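(* Let $H$ be a subcritical positive Schrödinger operator over $(X,m)$ and let $0<v\in\mathcal{F}$ be such that $\mathcal{H}v\ge0$. Then the following assertions are equivalent. (i) Every harmonic function $h$ bounded by $|h|\le v$ is zero. (ii) $G\mathcal{H}v=v$, i.e., $v\in\mathcal{P}$. (iii) One has for all $t>0$ that $$e^{-tH}v+\int_0^te^{-sH}\mathcal{H}v\,ds=v,$$ and $e^{-tH}v\to0$ pointwise as $t\to\infty$. (iv) For all superharmonic $u\in\mathcal{P}$, $$\sum_{x\in X}(\mathcal{H}u)(x)\,v(x)\,m(x)=\sum_{x\in X}u(x)\,(\mathcal{H}v)(x)\,m(x).$$
   Context: Let $X$ be a countable set and $m:X\to(0,\infty)$, viewed as the measure $m(A)=\sum_{x\in A}m(x)$. Let $b:X\times X\to[0,\infty)$ be symmetric with $b(x,x)=0$, $\sum_yb(x,y)<\infty$ for all $x$, and connected (for all $x,y$ there are $x=y_1,\dots,y_{n+1}=y$ with $b(y_i,y_{i+1})>0$). Let $c:X\to\mathbb{R}$ be a function (allowed to take negative values). Let $\mathcal{F}=\{f:X\to\mathbb{R}\mid\sum_yb(x,y)|f(y)|<\infty\text{ for all }x\}$ and, for $f\in\mathcal{F}$, $$\mathcal{H}f(x)=\frac1{m(x)}\sum_{y\in X}b(x,y)(f(x)-f(y))+\frac{c(x)}{m(x)}f(x).$$ The Schrödinger operator is called positive if there is a non-trivial function $w\ge0$ in $\mathcal{F}$ with $\mathcal{H}w\ge0$; equivalently, the form $h(\varphi)=\frac12\sum_{x,y}b(x,y)(\varphi(x)-\varphi(y))^2+\sum_xc(x)\varphi(x)^2$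 is non-negative on the finitely supported functions $C_c(X)$. In this case $H$ denotes the self-adjoint operator on $\ell^2(X,m)$ associated with the closure of $h$ on $C_c(X)$; it acts as $\mathcal{H}$ on its domain. The semigroup $e^{-tH}$ is positivity preserving and is extended to functions $f\ge0$ by $e^{-tH}f(x)=\sum_y(e^{-tH}1_y)(x)f(y)\in[0,\infty]$, where $1_y=1_{\{y\}}$. $H$ is subcritical if there is a function $w\ge0$, $w\neq0$, on $X$ with $h(\varphi)\ge\sum_xw(x)\varphi(x)^2$ for all $\varphi\in C_c(X)$. In this case the Green function $G(x,y)=\lim_{n\to\infty}(H_{K_n})^{-1}1_y(x)\in(0,\infty)$ exists, where $(K_n)$ is any increasing sequence of finite sets with union $X$ and $H_{K}$ is the restriction of $\mathcal{H}$ to functions on $K$ extended by zero (Dirichlet restriction). For $k\ge0$, or for $k\in\mathcal{G}=\{k:X\to\mathbb{R}\mid\sum_yG(x,y)|k(y)|<\infty\text{ for all }x\}$, put $Gk(x)=\sum_yG(x,y)k(y)$. The set of potentials is $\mathcal{P}=\{u\in\mathcal{F}\mid u=Gk\text{ for some }k\in\mathcal{G}\}$. A function $u\in\mathcal{F}$ is harmonic (superharmonic) if $\mathcal{H}u=0$ ($\mathcal{H}u\ge0$). In (iv) both sums have non-negative terms and may be infinite. *)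

(* Defs.v *)
From HB Require Import structures.
From mathcomp Require Import all_boot all_order all_algebra.
From mathcomp Require Import all_classical all_reals all_analysis.

Set Implicit Arguments.
Unset Strict Implicit.
Unset Printing Implicit Defensive.

Import Order.TTheory GRing.Theory Num.Theory.
Import numFieldNormedType.Exports.

Local Open Scope classical_set_scope.
Local Open Scope ring_scope.

(* The unordered sum of a real family: for a nonnegative family it is its sum
   in [0, +oo], for an absolutely summable one its (finite) sum. *)
Definition xsum (R : realType) (I : choiceType) (f : I -> R) : \bar R :=
  (esum [set: I] (EFin \o f)^\+ - esum [set: I] (EFin \o f)^\-)%E.

Definition rsum (R : realType) (I : choiceType) (f : I -> R) : R :=
  fine (xsum f).

Record weighted_graph (R : realType) (X : countType) (b : X -> X -> R) : Prop :=
  WeightedGraph {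
    weight_ge0 : forall x y, 0 <= b x y;
    weight_sym : forall x y, b x y = b y x;
    weight_diag : forall x, b x x = 0;
    weight_summable : forall x, summable [set: X] (EFin \o b x);
    weight_connected : forall x y, exists p : seq X,
      path (fun u v => 0 < b u v) x p /\ last x p = y }.

Section Schrodinger.
Variables (R : realType) (X : countType).
Variables (b : X -> X -> R) (m c : X -> R).
Implicit Types (f g u v w phi psi : X -> R) (x y : X).

Definition one_at y : X -> R := fun x => (x == y)%:R.

(* The space called F: sum_y b(x,y) |f(y)| is finite for all x. *)
Definition formal_dom f : Prop :=
  forall x, summable [set: X] (fun y => (b x y * f y)%:E).

(* The formal operator; it is meaningful on [formal_dom]. *)
Definition formal_op f : X -> R := fun x =>
  (m x)^-1 * rsum (fun y => b x y * (f x - f y)) + c x / m x * f x.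

Definition harmonic_fun u : Prop :=
  formal_dom u /\ forall x, formal_op u x = 0.

Definition superharmonic_fun u : Prop :=
  formal_dom u /\ forall x, 0 <= formal_op u x.

Definition positive_op : Prop :=
  exists w, [/\ forall x, 0 <= w x, exists x, w x != 0 & superharmonic_fun w].

(* C_c(X) *)
Definition fin_supp f : Prop := finite_set [set x | f x != 0].

(* The bilinear form on C_c(X) whose quadratic form is h. *)
Definition sform phi psi : R :=
  2^-1 * rsum (fun p : X * X =>
    b p.1 p.2 * ((phi p.1 - phi p.2) * (psi p.1 - psi p.2)))
  + rsum (fun x => c x * (phi x * psi x)).

Definition subcritical : Prop :=
  exists w, [/\ forall x, 0 <= w x, exists x, w x != 0 &
    forall phi, fin_supp phi ->
      rsum (fun x => w x * phi x ^+ 2) <= sform phi phi].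

(* l^2(X, m) *)
Definition l2sq f : \bar R := esum [set: X] (fun x => (m x * f x ^+ 2)%:E).

Definition l2 f : Prop := (l2sq f < +oo)%E.

Definition l2dot f g : R := rsum (fun x => m x * (f x * g x)).

(* [form_approx fn f]: fn is a sequence in C_c(X), Cauchy for the form and
   converging to f in l^2(X, m). *)
Definition form_approx (fn : nat -> X -> R) f : Prop :=
  [/\ forall n, fin_supp (fn n),
      (fun n => l2sq (fn n \- f)) @ \oo --> 0%E &
      forall e : R, 0 < e -> exists N : nat, forall n k : nat,
        (N <= n)%N -> (N <= k)%N ->
        sform (fn n \- fn k) (fn n \- fn k) < e].

(* The domain of the closure of the form, and the graph of the closed bilinear
   form: [closed_form f g r] says that its value at (f, g) is r. *)
Definition closed_form_dom f : Prop :=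
  l2 f /\ exists fn, form_approx fn f.

Definition closed_form f g (r : R) : Prop :=
  exists fn gn, [/\ form_approx fn f, form_approx gn g &
    (fun n => sform (fn n) (gn n)) @ \oo --> r].

(* The graph of the self-adjoint operator H associated with the closed form. *)
Definition assoc_op f g : Prop :=
  [/\ closed_form_dom f, l2 g &
      forall psi, closed_form_dom psi -> closed_form f psi (l2dot g psi)].

(* [T t] is e^{-tH}: T is the strongly continuous semigroup of bounded linear
   operators on l^2(X, m) whose infinitesimal generator is -H. Nothing is said
   on [T t f] for t < 0 or for f outside l^2(X, m). *)
Record semigroup_of (T : R -> (X -> R) -> X -> R) : Prop := SemigroupOf {
  semigroup_l2 : forall (t : R) f, 0 <= t -> l2 f -> l2 (T t f);
  semigroup_linear : forall (t a : R) f g, 0 <= t -> l2 f -> l2 g ->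
    T t (fun x => a * f x + g x) = (fun x => a * T t f x + T t g x);
  semigroup_bounded : forall t : R, 0 <= t ->
    exists C : R, forall f, l2 f -> (l2sq (T t f) <= C%:E * l2sq f)%E;
  semigroup0 : forall f, l2 f -> T 0 f = f;
  semigroupD : forall (s t : R) f, 0 <= s -> 0 <= t -> l2 f ->
    T (s + t) f = T s (T t f);
  semigroup_continuous : forall f, l2 f ->
    l2sq (T t f \- f) @[t --> 0^'+] --> 0%E;
  semigroup_generator : forall f g, l2 f -> l2 g ->
    (l2sq (fun x => t^-1 * (f x - T t f x) - g x) @[t --> 0^'+] --> 0%E) <->
    assoc_op f g }.

(* The extension of the semigroup to nonnegative functions. *)
Definition heat (T : R -> (X -> R) -> X -> R) (t : R) f x : \bar R :=
  xsum (fun y => T t (one_at y) x * f y).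

Definition exhaustion (K : nat -> set X) : Prop :=
  [/\ forall n, finite_set (K n), forall n k, (n <= k)%N -> K n `<=` K k &
      \bigcup_n K n = [set: X]].

(* (H_A)^{-1} g, for H_A the Dirichlet restriction to a finite set A; only the
   values of g on A matter. *)
Definition dirichlet_inv (A : set X) g : X -> R :=
  xget (fun=> 0) [set f | (forall x, ~ A x -> f x = 0) /\
                          (forall x, A x -> formal_op f x = g x)].

(* The Green function, computed along the exhaustion K. *)
Definition green (K : nat -> set X) x y : R :=
  lim ((fun n => dirichlet_inv (K n) (one_at y) x) @ \oo).

Definition green_dom (G : X -> X -> R) k : Prop :=
  forall x, summable [set: X] (fun y => (G x y * k y)%:E).

(* Gk, for k >= 0 (with values in [0, +oo]) or k in [green_dom G]. *)
Definition green_op (G : X -> X -> R) k x : \bar R :=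
  xsum (fun y => G x y * k y).

Definition potential (G : X -> X -> R) u : Prop :=
  formal_dom u /\
  exists k, green_dom G k /\ forall x, green_op G k x = (u x)%:E.

End Schrodinger.

(* Main.v *)
(* The potential theory rests on the minimum principle for the Dirichlet problem
   on finite sets, proved by comparison with the positive superharmonic function
   [v].  It gives the exhaustion [G_n] of the Green function, the inequality
   [G (H v) <= v] and the bound [h <= v - G_n (H v)] for harmonic [h <= v], hence
   (i) <-> (ii); the symmetry [m x * G x y = m y * G y x] and the choice
   [u = G(., y)] give (ii) <-> (iv).

   For (iii), write [p_t(x, y) = e^{-tH} 1_y (x)] and let [R_a = (H + a)^-1].
   Finite Dirichlet problems for [H + a] produce the resolvents, which are
   positive and increase to [G] as [a -> 0]; the representation of the form
   through [v] as a sum of squares makes it closable, so [H >= 0] and the implicit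
   Euler scheme [(1 + e H)^-1] is a positive contraction that converges to the
   semigroup.  Thus [p_t >= 0].  Integrating the derivative of
   [e^{-at} e^{-tH} R_a 1_y] and letting [a -> 0] yields
     [sum_z p_t(x, z) G(z, y) + int_0^t p_s(x, y) ds = G(x, y)]
   and [int_0^oo p_s(x, y) ds = G(x, y)], which sum against [H v] to
   (ii) <-> (iii). *)

Require Import Defs.
From HB Require Import structures.
From mathcomp Require Import all_boot all_order all_algebra finmap.
From mathcomp Require Import all_classical all_reals all_analysis.
From mathcomp Require Import measurable_realfun ring lra.

Set Implicit Arguments.
Unset Strict Implicit.
Unset Printing Implicit Defensive.

Import Order.TTheory GRing.Theory Num.Theory.
Import numFieldNormedType.Exports.

Local Open Scope classical_set_scope.
Local Open Scope ring_scope.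

(** * Unordered sums *)

(** Since [c] may be negative, constants need not be superharmonic, and [v] takes their place: the
    minimum principle looks at [f / v], and the form becomes a sum of squares in [phi / v]. A second
    obstacle is that neither [v] nor [G(., y)] need be square summable, so the semigroup, which
    lives on l^2, does not act on them directly. The semigroup identities are therefore proved for
    resolvents with [a > 0], evaluated at one point, and extended by limits and exchanges of
    nonnegative sums. Finally, [semigroup_of] describes [T] through strong continuity at 0, a bound
    for each single time and the generator; uniform bounds on time intervals, two-sided derivatives
    and positivity have to be derived from these. The function [1_y] need not lie in the domain of
    [H], only in that of the form. This is why positivity is obtained first for functions smoothed
    twice by the Euler step, and why a rate for the smoothing in terms of [h(1_y)] is needed. *)

Section Esum.
Local Open Scope ereal_scope.
Variables (R : realType) (I : choiceType).
Implicit Types (f g : I -> \bar R) (s : seq I).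

Lemma sum_le_esum f s : uniq s -> (forall i, 0 <= f i) ->
  \sum_(i <- s) f i <= \esum_(i in setT) f i.
Proof.
move=> us f0; apply: esum_ge; exists [set` s]; first by split.
by rewrite fsbig_seq.
Qed.

Lemma esum_le_ub f C : (forall s, uniq s -> \sum_(i <- s) f i <= C) ->
  \esum_(i in setT) f i <= C.
Proof.
move=> H; apply: ge_ereal_sup => _ [A [finA _] <-].
by rewrite fsbig_finite//=; apply: H; exact: fset_uniq.
Qed.

Lemma esum_gt f (a : \bar R) : a < \esum_(i in setT) f i ->
  exists2 s, uniq s & a < \sum_(i <- s) f i.
Proof.
move=> /ereal_sup_gt[_ [A [finA _] <-]].
by rewrite fsbig_finite//= => ?; exists (fset_set A).
Qed.

(** Monotone convergence along an arbitrary proper filter: domination by the limit replaces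
    monotonicity. Finite partial sums converge, which bounds the limit from below, and domination
    bounds it from above. It serves sequences as well as [t --> +oo]. *)
Lemma esum_cvg U (F : set_system U) {FF : ProperFilter F} (g : U -> I -> \bar R) f :
  (\forall u \near F, forall i, 0 <= g u i <= f i) ->
  (forall i, g u i @[u --> F] --> f i) ->
  \esum_(i in setT) g u i @[u --> F] --> \esum_(i in setT) f i.
Proof.
move=> gf gcvg.
have [u0 /= gf0] := filter_ex gf.
have f0 i : 0 <= f i by have /andP[a b] := gf0 i; exact: le_trans b.
have H a : a < \esum_(i in setT) f i ->
    \forall u \near F, a < \esum_(i in setT) g u i.
  move=> /esum_gt[s us asf].
  have cs : \sum_(i <- s) g u i @[u --> F] --> \sum_(i <- s) f i.
    apply: cvg_nnesum => i _; last exact: gcvg.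
    by apply: filterS gf => u /(_ i)/andP[].
  near=> u; apply: lt_le_trans (sum_le_esum us _); last first.
    by move=> i; have /(_ i)/andP[] : forall i, 0 <= g u i <= f i by near: u.
  near: u; apply: (cs [set x | a < x]).
  by apply: open_nbhs_nbhs; split => //; exact: open_ereal_gt_ereal.
have le : \forall u \near F, \esum_(i in setT) g u i <= \esum_(i in setT) f i.
  apply: filterS gf => u gfu; apply: le_esum => i _.
  by have /andP[] := gfu i.
have : 0 <= \esum_(i in setT) f i by apply: esum_ge0.
case E : (\esum_(i in setT) f i) => [r| |]// r0; last first.
  by apply/cvgeyPgt => A; apply: H; rewrite E ltry.
apply/fine_cvgP; split.
  near=> u; have : \esum_(i in setT) g u i <= r%:E by rewrite -E; near: u.
  have : (-1)%:E < \esum_(i in setT) g u i.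
    by near: u; apply: H; rewrite E (lt_le_trans _ r0)// lte_fin.
  by case: (\esum_(i in setT) g u i).
apply/cvgrPdist_le => e e0; near=> u => /=.
have : \esum_(i in setT) g u i <= r%:E by rewrite -E; near: u.
have : (r - e)%:E < \esum_(i in setT) g u i.
  by near: u; apply: H; rewrite E lte_fin ltrBlDr ltrDl.
case: (\esum_(i in setT) g u i) => [x| |]//=.
by rewrite !lte_fin lee_fin => h1 h2; rewrite ger0_norm; lra.
Unshelve. all: by end_near. Qed.

Lemma esumZl f (a : R) : (0 <= a)%R -> (forall i, 0 <= f i) ->
  \esum_(i in setT) (a%:E * f i) = a%:E * \esum_(i in setT) f i.
Proof.
move=> a0 f0; have le (c : R) (h : I -> \bar R) : (0 <= c)%R -> (forall i, 0 <= h i) ->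
    \esum_(i in setT) (c%:E * h i) <= c%:E * \esum_(i in setT) h i.
  move=> c0 h0; apply: esum_le_ub => s us.
  rewrite -ge0_sume_distrr//; apply: lee_wpmul2l; first by rewrite lee_fin.
  exact: sum_le_esum.
apply/eqP; rewrite eq_le le//=.
have [->|an0] := eqVneq a 0%R.
  by rewrite mul0e; apply: esum_ge0 => i _; rewrite mul0e.
have ap : (0 < a)%R by rewrite lt_def an0.
have := le a^-1%R (fun i => a%:E * f i); rewrite invr_ge0 => /(_ a0).
under eq_esum do rewrite muleA -EFinM mulVf// mul1e.
by move=> H; rewrite -lee_pdivlMl//; apply: H => i; exact: mule_ge0.
Qed.

End Esum.

Lemma esum_swap (R : realType) (I J : choiceType) (a : I -> J -> \bar R) :
  (forall i j, (0 <= a i j)%E) ->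
  \esum_(i in setT) \esum_(j in setT) a i j =
  \esum_(j in setT) \esum_(i in setT) a i j.
Proof.
move=> a0; rewrite (esum_esum (J := fun=> setT))//.
rewrite (esum_esum (J := fun=> setT) (a := fun j i => a i j))//.
rewrite (reindex_esum (setT `*`` (fun _ : J => @setT I)) _ (fun p => (p.2, p.1)))//.
split => //.
- by move=> [x y] [x' y'] _ _ /= [-> ->].
- by move=> [x y] _ /=; exists (y, x).
Qed.

Definition rsummable (R : realType) (I : choiceType) (f : I -> R) : Prop :=
  summable [set: I] (EFin \o f).

Section RealSums.
Variables (R : realType) (I : choiceType).
Implicit Types (f g : I -> R) (s : seq I).

Lemma rsummable_ltyE f :
  rsummable f <-> (\esum_(i in setT) (`|f i|)%:E < +oo)%E.
Proof. by []. Qed.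

Lemma rsummable_le f g : (forall i, `|f i| <= g i) -> rsummable g -> rsummable f.
Proof.
move=> fg; apply: le_lt_trans; apply: le_esum => i _ /=.
by rewrite lee_fin (le_trans (fg i))// ler_norm.
Qed.

Lemma rsummableD f g : rsummable f -> rsummable g -> rsummable (fun i => f i + g i).
Proof. exact: summableD. Qed.

Lemma rsummableZ f a : rsummable f -> rsummable (fun i => a * f i).
Proof.
move=> sf; apply/rsummable_ltyE.
under eq_esum do rewrite normrM EFinM.
by rewrite esumZl//; apply: lte_mul_pinfty => //; rewrite lee_fin.
Qed.

Lemma rsummable_norm f : rsummable f -> rsummable (fun i => `|f i|).
Proof.
by rewrite !rsummable_ltyE; under [in X in _ -> X]eq_esum do rewrite normr_id.
Qed.

Lemma rsummableN f : rsummable f -> rsummable (fun i => - f i).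
Proof.
by move=> /rsummable_norm sf; apply: rsummable_le sf => i; rewrite normrN.
Qed.

Lemma rsummableB f g : rsummable f -> rsummable g -> rsummable (fun i => f i - g i).
Proof. by move=> sf sg; apply: rsummableD => //; exact: rsummableN. Qed.

Lemma rsummable_ge0 f : (forall i, 0 <= f i) ->
  rsummable f <-> (\esum_(i in setT) (f i)%:E < +oo)%E.
Proof.
move=> f0; rewrite rsummable_ltyE; under eq_esum do rewrite ger0_norm//.
by [].
Qed.

Lemma xsum_ge0 f : (forall i, 0 <= f i) -> xsum f = \esum_(i in setT) (f i)%:E.
Proof.
move=> f0; rewrite /xsum [X in (_ - X)%E]esum1 ?sube0; last first.
  by move=> i _; rewrite funenegE; apply/max_idPr; rewrite lee_fin oppr_le0.
by apply: eq_esum => i _; rewrite funeposE /= max_l// lee_fin.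
Qed.

Lemma rsumE f : (forall i, 0 <= f i) -> rsummable f ->
  \esum_(i in setT) (f i)%:E = (rsum f)%:E.
Proof.
move=> f0 sf; rewrite /rsum xsum_ge0// fineK// ge0_fin_numE.
  exact: (rsummable_ge0 f0).1 sf.
by apply: esum_ge0 => i _; rewrite lee_fin.
Qed.

Lemma xsum_sub f g : (forall i, 0 <= f i) -> (forall i, 0 <= g i) ->
  rsummable f -> rsummable g ->
  xsum (fun i => f i - g i) = (rsum f - rsum g)%:E.
Proof.
move=> f0 g0 sf sg; rewrite EFinB -!rsumE//.
by have := @esumB R I setT _ _ sf sg; apply => i _ /=; rewrite lee_fin.
Qed.

Let pos f i := Num.max (f i) 0.
Let neg f i := Num.max (- f i) 0.

Let pos_ge0 f i : 0 <= pos f i. Proof. by rewrite le_max lexx orbT. Qed.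
Let neg_ge0 f i : 0 <= neg f i. Proof. by rewrite le_max lexx orbT. Qed.

Let pos_neg f i : f i = pos f i - neg f i.
Proof.
rewrite /pos /neg; have [h|/ltW h] := leP (f i) 0.
  by rewrite max_l ?oppr_ge0// opprK add0r.
by rewrite max_r ?oppr_le0// subr0.
Qed.

Let spos f : rsummable f -> rsummable (pos f).
Proof.
move/rsummable_norm; apply: rsummable_le => i.
by rewrite /pos ger0_norm ?le_max ?lexx ?orbT// ge_max ler_norm normr_ge0.
Qed.

Let sneg f : rsummable f -> rsummable (neg f).
Proof.
move/rsummable_norm; apply: rsummable_le => i.
by rewrite /neg ger0_norm ?le_max ?lexx ?orbT// ge_max -normrN ler_norm normr_ge0.
Qed.

Lemma eq_xsum f g : f =1 g -> xsum f = xsum g.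
Proof. by move=> /funext ->. Qed.

Lemma eq_rsum f g : f =1 g -> rsum f = rsum g.
Proof. by move=> /funext ->. Qed.

Lemma xsum_rsum f : rsummable f -> xsum f = (rsum f)%:E.
Proof.
move=> sf; rewrite /rsum (eq_xsum (pos_neg f)) xsum_sub//.
- exact: spos.
- exact: sneg.
Qed.

Lemma rsum_sub f g : (forall i, 0 <= f i) -> (forall i, 0 <= g i) ->
  rsummable f -> rsummable g ->
  rsum (fun i => f i - g i) = rsum f - rsum g.
Proof. by move=> *; rewrite {1}/rsum xsum_sub. Qed.

Let rsumD_ge0 f g : (forall i, 0 <= f i) -> (forall i, 0 <= g i) ->
  rsummable f -> rsummable g -> rsum (fun i => f i + g i) = rsum f + rsum g.
Proof.
move=> f0 g0 sf sg; apply: EFin_inj; rewrite EFinD -!rsumE//.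
- rewrite -esumD; [by apply: eq_esum => i _; rewrite EFinD| |];
  by move=> i _; rewrite lee_fin.
- by move=> i; rewrite addr_ge0.
- exact: rsummableD.
Qed.

Lemma rsumN f : rsummable f -> rsum (fun i => - f i) = - rsum f.
Proof.
move=> sf; have := spos sf; have := sneg sf => sn sp.
rewrite [in RHS](eq_rsum (pos_neg f)) rsum_sub// opprB -rsum_sub//.
by apply: eq_rsum => i; rewrite {1}(pos_neg f i) opprB.
Qed.

Lemma rsumD f g : rsummable f -> rsummable g ->
  rsum (fun i => f i + g i) = rsum f + rsum g.
Proof.
move=> sf sg; have pf := spos sf; have nf := sneg sf.
have pg := spos sg; have ng := sneg sg.
rewrite (@eq_rsum _ (fun i => (pos f i + pos g i) - (neg f i + neg g i))); last first.
  by move=> i; rewrite {1}(pos_neg f i) {1}(pos_neg g i); ring.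
rewrite rsum_sub ?rsumD_ge0//; try exact: rsummableD.
- rewrite (eq_rsum (pos_neg f)) (eq_rsum (pos_neg g)) !rsum_sub//; ring.
- by move=> i; rewrite addr_ge0.
- by move=> i; rewrite addr_ge0.
Qed.

Lemma rsumB f g : rsummable f -> rsummable g ->
  rsum (fun i => f i - g i) = rsum f - rsum g.
Proof. by move=> sf sg; rewrite rsumD ?rsumN//; exact: rsummableN. Qed.

Lemma rsum_ge0 f : (forall i, 0 <= f i) -> 0 <= rsum f.
Proof.
by move=> f0; rewrite /rsum xsum_ge0// fine_ge0// esum_ge0// => i _; rewrite lee_fin.
Qed.

Lemma ler_rsum f g : rsummable f -> rsummable g -> (forall i, f i <= g i) ->
  rsum f <= rsum g.
Proof.
move=> sf sg fg; rewrite -subr_ge0 -rsumB//; apply: rsum_ge0 => i.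
by rewrite subr_ge0.
Qed.

Let rsumZ_ge0 f a : 0 <= a -> (forall i, 0 <= f i) -> rsummable f ->
  rsum (fun i => a * f i) = a * rsum f.
Proof.
move=> a0 f0 sf; apply: EFin_inj; rewrite EFinM -!rsumE//.
- by rewrite -esumZl//.
- by move=> i; rewrite mulr_ge0.
- exact: rsummableZ.
Qed.

Lemma rsumZ f a : rsummable f -> rsum (fun i => a * f i) = a * rsum f.
Proof.
move=> sf; have pf := spos sf; have nf := sneg sf.
wlog a0 : a / 0 <= a => [H|].
  have [|/ltW a0] := leP 0 a; first exact: H.
  have := H (- a); rewrite oppr_ge0 => /(_ a0).
  rewrite (@eq_rsum _ (fun i => - (a * f i))); last by move=> i; ring.
  by rewrite rsumN ?mulNr; [move/oppr_inj|exact: rsummableZ].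
rewrite (@eq_rsum _ (fun i => a * pos f i - a * neg f i)); last first.
  by move=> i; rewrite {1}(pos_neg f i) mulrBr.
rewrite rsumB; try exact: rsummableZ.
by rewrite !rsumZ_ge0// -mulrBr -rsum_sub// -(eq_rsum (pos_neg f)).
Qed.

Lemma rsummable_ub f C : (forall i, 0 <= f i) ->
  (forall s, uniq s -> \sum_(i <- s) f i <= C) -> rsummable f /\ rsum f <= C.
Proof.
move=> f0 H; have le : (\esum_(i in setT) (f i)%:E <= C%:E)%E.
  by apply: esum_le_ub => s us; rewrite sumEFin lee_fin H.
have sf : rsummable f by apply/rsummable_ge0 => //; apply: le_lt_trans le _; rewrite ltry.
by split=> //; rewrite -lee_fin -rsumE.
Qed.

Lemma sum_le_rsum f s : uniq s -> (forall i, 0 <= f i) -> rsummable f ->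
  \sum_(i <- s) f i <= rsum f.
Proof.
move=> us f0 sf; rewrite -lee_fin -rsumE// -sumEFin; exact: sum_le_esum.
Qed.

Lemma term_le_rsum f i : (forall i, 0 <= f i) -> rsummable f -> f i <= rsum f.
Proof.
by move=> f0 sf; have := @sum_le_rsum f [:: i] isT f0 sf; rewrite big_seq1.
Qed.

Let fin_supp_le f s t : uniq s -> uniq t -> (forall i, i \notin s -> f i = 0) ->
  (forall i, 0 <= f i) -> \sum_(i <- t) f i <= \sum_(i <- s) f i.
Proof.
move=> us ut fs f0; rewrite (bigID (mem s))/= [X in _ + X]big1 ?addr0; last first.
  by move=> i; exact: fs.
rewrite -big_filter (perm_big [seq i <- s | i \in t]); last first.
  apply: uniq_perm; rewrite ?filter_uniq// => i.
  by rewrite !mem_filter andbC.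
by rewrite big_filter [leRHS](bigID (mem t))/= lerDl sumr_ge0.
Qed.

Lemma rsummable_fin f s : (forall i, i \notin s -> f i = 0) -> rsummable f.
Proof.
move=> fs; apply/rsummable_ltyE.
apply: (@le_lt_trans _ _ (\sum_(i <- undup s) `|f i|)%:E); last by rewrite ltry.
apply: esum_le_ub => t ut; rewrite sumEFin lee_fin; apply: fin_supp_le => //.
  exact: undup_uniq.
by move=> i; rewrite mem_undup => /fs ->; rewrite normr0.
Qed.

Let rsum_fin_ge0 f s : uniq s -> (forall i, i \notin s -> f i = 0) ->
  (forall i, 0 <= f i) -> rsum f = \sum_(i <- s) f i.
Proof.
move=> us fs f0; apply/eqP; rewrite eq_le; apply/andP; split.
  by apply: (rsummable_ub _ _).2 => // t ut; exact: fin_supp_le.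
by apply: sum_le_rsum => //; exact: rsummable_fin fs.
Qed.

Lemma rsum_fin f s : uniq s -> (forall i, i \notin s -> f i = 0) ->
  rsum f = \sum_(i <- s) f i.
Proof.
move=> us fs; have sf := rsummable_fin fs.
rewrite (eq_rsum (pos_neg f)) rsum_sub//; [|exact: spos|exact: sneg].
rewrite !(@rsum_fin_ge0 _ s)//.
- by rewrite -sumrB; apply: eq_bigr => i _; rewrite -pos_neg.
- by move=> i /fs fi; rewrite /neg fi oppr0 max_l.
- by move=> i /fs fi; rewrite /pos fi max_l.
Qed.

Lemma rsum0 : rsum (fun _ : I => 0 : R) = 0.
Proof. by rewrite (@rsum_fin _ [::])// big_nil. Qed.

Lemma rsum_cvg U (F : set_system U) {FF : ProperFilter F} (g : U -> I -> R) f :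
  (\forall u \near F, forall i, 0 <= g u i <= f i) -> rsummable f ->
  (forall i, g u i @[u --> F] --> f i) ->
  rsum (g u) @[u --> F] --> rsum f.
Proof.
move=> gf sf gcvg; have [u0 /= gf0] := filter_ex gf.
have f0 i : 0 <= f i by have /andP[a b] := gf0 i; exact: le_trans b.
have sg : \forall u \near F, rsummable (g u).
  by apply: filterS gf => u gfu; apply: rsummable_le sf => i;
     have /andP[a b] := gfu i; rewrite ger0_norm.
have cE : (rsum (g u))%:E @[u --> F] --> (rsum f)%:E.
  rewrite -rsumE//; apply: (@cvg_trans _ (\esum_(i in setT) (g u i)%:E @[u --> F])).
    apply: near_eq_cvg; near=> u.
    rewrite rsumE//; last by near: u.
    by move=> i; have /(_ i)/andP[] : forall i, 0 <= g u i <= f i by near: u.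
  apply: esum_cvg => [|i].
    by apply: filterS gf => u gfu i; rewrite !lee_fin.
  by apply: cvg_EFin; [exact: nearW|exact: gcvg].
exact: (fine_cvg cE).
Unshelve. all: by end_near. Qed.

End RealSums.

Lemma cvg_sumr (R : realType) (I : Type) (T : Type) (F : set_system T)
    (FF : Filter F) (s : seq I) (f : I -> T -> R) (l : I -> R) :
  (forall i, f i t @[t --> F] --> l i) ->
  \sum_(i <- s) f i t @[t --> F] --> \sum_(i <- s) l i.
Proof. by move=> fl; apply: cvg_big => [|i _]; [exact: add_continuous|]. Qed.

(** * The formal operator and the form *)

Section PairSums.
Variables (R : realType) (X : choiceType).
Implicit Types (F : X -> X -> R) (s : seq X).

Lemma rsummable_swap F : rsummable (fun p : X * X => F p.1 p.2) ->
  rsummable (fun p : X * X => F p.2 p.1).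
Proof.
apply: le_lt_trans.
rewrite [leLHS](reindex_esum setT setT (fun p : X * X => (p.2, p.1)))//=.
split => //; first by move=> [x y] [x' y'] _ _ /= [-> ->].
by move=> [x y] _ /=; exists (y, x).
Qed.

Let rsum_swap_ge0 F : (forall x y, 0 <= F x y) ->
  rsum (fun p : X * X => F p.2 p.1) = rsum (fun p : X * X => F p.1 p.2).
Proof.
move=> F0; rewrite /rsum !xsum_ge0//; congr fine.
rewrite [RHS](reindex_esum setT setT (fun p : X * X => (p.2, p.1))) //=.
split => //; first by move=> [x y] [x' y'] _ _ /= [-> ->].
by move=> [x y] _ /=; exists (y, x).
Qed.

Lemma rsum_swap F : rsummable (fun p : X * X => F p.1 p.2) ->
  rsum (fun p : X * X => F p.2 p.1) = rsum (fun p : X * X => F p.1 p.2).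
Proof.
move=> sF; have sN := rsummable_norm sF.
have sF' := rsummable_swap sF; have sN' := rsummable_norm sF'.
(* Both [|G|] and [|G| - G] are nonnegative and summable, so a signed sum reduces to two nonnegative
   ones. *)
have E (G : X -> X -> R) : rsummable (fun p : X * X => G p.1 p.2) ->
    rsum (fun p : X * X => G p.1 p.2) = rsum (fun p : X * X => `|G p.1 p.2|)
     - rsum (fun p : X * X => `|G p.1 p.2| - G p.1 p.2).
  move=> sG; have sNG := rsummable_norm sG.
  by rewrite rsumB//; ring.
rewrite E// (E (fun x y => F y x))//; congr (_ - _).
  by rewrite (rsum_swap_ge0 (F := fun x y => `|F x y|)).
rewrite (rsum_swap_ge0 (F := fun x y => `|F x y| - F x y))// => x y.
by rewrite subr_ge0 ler_norm.
Qed.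

(** Finitely many nonzero rows, each possibly infinite: this is the shape of form sums against a
    finitely supported function on a graph that need not be locally finite. *)
Lemma esum_rows s F : uniq s -> (forall x y, x \notin s -> F x y = 0) ->
  (forall x y, 0 <= F x y) -> (forall x, rsummable (F x)) ->
  \esum_(p in setT) (F p.1 p.2)%:E = (\sum_(x <- s) rsum (F x))%:E.
Proof.
move=> us Fs F0 sF.
rewrite (_ : \esum_(p in setT) (F p.1 p.2)%:E =
             \esum_(x in setT) \esum_(y in setT) (F x y)%:E); last first.
  rewrite (esum_esum (J := fun=> setT)); last by move=> i j _ _; rewrite lee_fin.
  by congr esum; apply/seteqP; split.
under eq_esum do rewrite rsumE//.
rewrite rsumE; [|by move=> x; exact: rsum_ge0|].
  rewrite (rsum_fin us)// => x xs; rewrite (eq_rsum (g := fun=> 0)) ?rsum0//.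
  by move=> y; exact: Fs.
apply: (@rsummable_fin _ _ _ s) => x xs.
by rewrite (eq_rsum (g := fun=> 0)) ?rsum0// => y; exact: Fs.
Qed.

Lemma rsummable_rows s F : uniq s -> (forall x y, x \notin s -> F x y = 0) ->
  (forall x, rsummable (F x)) -> rsummable (fun p : X * X => F p.1 p.2).
Proof.
move=> us Fs sF; apply/rsummable_ltyE.
rewrite (@esum_rows s (fun x y => `|F x y|))// ?ltry// => [x y /Fs ->|x].
  by rewrite normr0.
exact: rsummable_norm.
Qed.

Lemma rsum_rows s F : uniq s -> (forall x y, x \notin s -> F x y = 0) ->
  (forall x, rsummable (F x)) ->
  rsum (fun p : X * X => F p.1 p.2) = \sum_(x <- s) rsum (F x).
Proof.
move=> us Fs sF.
have sN x := rsummable_norm (sF x).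
have sF2 := rsummable_rows us Fs sF.
have sN2 := rsummable_norm sF2.
have H (G : X -> X -> R) : (forall x y, x \notin s -> G x y = 0) ->
    (forall x y, 0 <= G x y) -> (forall x, rsummable (G x)) ->
    rsum (fun p : X * X => G p.1 p.2) = \sum_(x <- s) rsum (G x).
  move=> Gs G0 sG; rewrite /rsum xsum_ge0; last by move=> [].
  by rewrite (esum_rows us).
have -> : rsum (fun p : X * X => F p.1 p.2) =
    rsum (fun p : X * X => `|F p.1 p.2|)
     - rsum (fun p : X * X => `|F p.1 p.2| - F p.1 p.2).
  by rewrite rsumB//; ring.
rewrite (H (fun x y => `|F x y|))//; last by move=> x y /Fs ->; rewrite normr0.
rewrite (H (fun x y => `|F x y| - F x y)).
- rewrite -sumrB; apply: eq_bigr => x _; rewrite rsumB//; ring.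
- by move=> x y /Fs ->; rewrite normr0 subr0.
- by move=> x y; rewrite subr_ge0 ler_norm.
- by move=> x; apply: rsummableB.
Qed.

End PairSums.

(** * The formal operator and Green's formula *)

Section FormalOp.
Variables (R : realType) (X : countType) (b : X -> X -> R) (m : X -> R).
Hypothesis hm : forall x, 0 < m x.
Hypothesis hb : weighted_graph b.
Implicit Types (c f g u w phi psi : X -> R) (x y : X) (s : seq X).

Definition nbr_sum f x : R := rsum (fun y => b x y * f y).

Definition total_deg c x : R := rsum (b x) + c x.

(* [x |-> m x * formal_op f x], which does not depend on [m] *)
Definition lap c f x : R := total_deg c x * f x - nbr_sum f x.

Lemma formal_domE f : formal_dom b f <-> forall x, rsummable (fun y => b x y * f y).
Proof. by []. Qed.

Lemma formal_domD f g : formal_dom b f -> formal_dom b g ->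
  formal_dom b (fun x => f x + g x).
Proof.
move=> /formal_domE df /formal_domE dg x; have := rsummableD (df x) (dg x).
by under eq_fun do rewrite -mulrDr.
Qed.

Lemma formal_domZ f a : formal_dom b f -> formal_dom b (fun x => a * f x).
Proof.
move=> /formal_domE df x; have := rsummableZ a (df x).
by under eq_fun do rewrite mulrCA.
Qed.

Lemma formal_domB f g : formal_dom b f -> formal_dom b g ->
  formal_dom b (fun x => f x - g x).
Proof.
move=> df dg; have := formal_domD df (formal_domZ (-1) dg).
by under eq_fun do rewrite mulN1r.
Qed.

Lemma formal_dom_fin f s : (forall x, x \notin s -> f x = 0) -> formal_dom b f.
Proof.
move=> fs x; apply: (@rsummable_fin _ _ _ s) => y /fs ->.
by rewrite mulr0.
Qed.

Lemma formal_opE c f x : formal_dom b f ->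
  formal_op b m c f x = (m x)^-1 * lap c f x.
Proof.
move=> /formal_domE df; rewrite /formal_op /lap /total_deg.
rewrite (eq_rsum (g := fun y => f x * b x y - b x y * f y)); last by move=> y; ring.
have sb : rsummable (b x) by exact: (weight_summable hb).
rewrite rsumB ?rsumZ//; last exact: rsummableZ.
by rewrite /nbr_sum; ring.
Qed.

Lemma lapE c f x : formal_dom b f -> lap c f x = m x * formal_op b m c f x.
Proof. by move=> df; rewrite formal_opE// mulrA divff ?mul1r ?gt_eqF. Qed.

Lemma nbr_sumD f g x : formal_dom b f -> formal_dom b g ->
  nbr_sum (fun x => f x + g x) x = nbr_sum f x + nbr_sum g x.
Proof.
move=> /formal_domE df /formal_domE dg; rewrite /nbr_sum -rsumD//.
by apply: eq_rsum => y; rewrite mulrDr.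
Qed.

Lemma nbr_sumZ f a x : formal_dom b f ->
  nbr_sum (fun x => a * f x) x = a * nbr_sum f x.
Proof.
move=> /formal_domE df; rewrite /nbr_sum -rsumZ//.
by apply: eq_rsum => y; rewrite mulrCA.
Qed.

Lemma lapD c f g x : formal_dom b f -> formal_dom b g ->
  lap c (fun x => f x + g x) x = lap c f x + lap c g x.
Proof. by move=> df dg; rewrite /lap nbr_sumD//; ring. Qed.

Lemma lapZ c f a x : formal_dom b f -> lap c (fun x => a * f x) x = a * lap c f x.
Proof. by move=> df; rewrite /lap nbr_sumZ//; ring. Qed.

Lemma lapB c f g x : formal_dom b f -> formal_dom b g ->
  lap c (fun x => f x - g x) x = lap c f x - lap c g x.
Proof.
move=> df dg; have -> : (fun x => f x - g x) = (fun x => f x + (-1) * g x).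
  by apply/funext => y; rewrite mulN1r.
by rewrite lapD ?lapZ// ?mulN1r//; exact: formal_domZ.
Qed.

Lemma lap0 c x : lap c (fun=> 0) x = 0.
Proof.
rewrite /lap mulr0 /nbr_sum (eq_rsum (g := fun=> 0)) ?rsum0 ?subrr// => y.
by rewrite mulr0.
Qed.

Lemma lap_sum c (J : Type) (r : seq J) (a : J -> R) (F : J -> X -> R) :
  (forall j, formal_dom b (F j)) ->
  formal_dom b (fun x => \sum_(j <- r) a j * F j x) /\
  forall x, lap c (fun x => \sum_(j <- r) a j * F j x) x =
            \sum_(j <- r) a j * lap c (F j) x.
Proof.
move=> dF; elim: r => [|j r [IH1 IH2]].
  under eq_fun do rewrite big_nil; split.
    by apply: (@formal_dom_fin _ [::]).
  by move=> x; rewrite lap0 big_nil.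
under eq_fun do rewrite big_cons; split.
  by apply: formal_domD => //; exact: formal_domZ.
by move=> x; rewrite big_cons lapD ?lapZ// ?IH2//; exact: formal_domZ.
Qed.

Lemma formal_dom_one y : formal_dom b (one_at R y).
Proof.
by apply: (@formal_dom_fin _ [:: y]) => x; rewrite inE /one_at => /negPf ->.
Qed.

Lemma lap_shift c f x (a : R) :
  lap (fun x => c x + a * m x) f x = lap c f x + a * m x * f x.
Proof. by rewrite /lap /total_deg; ring. Qed.

(** Green's formula. Only [phi] has finite support, so the double sum is cut into [F], [G] and their
    transposes, each with finitely many nonzero rows or columns; the symmetry of [b] makes the
    transposed part equal to the first, which cancels the factor 1/2. *)
Lemma sformE c phi psi s : uniq s -> (forall x, x \notin s -> phi x = 0) ->
  formal_dom b psi ->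
  sform b c phi psi = \sum_(x <- s) phi x * lap c psi x.
Proof.
move=> us phis /formal_domE dpsi.
have sb x : rsummable (b x) by exact: (weight_summable hb).
pose F x y := phi x * psi x * b x y.
pose G x y := phi x * (b x y * psi y).
have Fs x y : x \notin s -> F x y = 0 by move=> /phis h; rewrite /F h !mul0r.
have Gs x y : x \notin s -> G x y = 0 by move=> /phis h; rewrite /G h !mul0r.
have sF x : rsummable (F x) by exact: rsummableZ.
have sG x : rsummable (G x) by exact: rsummableZ.
have sF2 := rsummable_rows us Fs sF; have sG2 := rsummable_rows us Gs sG.
have sF3 := rsummable_swap sF2; have sG3 := rsummable_swap sG2.
rewrite /sform (eq_rsum (g := fun p => (F p.1 p.2 - G p.1 p.2)
   + (F p.2 p.1 - G p.2 p.1))); last first.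
  by move=> [x y]; rewrite /F /G (weight_sym hb y x)/=; ring.
rewrite rsumD; try exact: rsummableB.
rewrite !rsumB// !(rsum_swap (F := F))// !(rsum_swap (F := G))//.
rewrite (rsum_rows us Fs sF) (rsum_rows us Gs sG).
rewrite [X in _ + X](@rsum_fin _ _ _ s)//; last first.
  by move=> x /phis ->; rewrite mul0r mulr0.
have half (z : R) : 2^-1 * (z + z) = z by field.
rewrite half -sumrB -big_split/=.
apply: eq_bigr => x _; rewrite /F /G !rsumZ// /lap /total_deg /nbr_sum; ring.
Qed.

Lemma sformC c phi psi : sform b c phi psi = sform b c psi phi.
Proof.
rewrite /sform; congr (_ * _ + _); apply: eq_rsum => x.
  by congr (_ * _); rewrite mulrC.
by congr (_ * _); rewrite mulrC.
Qed.

Lemma fin_suppP f : fin_supp f ->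
  exists2 s, uniq s & forall x, x \notin s -> f x = 0.
Proof.
move=> ff; exists (fset_set [set x | f x != 0]); first exact: fset_uniq.
by move=> x; rewrite in_fset_set// notin_setE/= => /negP; rewrite negbK => /eqP.
Qed.

Lemma fin_supp_seq f s : (forall x, x \notin s -> f x = 0) -> fin_supp f.
Proof.
move=> fs; apply: (@sub_finite_set _ _ [set` s]); last exact: finite_seq.
by move=> x /= fx0; apply: contraNT fx0 => /fs ->.
Qed.

Lemma fin_supp_one y : fin_supp (one_at R y).
Proof.
by apply: (@fin_supp_seq _ [:: y]) => x; rewrite inE /one_at => /negPf ->.
Qed.

End FormalOp.

(** * Dirichlet problems on finite sets *)

Lemma seq_argmin (R : realDomainType) (I : eqType) (s : seq I) (g : I -> R) (x0 : I) : x0 \in s ->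
  exists2 y, y \in s & forall x, x \in s -> g y <= g x.
Proof.
move=> x0s.
suff H t : t != [::] -> exists2 y, y \in t & forall x, x \in t -> g y <= g x.
  by apply: H; apply: contraTneq x0s => ->.
elim: t => // a t IH _; have [->|/IH[y yt hy]] := eqVneq t [::].
  by exists a; rewrite ?mem_head// => x; rewrite inE => /eqP ->.
have [ag|/ltW ga] := leP (g a) (g y).
  exists a; rewrite ?mem_head// => x; rewrite inE => /orP[/eqP ->//|/hy].
  exact: le_trans.
exists y; first by rewrite inE yt orbT.
by move=> x; rewrite inE => /orP[/eqP ->//|/hy].
Qed.

Section Dirichlet.
Variables (R : realType) (X : countType) (b : X -> X -> R) (m c : X -> R).
Variable v : X -> R.
Hypothesis hm : forall x, 0 < m x.
Hypothesis hb : weighted_graph b.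
Hypothesis hsub : subcritical b c.
Hypothesis hv0 : forall x, 0 < v x.
Hypothesis hv : superharmonic_fun b m c v.
Implicit Types (f g u w phi psi : X -> R) (x y : X) (s : seq X) (A B : set X).

Let dv : formal_dom b v. Proof. by case: hv. Qed.

Lemma lap_sup_ge0 x : 0 <= lap b c v x.
Proof. by rewrite (lapE hm hb)// mulr_ge0 ?(ltW (hm x))//; case: hv. Qed.

(** Settles the case of a finite [X], where no boundary is left: there [v] itself is a test
    function, and a harmonic [v] would give [h(v) = 0], against a weight [w] that is positive
    somewhere. *)
Lemma subcritical_nonharmonic s : (forall x, x \in s) ->
  ~ (forall x, lap b c v x = 0).
Proof.
move=> sT h0; case: hsub => [w [w0 [x0 wo] hw]].
have fv : fin_supp v by apply: (@fin_supp_seq _ _ v s) => x; rewrite sT.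
have := hw _ fv; rewrite (@sformE _ _ _ hb c v v (undup s))//; first last.
  - by move=> x; rewrite mem_undup sT.
  - exact: undup_uniq.
rewrite big1; last by move=> x _; rewrite h0 mulr0.
apply/negP; rewrite -ltNge.
have wpos x : 0 <= w x * v x ^+ 2 by rewrite mulr_ge0 ?sqr_ge0.
apply: (@lt_le_trans _ _ (w x0 * v x0 ^+ 2)).
  by rewrite mulr_gt0 ?exprn_gt0// lt_def wo w0.
apply: (@term_le_rsum _ _ (fun x => w x * v x ^+ 2)) => //.
by apply: (@rsummable_fin _ _ _ s) => x; rewrite sT.
Qed.

(** If [f / v] had a negative minimum [q], then [u = f - q v] would be nonnegative, superharmonic on
    [A] and zero at a minimum point. Its zeros spread along edges, while [u > 0] outside [A]; so [A]
    would be all of [X], which subcriticality forbids. *)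
Lemma min_principle A f : finite_set A -> formal_dom b f ->
  (forall x, ~ A x -> 0 <= f x) -> (forall x, A x -> 0 <= lap b c f x) ->
  forall x, 0 <= f x.
Proof.
move=> finA df fA LA x1; rewrite leNgt; apply/negP => fx1.
pose s : seq X := fset_set A.
have sA x : x \in s <-> A x by rewrite in_fset_set// inE.
have As x : x \notin s -> ~ A x by move=> /negP h /sA.
have x1s : x1 \in s.
  by apply: contraTT fx1 => /As/fA; rewrite leNgt.
have [x0 x0s hmin] := seq_argmin (fun x => f x / v x) x1s.
pose q := f x0 / v x0.
have q0 : q < 0.
  apply: le_lt_trans (hmin _ x1s) _.
  by rewrite pmulr_llt0// invr_gt0.
pose u x := f x - q * v x.
have du : formal_dom b u by apply: formal_domB => //; exact: formal_domZ.
have Lu x : lap b c u x = lap b c f x - q * lap b c v x.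
  by rewrite lapB ?lapZ//; exact: formal_domZ.
have uA x : x \notin s -> 0 < u x.
  move=> xs; rewrite /u subr_gt0 (@lt_le_trans _ _ 0)//; last exact/fA/As.
  by rewrite nmulr_rlt0.
have u0 x : 0 <= u x.
  have [xs|/uA/ltW//] := boolP (x \in s).
  by rewrite /u subr_ge0 -ler_pdivlMr// hmin.
have ux0 : u x0 = 0 by rewrite /u /q divfK ?subrr// gt_eqF.
(* At a zero [x] of [u] the operator is minus the neighbour sum of [u]; being nonnegative, it makes
   each nonnegative term of that sum vanish. *)
have step x y : u x = 0 -> 0 < b x y -> u y = 0.
  move=> ux bxy; have xs : x \in s by apply: contraTT isT => /uA; rewrite ux ltxx.
  have : 0 <= lap b c u x.
    rewrite Lu addr_ge0 ?LA ?oppr_ge0//; first exact/sA.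
    by rewrite mulr_le0_ge0 ?(ltW q0)// lap_sup_ge0.
  rewrite /lap ux mulr0 sub0r oppr_ge0 => B0.
  have /(_ y) h : forall y, b x y * u y <= nbr_sum b u x.
    move=> z; apply: (@term_le_rsum _ _ (fun y => b x y * u y)).
      by move=> i; rewrite mulr_ge0// (weight_ge0 hb).
    exact: du.
  apply/eqP; rewrite eq_le u0 andbT.
  by rewrite -(pmulr_rle0 _ bxy) (le_trans h).
have uz y : u y = 0.
  have [p [pp <-]] := weight_connected hb x0 y.
  have H (w : X -> R) z : (forall x y, w x = 0 -> 0 < b x y -> w y = 0) ->
      w z = 0 -> path (fun x y => 0 < b x y) z p -> w (last z p) = 0.
    move=> st; elim: p z {pp} => //= a p IH z wz /andP[bza pa].
    exact: IH (st _ _ wz bza) pa.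
  exact: H step ux0 pp.
have sT x : x \in s by apply: contraTT isT => /uA; rewrite uz ltxx.
(* As [u = 0], one has [lap f = q * lap v]; the left side is nonnegative and [q < 0], so [lap v] is
   zero. *)
apply: (subcritical_nonharmonic sT) => x; apply/eqP; rewrite eq_le lap_sup_ge0 andbT.
have : lap b c u x = 0 by rewrite (_ : u = fun=> 0) ?lap0//; exact/funext.
rewrite Lu => /eqP; rewrite subr_eq0 => /eqP E.
by rewrite -(nmulr_rge0 _ q0) -E LA//; exact/sA.
Qed.

Lemma min_principle0 A f : finite_set A ->
  (forall x, ~ A x -> f x = 0) -> (forall x, A x -> lap b c f x = 0) ->
  forall x, f x = 0.
Proof.
move=> finA fA LA x.
have df : formal_dom b f.
  apply: (@formal_dom_fin _ _ _ f (fset_set A)) => z.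
  by rewrite in_fset_set// notin_setE => /fA.
apply/eqP; rewrite eq_le; apply/andP; split; last first.
  by apply: (min_principle finA) => // z Az; rewrite (fA, LA).
rewrite -oppr_ge0 -mulN1r; apply: (@min_principle A (fun x => -1 * f x)) => //.
- exact: formal_domZ.
- by move=> z /fA ->; rewrite mulr0.
- by move=> z Az; rewrite lapZ// LA// mulr0.
Qed.

(** The problem is a square linear system indexed by the points of [A]; the minimum principle gives
    a trivial kernel, hence invertibility. *)
Lemma dirichlet_solvable A g : finite_set A ->
  exists f, (forall x, ~ A x -> f x = 0) /\ forall x, A x -> lap b c f x = g x.
Proof.
move=> finA; pose s : seq X := fset_set A; pose n := size s.
have us : uniq s by exact: fset_uniq.
have sA x : x \in s <-> A x by rewrite in_fset_set// inE.
pose e (i : 'I_n) : X := tnth (in_tuple s) i.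
have es i : e i \in s by rewrite mem_tnth.
pose E (z : 'rV[R]_n) x := \sum_i z 0 i * @one_at R X (e i) x.
have Eoff z x : ~ A x -> E z x = 0.
  move=> nAx; rewrite /E big1// => i _; rewrite /one_at.
  case: eqP => [xe|]; last by rewrite mulr0.
  by case: nAx; apply/sA; rewrite xe.
have Ee z i : E z (e i) = z 0 i.
  rewrite /E (bigD1 i)//= /one_at eqxx mulr1 big1 ?addr0// => j ji.
  case: eqP => [eij|]; last by rewrite mulr0.
  move: ji; rewrite /e !(tnth_nth (e i)) in eij.
  by move/eqP: eij; rewrite nth_uniq// => /eqP/val_inj ->; rewrite eqxx.
have d1 := @formal_dom_one R X b.
pose M : 'M[R]_n := \matrix_(i, j) lap b c (@one_at R X (e i)) (e j).
have LE z x : lap b c (E z) x = \sum_i z 0 i * lap b c (@one_at R X (e i)) x.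
  exact: (lap_sum c _ _ (fun i => d1 (e i))).2.
have Mu : M \in unitmx.
  rewrite -row_free_unit; apply: inj_row_free => z zM.
  have E0 : forall x, E z x = 0.
    apply: (min_principle0 finA) => [|x /sA xs]; first exact: Eoff.
    have [i ->] : exists i, x = e i by have /tnthP[i ->] : x \in in_tuple s by []; exists i.
    rewrite LE; move/rowP: zM => /(_ i); rewrite !mxE => zi.
    by rewrite -[RHS]zi; apply: eq_bigr => j _; rewrite !mxE.
  by apply/rowP => i; rewrite mxE -Ee E0.
pose z := \row_j g (e j) *m invmx M.
exists (E z); split; first exact: Eoff.
move=> x /sA xs.
have [i ->] : exists i, x = e i by have /tnthP[i ->] : x \in in_tuple s by []; exists i.
rewrite LE; transitivity ((z *m M) 0 i).
  by rewrite !mxE; apply: eq_bigr => j _; rewrite !mxE.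
by rewrite /z mulmxKV// mxE.
Qed.

End Dirichlet.

(** * The Green function *)

Section GreenFunction.
Variables (R : realType) (X : countType) (b : X -> X -> R) (m c : X -> R).
Variables (v : X -> R) (K : nat -> set X).
Hypothesis hm : forall x, 0 < m x.
Hypothesis hb : weighted_graph b.
Hypothesis hsub : subcritical b c.
Hypothesis hv0 : forall x, 0 < v x.
Hypothesis hv : superharmonic_fun b m c v.
Hypothesis hK : exhaustion K.
Implicit Types (f g u w phi psi : X -> R) (x y z : X) (s : seq X) (A B : set X).

Local Notation dir := (dirichlet_inv b m c).

Lemma formal_dom_off A f : finite_set A -> (forall x, ~ A x -> f x = 0) ->
  formal_dom b f.
Proof.
move=> finA fA; apply: (@formal_dom_fin _ _ _ f (fset_set A)) => z.
by rewrite in_fset_set// notin_setE => /fA.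
Qed.

(** The existence of a solution keeps [dirichlet_inv] from falling back on its default value. *)
Lemma dirichletP A g : finite_set A -> (forall x, ~ A x -> dir A g x = 0) /\
  forall x, A x -> lap b c (dir A g) x = m x * g x.
Proof.
move=> finA.
have [f [fA fL]] := dirichlet_solvable hm hb hsub hv0 hv (fun x => m x * g x) finA.
have [d0 dL] : (forall x, ~ A x -> dir A g x = 0) /\
    forall x, A x -> formal_op b m c (dir A g) x = g x.
  apply: (@xgetPex _ (fun=> 0) [set f : X -> R | (forall x, ~ A x -> f x = 0) /\
    forall x, A x -> formal_op b m c f x = g x]); exists f; split=> // x Ax.
  rewrite (formal_opE m hb) ?fL//; last exact: formal_dom_off fA.
  by rewrite mulKf ?gt_eqF.
split=> // x Ax; rewrite (lapE hm hb) ?dL//; exact: formal_dom_off d0.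
Qed.

Lemma dir_off A g x : finite_set A -> ~ A x -> dir A g x = 0.
Proof. by move=> finA; exact: (dirichletP g finA).1. Qed.

Lemma lap_dir A g x : finite_set A -> A x -> lap b c (dir A g) x = m x * g x.
Proof. by move=> finA; exact: (dirichletP g finA).2. Qed.

Lemma formal_dom_dir A g : finite_set A -> formal_dom b (dir A g).
Proof. by move=> finA; apply: (formal_dom_off finA) => x; exact: dir_off. Qed.

Lemma dirichlet_le A g f : finite_set A -> formal_dom b f ->
  (forall x, ~ A x -> 0 <= f x) -> (forall x, A x -> m x * g x <= lap b c f x) ->
  forall x, dir A g x <= f x.
Proof.
move=> finA df fA fL x; rewrite -subr_ge0.
have dd := formal_dom_dir g finA.
apply: (min_principle hm hb hsub hv0 hv finA (f := fun x => f x - dir A g x)).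
- exact: formal_domB.
- by move=> z nAz; rewrite dir_off// subr0 fA.
- by move=> z Az; rewrite lapB// lap_dir// subr_ge0 fL.
Qed.

Lemma dirichlet_ge0 A g : finite_set A -> (forall x, A x -> 0 <= g x) ->
  forall x, 0 <= dir A g x.
Proof.
move=> finA g0; apply: (min_principle hm hb hsub hv0 hv finA).
- exact: formal_dom_dir.
- by move=> z nAz; rewrite dir_off.
- by move=> z Az; rewrite lap_dir// mulr_ge0 ?(ltW (hm z))// g0.
Qed.

Lemma dirichlet_mono A B g : finite_set B -> A `<=` B ->
  (forall x, B x -> 0 <= g x) -> forall x, dir A g x <= dir B g x.
Proof.
move=> finB AB g0; have finA := sub_finite_set AB finB.
apply: (dirichlet_le finA).
- exact: formal_dom_dir.
- by move=> x _; exact: dirichlet_ge0.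
- by move=> x /AB Bx; rewrite lap_dir.
Qed.

Lemma sform_dir A g f : finite_set A -> formal_dom b f ->
  sform b c (dir A g) f = \sum_(x <- fset_set A) dir A g x * lap b c f x.
Proof.
move=> finA df; apply: (sformE hb) => //; first exact: fset_uniq.
by move=> x; rewrite in_fset_set// notin_setE => /(dir_off g finA).
Qed.

(** Both sides equal the symmetric form evaluated at the Dirichlet solutions for [1_x] and [1_y];
    the auxiliary [H] also covers points outside [A], where everything vanishes. *)
Lemma dirichlet_sym A x y : finite_set A ->
  m x * dir A (one_at R y) x = m y * dir A (one_at R x) y.
Proof.
move=> finA.
have H x' y' : sform b c (dir A (one_at R x')) (dir A (one_at R y')) =
    m y' * dir A (one_at R x') y'.
  rewrite sform_dir//; last exact: formal_dom_dir.
  have [Ay|nAy] := pselect (A y').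
    rewrite (bigD1_seq y')/=; [|by rewrite in_fset_set// inE|exact: fset_uniq].
    rewrite lap_dir// /one_at eqxx mulr1 mulrC big1_seq ?addr0// => z /andP[zy].
    rewrite in_fset_set// inE => Az.
    by rewrite lap_dir// (negPf zy) !mulr0.
  rewrite dir_off// mulr0 big1_seq// => z /andP[_]; rewrite in_fset_set// inE => Az.
  rewrite lap_dir// /one_at; case: eqP => [zy|]; last by rewrite !mulr0.
  by case: nAy; rewrite -zy.
by rewrite -(H y x) -(H x y) sformC.
Qed.

Local Notation gn n y x := (dir (K n) (one_at R y) x).
Local Notation G := (green b m c K).

Let finK n : finite_set (K n). Proof. by case: hK. Qed.
Let monK n k : (n <= k)%N -> K n `<=` K k. Proof. by case: hK => _ h _; exact: h. Qed.

Lemma exhaustion_near x : exists n, forall k, (n <= k)%N -> K k x.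
Proof.
have [_ _ KT] := hK; have : [set: X] x by [].
rewrite -KT => -[n _ Knx]; exists n => k nk; exact: monK Knx.
Qed.

Let one_at_ge0 y x : 0 <= one_at R y x. Proof. by rewrite /one_at ler0n. Qed.

Let gn_ge0 n y x : 0 <= gn n y x.
Proof. by apply: dirichlet_ge0. Qed.

Let gn_mono y x n k : (n <= k)%N -> gn n y x <= gn k y x.
Proof. by move=> nk; apply: dirichlet_mono => //; exact: monK. Qed.

Let gbounded x y := exists C, forall n, gn n y x <= C.

(** A Harnack inequality along an edge: at [x] the operator is nonnegative, so the single term
    [b x z * gn z] is at most [total_deg x * gn x]. The index is first raised to some [k] with [x]
    in [K k]. *)
Let gbounded_step x y z : gbounded x y -> 0 < b x z -> gbounded z y.
Proof.
move=> [C hC] bxz; exists (`|total_deg b c x| * C / b x z) => n.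
have [n0 hn0] := exhaustion_near x.
apply: le_trans (gn_mono _ _ (leq_maxl n n0)) _.
set k := maxn n n0; have Kx : K k x by apply: hn0; exact: leq_maxr.
rewrite ler_pdivlMr// mulrC.
have : 0 <= lap b c (fun x => gn k y x) x by rewrite lap_dir// mulr_ge0// ltW.
rewrite /lap subr_ge0 => h.
apply: (@le_trans _ _ (nbr_sum b (fun x => gn k y x) x)).
  apply: (@term_le_rsum _ _ (fun z => b x z * gn k y z)).
    by move=> i; rewrite mulr_ge0// (weight_ge0 hb).
  exact: formal_dom_dir.
apply: le_trans h _; apply: le_trans (ler_norm _) _; rewrite normrM.
by rewrite ler_wpM2l// ger0_norm.
Qed.

Let gbounded_sym x y : gbounded x y -> gbounded y x.
Proof.
move=> [C hC]; exists (m x * C / m y) => n; rewrite ler_pdivlMr// mulrC.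
by rewrite dirichlet_sym// ler_wpM2l// ltW.
Qed.

Let gbounded_path x y z : gbounded x y -> gbounded z y.
Proof.
move=> hx; have [p [pp <-]] := weight_connected hb x z.
elim: p x hx pp => //= a p IH x hx /andP[bxa pa].
by apply: IH pa; exact: gbounded_step bxa.
Qed.

(** Testing the weight [w] with [phi = gn(., x0)] gives [w x0 * phi x0 ^ 2 <= h(phi) = m x0 * phi
    x0], a bound on the diagonal at a point with [w x0 > 0]. Harnack steps move the first argument,
    symmetry exchanges the two, and a second chain of steps reaches every pair. *)
Lemma dirichlet_green_bounded x y : exists C, forall n, gn n y x <= C.
Proof.
case: hsub => [w [w0 [x0 wx0] hw]].
have w1 : 0 < w x0 by rewrite lt_def wx0 w0.
have h0 : gbounded x0 x0.
  exists (m x0 / w x0) => n; set phi := fun x => gn n x0 x.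
  have [phi0|phin0] := eqVneq (phi x0) 0.
    by rewrite -/(phi x0) phi0 divr_ge0// ltW.
  have Kx0 : K n x0.
    by apply: contrapT => nK; move: phin0; rewrite /phi dir_off// eqxx.
  have php : 0 < phi x0 by rewrite lt_def phin0 gn_ge0.
  have fs z : z \notin (fset_set (K n) : seq X) -> phi z = 0.
    by rewrite in_fset_set// notin_setE => nK; rewrite /phi dir_off.
  have := hw phi (fin_supp_seq fs).
  rewrite /phi sform_dir//; last exact: formal_dom_dir.
  rewrite (bigD1_seq x0)/=; [|by rewrite in_fset_set// inE|exact: fset_uniq].
  rewrite lap_dir// /one_at eqxx mulr1 big1_seq ?addr0; last first.
    move=> z /andP[zy]; rewrite in_fset_set// inE => Az.
    by rewrite lap_dir// (negPf zy) !mulr0.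
  rewrite -/(phi x0) => le.
  have : w x0 * phi x0 ^+ 2 <= phi x0 * m x0.
    apply: le_trans le; apply: (@term_le_rsum _ _ (fun x => w x * phi x ^+ 2)).
      by move=> i; rewrite mulr_ge0// sqr_ge0.
    by apply: (@rsummable_fin _ _ _ (fset_set (K n))) => z /fs ->; rewrite expr0n mulr0.
  rewrite expr2 mulrA mulrC ler_pM2l// => le2.
  by rewrite ler_pdivlMr// mulrC.
exact: gbounded_path (gbounded_sym (gbounded_path y h0)).
Qed.

Lemma green_cvg x y : gn n y x @[n --> \oo] --> G x y.
Proof.
have [C hC] := dirichlet_green_bounded x y.
apply: nondecreasing_is_cvgn; first by move=> n k; exact: gn_mono.
by exists C => _ [n _ <-].
Qed.

Lemma dirichlet_green_le n x y : gn n y x <= G x y.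
Proof.
apply: nondecreasing_cvgn_le; first by move=> i k; exact: gn_mono.
exact: green_cvg.
Qed.

Lemma green_ge0 x y : 0 <= G x y.
Proof. exact: le_trans (gn_ge0 0 y x) (dirichlet_green_le 0 x y). Qed.

Lemma green_sym x y : m x * G x y = m y * G y x.
Proof.
have cxy (x' y' : X) : m x' * gn n y' x' @[n --> \oo] --> m x' * G x' y'.
  by apply: cvgM; [exact: cvg_cst|exact: green_cvg].
have := cxy y x; under eq_fun do rewrite dirichlet_sym//.
by move=> /(cvg_unique (@norm_hausdorff _ _) (cxy x y)); apply.
Qed.

(** Finite neighbour sums of [gn] are bounded by [|total_deg|] times [G], uniformly in large [n]; so
    [G(., y)] lies in the formal domain, and then dominated limits carry the equation over. *)
Lemma lap_green y : formal_dom b (G ^~ y) /\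
  forall x, lap b c (G ^~ y) x = m x * one_at R y x.
Proof.
have dG : formal_dom b (G ^~ y).
  apply/formal_domE => x.
  apply: (rsummable_ub (C := `|total_deg b c x| * G x y) _ _).1 => [z|s us].
    by rewrite mulr_ge0 ?(weight_ge0 hb)// green_ge0.
  have cs : \sum_(z <- s) b x z * gn n y z @[n --> \oo] --> \sum_(z <- s) b x z * G z y.
    apply: cvg_sumr => z; apply: cvgM; [exact: cvg_cst|exact: green_cvg].
  apply: (cvgr_to_le cs).
  have [n0 hn0] := exhaustion_near x.
  exists n0 => //= k /hn0 Kx.
  apply: (@le_trans _ _ (nbr_sum b (fun x => gn k y x) x)).
    apply: (@sum_le_rsum _ _ (fun z => b x z * gn k y z)) => //.
      by move=> i; rewrite mulr_ge0// (weight_ge0 hb).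
    exact: formal_dom_dir.
  have : 0 <= lap b c (fun x => gn k y x) x by rewrite lap_dir// mulr_ge0// ltW.
  rewrite /lap subr_ge0 => h.
  apply: le_trans h _; apply: le_trans (ler_norm _) _; rewrite normrM.
  by rewrite ler_wpM2l// ger0_norm// dirichlet_green_le.
split=> // x.
have cL : lap b c (fun x => gn n y x) x @[n --> \oo] --> lap b c (G ^~ y) x.
  rewrite /lap; apply: cvgB.
    by apply: cvgM; [exact: cvg_cst|exact: green_cvg].
  apply: (@rsum_cvg _ _ _ _ _ (fun n z => b x z * gn n y z)).
  - apply: nearW => n z; rewrite mulr_ge0 ?(weight_ge0 hb)//=.
    by rewrite ler_wpM2l ?(weight_ge0 hb)// dirichlet_green_le.
  - exact: dG.
  - by move=> z; apply: cvgM; [exact: cvg_cst|exact: green_cvg].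
have [n0 hn0] := exhaustion_near x.
have cc : lap b c (fun x => gn n y x) x @[n --> \oo] --> m x * one_at R y x.
  by apply: cvg_near_cst; exists n0 => //= k /hn0 Kx; rewrite lap_dir.
exact: (cvg_unique (@norm_hausdorff _ _) cL cc).
Qed.

Let lap_green_op_ge0 (k : X -> R) : (forall x, 0 <= k x) -> green_dom G k ->
  formal_dom b (fun x => rsum (fun y => G x y * k y)) /\
  forall x, lap b c (fun x => rsum (fun y => G x y * k y)) x = m x * k x.
Proof.
move=> k0 dk; set u := (fun x => _).
have Gk0 x y : 0 <= G x y * k y by rewrite mulr_ge0// green_ge0.
have sGk x : rsummable (fun y => G x y * k y) by exact: dk.
(* The equation for [G(., y)] solved for the neighbour sum: after weighting by [k] the right side is
   summable in [y], which makes the exchange of the sums over [z] and [y] finite. *)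
have nG x y : nbr_sum b (G ^~ y) x * k y =
    total_deg b c x * (G x y * k y) - m x * one_at R y x * k y.
  by have := (lap_green y).2 x; rewrite /lap => <-; ring.
have sone x : rsummable (fun y => m x * one_at R y x * k y).
  apply: (@rsummable_fin _ _ _ [:: x]) => y; rewrite inE /one_at eq_sym => /negPf ->.
  by rewrite mulr0 mul0r.
have sn x : rsummable (fun y => nbr_sum b (G ^~ y) x * k y).
  have -> : (fun y => nbr_sum b (G ^~ y) x * k y) =
    (fun y => total_deg b c x * (G x y * k y) - m x * one_at R y x * k y).
    by apply/funext => y; rewrite nG.
  by apply: rsummableB => //; exact: rsummableZ.
have b0 := weight_ge0 hb.
have E x : (\esum_(z in setT) (b x z * u z)%:E =
    (rsum (fun y => nbr_sum b (G ^~ y) x * k y))%:E)%E.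
  rewrite -rsumE//; last first.
    by move=> y; rewrite mulr_ge0// rsum_ge0// => z; rewrite mulr_ge0// green_ge0.
  transitivity (\esum_(z in setT) \esum_(y in setT) (b x z * (G z y * k y))%:E)%E.
    apply: eq_esum => z _; rewrite EFinM -rsumE// -esumZl//.
    by move=> y; rewrite lee_fin.
  rewrite (esum_swap (a := fun z y => (b x z * (G z y * k y))%:E)); last first.
    by move=> z y; rewrite lee_fin mulr_ge0.
  apply: eq_esum => y _.
  transitivity (\esum_(z in setT) ((k y)%:E * (b x z * G z y)%:E))%E.
    by apply: eq_esum => z _; rewrite -EFinM; congr EFin; ring.
  rewrite esumZl//; last by move=> z; rewrite lee_fin mulr_ge0// green_ge0.
  rewrite rsumE; [by rewrite -EFinM mulrC| |exact: (lap_green y).1].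
  by move=> z; rewrite mulr_ge0// green_ge0.
have du : formal_dom b u.
  apply/formal_domE => x; apply/rsummable_ge0; last by rewrite E ltry.
  by move=> z; rewrite mulr_ge0// rsum_ge0.
split=> // x; rewrite /lap.
have -> : nbr_sum b u x = rsum (fun y => nbr_sum b (G ^~ y) x * k y).
  apply: EFin_inj; rewrite -E rsumE//; first by move=> z; rewrite mulr_ge0// rsum_ge0.
  exact: du.
rewrite (eq_rsum (nG x)) rsumB//; last exact: rsummableZ.
rewrite rsumZ//; rewrite [X in _ - (_ - X)](@rsum_fin _ _ _ [:: x])//; last first.
  by move=> y; rewrite inE /one_at eq_sym => /negPf ->; rewrite mulr0 mul0r.
by rewrite big_seq1 /one_at eqxx mulr1 /u; ring.
Qed.

Lemma lap_green_op (k : X -> R) : green_dom G k ->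
  formal_dom b (fun x => rsum (fun y => G x y * k y)) /\
  forall x, lap b c (fun x => rsum (fun y => G x y * k y)) x = m x * k x.
Proof.
move=> dk; pose kp y := `|k y|; pose kn y := `|k y| - k y.
have kE y : k y = kp y - kn y by rewrite /kp /kn; ring.
have dp : green_dom G kp.
  move=> x; apply: rsummable_le (rsummable_norm (dk x)) => y.
  by rewrite !normrM /kp normr_id.
have dn : green_dom G kn.
  move=> x; have := rsummableB (dp x) (dk x).
  by under eq_fun do rewrite -mulrBr.
have kp0 y : 0 <= kp y by exact: normr_ge0.
have kn0 y : 0 <= kn y by rewrite subr_ge0 ler_norm.
have [dom1 L1]  := lap_green_op_ge0 kp0 dp.
have [dom2 L2]  := lap_green_op_ge0 kn0 dn.
have -> : (fun x => rsum (fun y => G x y * k y)) =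
   (fun x => rsum (fun y => G x y * kp y) - rsum (fun y => G x y * kn y)).
  apply/funext => x; rewrite -rsumB; [|exact: dp|exact: dn].
  by apply: eq_rsum => y; rewrite {1}(kE y) mulrBr.
split; first exact: formal_domB.
by move=> x; rewrite lapB// L1 L2 -mulrBr -kE.
Qed.

End GreenFunction.

(** * Potentials and harmonic functions *)

Section Potentials.
Variables (R : realType) (X : countType) (b : X -> X -> R) (m c : X -> R).
Variables (v : X -> R) (K : nat -> set X).
Hypothesis hm : forall x, 0 < m x.
Hypothesis hb : weighted_graph b.
Hypothesis hsub : subcritical b c.
Hypothesis hv0 : forall x, 0 < v x.
Hypothesis hv : superharmonic_fun b m c v.
Hypothesis hK : exhaustion K.
Implicit Types (f g u w phi psi : X -> R) (x y z : X).

Local Notation G := (green b m c K).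
Local Notation H := (formal_op b m c).
Local Notation gn n y x := (dirichlet_inv b m c (K n) (one_at R y) x).

Let finK n : finite_set (K n). Proof. by case: hK. Qed.
Let dv : formal_dom b v. Proof. by case: hv. Qed.
Let Hv0 x : 0 <= H v x. Proof. by case: hv. Qed.
Let G0 x y : 0 <= G x y. Proof. exact: (green_ge0 hm hb hsub hv0 hv hK). Qed.
Let Gcvg x y : gn n y x @[n --> \oo] --> G x y.
Proof. exact: (green_cvg hm hb hsub hv0 hv hK). Qed.
Let gnG n x y : 0 <= gn n y x <= G x y.
Proof.
rewrite (dirichlet_green_le hm hb hsub hv0 hv hK) andbT.
by apply: (dirichlet_ge0 hm hb hsub hv0 hv) => // z _; rewrite ler0n.
Qed.
Let finK_off n x : (x \notin (fset_set (K n) : seq X)) -> ~ K n x.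
Proof. by rewrite in_fset_set// notin_setE. Qed.

Lemma lap_dirichlet_sum n (k : X -> R) (s : seq X) :
  formal_dom b (fun x => \sum_(y <- s) k y * gn n y x) /\
  forall x, K n x -> lap b c (fun x => \sum_(y <- s) k y * gn n y x) x =
    \sum_(y <- s) k y * (m x * one_at R y x).
Proof.
have d y : formal_dom b (fun x => gn n y x).
  exact: (formal_dom_dir hm hb hsub hv0 hv).
have [d1 L1] := lap_sum c s k d.
split=> // x Kx; rewrite L1; apply: eq_bigr => y _.
by rewrite (lap_dir hm hb hsub hv0 hv).
Qed.

(** For a finite set [s] of poles, the sum of [H v y * gn(., y)] is compared with [v] on [K n]: it
    vanishes outside, and inside its image under the operator is at most that of [v]. Letting [n]
    grow and then [s] gives both claims. *)
Lemma green_superharmonic_le x :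
  rsummable (fun y => G x y * H v y) /\ rsum (fun y => G x y * H v y) <= v x.
Proof.
apply: rsummable_ub => [y|s us]; first by rewrite mulr_ge0.
have cs : \sum_(y <- s) H v y * gn n y x @[n --> \oo] --> \sum_(y <- s) G x y * H v y.
  under [X in _ --> X]eq_bigr do rewrite mulrC.
  by apply: cvg_sumr => z; apply: cvgM; [exact: cvg_cst|exact: Gcvg].
apply: (cvgr_to_le cs); apply: nearW => n; rewrite -subr_ge0.
have [ds Ls] := lap_dirichlet_sum n (H v) s.
apply: (min_principle hm hb hsub hv0 hv (finK n)
  (f := fun x => v x - \sum_(y <- s) H v y * gn n y x)).
- exact: formal_domB.
- move=> z nK; rewrite big1 ?subr0 ?(ltW (hv0 z))// => y _.
  by rewrite (dir_off hm hb hsub hv0 hv) ?mulr0.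
- move=> z Kz; rewrite lapB// Ls// (lapE hm hb)// subr_ge0.
  have [zs|zs] := boolP (z \in s).
    rewrite (bigD1_seq z)//= /one_at eqxx mulr1 mulrC big1 ?addr0// => y yz.
    by rewrite eq_sym (negPf yz) !mulr0.
  rewrite big1_seq ?mulr_ge0 ?(ltW (hm z))// => y /= ys.
  rewrite /one_at; case: eqP => [E|_]; last by rewrite !mulr0.
  by move: zs; rewrite E ys.
Qed.

Lemma green_op_rsum x : green_op G (H v) x = (rsum (fun y => G x y * H v y))%:E.
Proof. by rewrite /green_op xsum_rsum//; have [] := green_superharmonic_le x. Qed.

Lemma no_harmonic_green :
  (forall h, harmonic_fun b m c h -> (forall x, `|h x| <= v x) -> forall x, h x = 0) ->
  forall x, green_op G (H v) x = (v x)%:E.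
Proof.
move=> hi x; rewrite green_op_rsum; congr EFin.
have dk : green_dom G (H v) by move=> z; have [] := green_superharmonic_le z.
have [du Lu] := lap_green_op hm hb hsub hv0 hv hK dk.
pose u z := rsum (fun y => G z y * H v y).
apply/esym/eqP; rewrite -subr_eq0; apply/eqP.
apply: (hi (fun z => v z - u z)) => [|z].
  split; first exact: formal_domB.
  move=> z; rewrite (formal_opE m hb); last exact: formal_domB.
  by rewrite lapB// Lu (lapE hm hb)// subrr mulr0.
have uz0 : 0 <= u z by apply: rsum_ge0 => y; rewrite mulr_ge0.
have uzv : u z <= v z by have [] := green_superharmonic_le z.
by rewrite ger0_norm ?subr_ge0// lerBlDr lerDl.
Qed.

Lemma green_no_harmonic : (forall x, green_op G (H v) x = (v x)%:E) ->
  forall h, harmonic_fun b m c h -> (forall x, `|h x| <= v x) -> forall x, h x = 0.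
Proof.
move=> hii.
have key h x : harmonic_fun b m c h -> (forall x, `|h x| <= v x) -> h x <= 0.
  move=> [dh Hh] hle.
  have [sk _] := green_superharmonic_le x.
  have Gv : rsum (fun y => G x y * H v y) = v x.
    by apply: EFin_inj; rewrite -hii green_op_rsum.
  pose vn n := \sum_(y <- fset_set (K n)) H v y * gn n y x.
  have cv : v x - vn n @[n --> \oo] --> v x - v x.
    apply: cvgB; first exact: cvg_cst.
    rewrite -[X in _ --> X]Gv.
    (* [gn(x, y)] vanishes for [x] outside [K n] by construction and for [y] outside by symmetry, so
       the sum over [K n] is the full sum and convergence by domination applies. *)
    have -> : vn = (fun n => rsum (fun y => gn n y x * H v y)).
      apply/funext => n; rewrite (@rsum_fin _ _ _ (fset_set (K n))).
      + by apply: eq_bigr => y _; rewrite mulrC.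
      + exact: fset_uniq.
      + move=> y /finK_off nK.
        suff -> : gn n y x = 0 by rewrite mul0r.
        have [Kx|nKx] := pselect (K n x); last by rewrite (dir_off hm hb hsub hv0 hv).
        apply: (mulfI (lt0r_neq0 (hm x))).
        rewrite mulr0 (dirichlet_sym hm hb hsub hv0 hv)//.
        by rewrite (dir_off hm hb hsub hv0 hv) ?mulr0.
    apply: rsum_cvg => // [|y].
      apply: nearW => n y; have /andP[g0 g1] := gnG n x y.
      by rewrite mulr_ge0//= ler_wpM2r.
    by apply: cvgM; [exact: Gcvg|exact: cvg_cst].
  rewrite -(subrr (v x)); apply: (cvgr_to_ge cv); apply: nearW => n.
  rewrite -subr_ge0.
  have [ds Ls] := lap_dirichlet_sum n (H v) (fset_set (K n)).
  pose f z := v z - \sum_(y <- fset_set (K n)) H v y * gn n y z - h z.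
  have dvs := formal_domB dv ds.
  apply: (min_principle hm hb hsub hv0 hv (finK n) (f := f)).
  - exact: formal_domB.
  - move=> z nK; rewrite /f big1 ?subr0 ?subr_ge0.
      exact: le_trans (ler_norm _) (hle z).
    by move=> y _; rewrite (dir_off hm hb hsub hv0 hv) ?mulr0.
  - move=> z Kz; rewrite /f !lapB// Ls// !(lapE hm hb)// Hh mulr0 subr0.
    rewrite (bigD1_seq z)/=; [|by rewrite in_fset_set// inE|exact: fset_uniq].
    rewrite /one_at eqxx mulr1 mulrC big1 ?addr0 ?subrr// => y yz.
    by rewrite eq_sym (negPf yz) !mulr0.
move=> h hh hle x; apply/eqP; rewrite eq_le key//= -oppr_le0 -mulN1r.
have [dh Hh] := hh.
apply: (key (fun x => -1 * h x)) => [|z]; last by rewrite mulN1r normrN.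
split; first exact: formal_domZ.
move=> z; rewrite (formal_opE m hb); last exact: formal_domZ.
by rewrite lapZ// (lapE hm hb)// Hh !mulr0.
Qed.

(** The density [k] of a potential is hidden in an existential, but the operator recovers it:
    [H (G k) = k]. *)
Lemma potential_green u : potential b G u -> forall x,
  rsummable (fun y => G x y * H u y) /\ u x = rsum (fun y => G x y * H u y).
Proof.
move=> [du [k [dk uk]]].
have uE x : u x = rsum (fun y => G x y * k y).
  by apply: EFin_inj; rewrite -uk /green_op xsum_rsum//; exact: dk.
have [_ Lu] := lap_green_op hm hb hsub hv0 hv hK dk.
have -> : H u = k.
  apply/funext => x; rewrite (formal_opE m hb)// (funext uE) Lu mulKf//.
  by rewrite gt_eqF.
by move=> x; split=> //; exact: dk.
Qed.

Lemma green_potential :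
  (forall x, green_op G (H v) x = (v x)%:E) <-> potential b G v.
Proof.
split=> [hii|pv x].
  split=> //; exists (H v); split=> // x.
  by have [] := green_superharmonic_le x.
by rewrite green_op_rsum; have [_ <-] := potential_green pv x.
Qed.

Lemma green_symmetric_pairing :
  (forall x, green_op G (H v) x = (v x)%:E) ->
  forall u, superharmonic_fun b m c u -> potential b G u ->
    xsum (fun x => H u x * v x * m x) = xsum (fun x => u x * H v x * m x).
Proof.
move=> hii u [du Hu0] /potential_green pu.
have u0 x : 0 <= u x.
  by have [_ ->] := pu x; apply: rsum_ge0 => y; rewrite mulr_ge0.
rewrite !xsum_ge0; first last.
- by move=> x; rewrite !mulr_ge0// ltW.
- by move=> x; rewrite !mulr_ge0// ltW.
transitivity (\esum_(x in setT) \esum_(y in setT)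
    (H u x * m x * G x y * H v y)%:E)%E.
  apply: eq_esum => x _.
  have [sv _] := green_superharmonic_le x.
  have -> : v x = rsum (fun y => G x y * H v y).
    by apply: EFin_inj; rewrite -hii green_op_rsum.
  rewrite mulrAC EFinM -rsumE//; last by move=> y; rewrite mulr_ge0.
  rewrite -esumZl; [|by rewrite mulr_ge0// ltW|by move=> y; rewrite lee_fin mulr_ge0].
  by apply: eq_esum => y _; rewrite -EFinM mulrA.
rewrite (esum_swap (a := fun x y => (H u x * m x * G x y * H v y)%:E)); last first.
  by move=> x y; rewrite lee_fin !mulr_ge0// ltW.
apply: eq_esum => y _; have [su ->] := pu y.
rewrite -mulrA mulrC EFinM -rsumE//; last by move=> x; rewrite mulr_ge0.
rewrite -esumZl; last 2 first.
  - by rewrite mulr_ge0// ltW.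
  - by move=> x; rewrite lee_fin mulr_ge0.
apply: eq_esum => x _; rewrite -EFinM; congr EFin.
have E := green_sym hm hb hsub hv0 hv hK x y.
rewrite -[H u x * m x * G x y]mulrA E; ring.
Qed.

Lemma symmetric_pairing_green :
  (forall u, superharmonic_fun b m c u -> potential b G u ->
    xsum (fun x => H u x * v x * m x) = xsum (fun x => u x * H v x * m x)) ->
  forall x, green_op G (H v) x = (v x)%:E.
Proof.
move=> hiv y; pose u x := G x y.
have [du Lu] := lap_green hm hb hsub hv0 hv hK y.
have Hu x : H u x = one_at R y x.
  by rewrite (formal_opE m hb)// Lu mulKf// gt_eqF.
have := hiv u.
have -> : (fun x => H u x * v x * m x) = (fun x => one_at R y x * v x * m x).
  by apply/funext => x; rewrite Hu.
have -> : (fun x => u x * H v x * m x) = (fun x => m y * (G y x * H v x)).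
  apply/funext => x; rewrite /u mulrC mulrA (green_sym hm hb hsub hv0 hv hK).
  by rewrite mulrA.
have one_off x : x \notin [:: y] -> one_at R y x = 0.
  by rewrite inE /one_at => /negPf ->.
rewrite xsum_rsum; last first.
  by apply: (@rsummable_fin _ _ _ [:: y]) => x /one_off ->; rewrite !mul0r.
rewrite (@rsum_fin _ _ _ [:: y])//; last by move=> x /one_off ->; rewrite !mul0r.
rewrite big_seq1 /one_at eqxx mul1r.
have [sG _] := green_superharmonic_le y.
rewrite xsum_rsum; last exact: rsummableZ.
rewrite rsumZ// green_op_rsum => E; congr EFin.
apply: (mulfI (lt0r_neq0 (hm y))); apply: EFin_inj; rewrite -E ?[m y * _]mulrC//.
  by split=> // x; rewrite Hu /one_at.
split=> //; exists (one_at R y).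
have GE x : (fun z => G x z * one_at R y z) = (fun z => G x y * one_at R y z).
  apply/funext => z; rewrite /one_at; case: eqP => [->//|_]; by rewrite !mulr0.
split=> x.
  apply: (@rsummable_fin _ _ _ [:: y]) => z /one_off ->; by rewrite mulr0.
rewrite /green_op xsum_rsum; last first.
  by apply: (@rsummable_fin _ _ _ [:: y]) => z /one_off ->; rewrite mulr0.
rewrite (@rsum_fin _ _ _ [:: y])//; last by move=> z /one_off ->; rewrite mulr0.
by rewrite big_seq1 /one_at eqxx mulr1.
Qed.

End Potentials.

(** * The space of square summable functions *)

Lemma cvg0_nat (R : realType) (u : nat -> R) (e : R) :
  u n @[n --> \oo] --> 0 -> 0 < e -> exists N, forall n, (N <= n)%N -> `|u n| < e.
Proof.
move=> u0 e0; have /cvgrPdist_lt/(_ e e0)[N _ hN] := u0.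
by exists N => n /hN; rewrite sub0r normrN.
Qed.

Section L2Space.
Variables (R : realType) (X : countType) (m : X -> R).
Hypothesis hm : forall x, 0 < m x.
Implicit Types (f g u : X -> R) (x : X) (s : seq X).

Definition l2norm f : R := Num.sqrt (rsum (fun x => m x * f x ^+ 2)).

Lemma l2_summand_ge0 f x : 0 <= m x * f x ^+ 2.
Proof. by rewrite mulr_ge0 ?sqr_ge0// ltW. Qed.
Local Hint Resolve l2_summand_ge0 : core.

Lemma l2P f : l2 m f <-> rsummable (fun x => m x * f x ^+ 2).
Proof. by split=> [h|/rsummable_ge0]; [apply/rsummable_ge0|exact]. Qed.

Lemma l2sqE f : l2 m f -> l2sq m f = (l2norm f ^+ 2)%:E.
Proof.
move=> /l2P lf; rewrite /l2norm sqr_sqrtr; last exact: rsum_ge0.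
by rewrite -rsumE.
Qed.

Lemma l2norm_ge0 f : 0 <= l2norm f. Proof. exact: sqrtr_ge0. Qed.

Lemma l2norm_sqr f : l2norm f ^+ 2 = rsum (fun x => m x * f x ^+ 2).
Proof. by rewrite sqr_sqrtr// rsum_ge0. Qed.

Lemma l2norm_sqr_dot f : l2norm f ^+ 2 = l2dot m f f.
Proof. by rewrite l2norm_sqr; apply: eq_rsum => x; rewrite expr2. Qed.

Lemma l2_mul f g : l2 m f -> l2 m g -> rsummable (fun x => m x * (f x * g x)).
Proof.
move=> /l2P lf /l2P lg; apply: rsummable_le (rsummableD lf lg) => x.
rewrite normrM ger0_norm ?(ltW (hm x))// -mulrDr ler_wpM2l ?(ltW (hm x))//.
by rewrite normrM -(real_normK (num_real (f x))) -(real_normK (num_real (g x))); nra.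
Qed.

Lemma l2_le f g : (forall x, `|f x| <= `|g x|) -> l2 m g -> l2 m f.
Proof.
move=> fg /l2P lg; apply/l2P; apply: rsummable_le lg => x.
rewrite ger0_norm// ler_wpM2l ?(ltW (hm x))//.
by rewrite -(real_normK (num_real (f x))) -(real_normK (num_real (g x))) lerXn2r ?nnegrE.
Qed.

Lemma l2Z f a : l2 m f -> l2 m (fun x => a * f x).
Proof.
move=> /l2P lf; apply/l2P; have := rsummableZ (a ^+ 2) lf.
by apply: rsummable_le => x; rewrite ger0_norm ?(l2_summand_ge0 (fun x => a * f x))// exprMn mulrCA.
Qed.

Lemma l2D f g : l2 m f -> l2 m g -> l2 m (fun x => f x + g x).
Proof.
move=> lf lg; have lfg := l2_mul lf lg; move: lf lg => /l2P lf /l2P lg.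
apply/l2P; have := rsummableD (rsummableD lf lg) (rsummableZ 2 lfg).
apply: rsummable_le => x; rewrite ger0_norm ?(l2_summand_ge0 (fun x => f x + g x))//.
by rewrite le_eqVlt; apply/orP; left; apply/eqP; ring.
Qed.

Lemma l2B f g : l2 m f -> l2 m g -> l2 m (fun x => f x - g x).
Proof.
move=> lf lg; have := l2D lf (l2Z (-1) lg).
by under eq_fun do rewrite mulN1r.
Qed.

Lemma l2_fin f s : (forall x, x \notin s -> f x = 0) -> l2 m f.
Proof.
move=> fs; apply/l2P; apply: (@rsummable_fin _ _ _ s) => x /fs ->.
by rewrite expr0n mulr0.
Qed.

Lemma l2_one y : l2 m (one_at R y).
Proof. by apply: (@l2_fin _ [:: y]) => x; rewrite inE /one_at => /negPf ->. Qed.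

Lemma l2dotC f g : l2dot m f g = l2dot m g f.
Proof. by apply: eq_rsum => x; rewrite [f x * _]mulrC. Qed.

Lemma l2dotDl f g u : l2 m f -> l2 m g -> l2 m u ->
  l2dot m (fun x => f x + g x) u = l2dot m f u + l2dot m g u.
Proof.
move=> lf lg lu; rewrite /l2dot -rsumD; [|exact: l2_mul|exact: l2_mul].
by apply: eq_rsum => x; ring.
Qed.

Lemma l2dotZl f a u : l2 m f -> l2 m u ->
  l2dot m (fun x => a * f x) u = a * l2dot m f u.
Proof.
move=> lf lu; rewrite /l2dot -rsumZ; last exact: l2_mul.
by apply: eq_rsum => x; ring.
Qed.

Lemma l2dotBl f g u : l2 m f -> l2 m g -> l2 m u ->
  l2dot m (fun x => f x - g x) u = l2dot m f u - l2dot m g u.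
Proof.
move=> lf lg lu; rewrite /l2dot -rsumB; [|exact: l2_mul|exact: l2_mul].
by apply: eq_rsum => x; ring.
Qed.

(** The leading coefficient [r] carries no sign assumption. For [r <= 0] the polynomial is at most
    -1 at special values of [t]: [-(p + 1) / (2 q)] excludes [q != 0], and the square root of
    [(p + 1) / - r] excludes [r < 0]. *)
Lemma discriminant_le (p q r : R) : (forall t, 0 <= p + t * (2 * q) + t ^+ 2 * r) ->
  q ^+ 2 <= p * r.
Proof.
move=> H; have p0 : 0 <= p by have := H 0; rewrite mul0r expr0n mul0r !addr0.
have [r0|rn0] := leP r 0.
  have q0 : q = 0.
    apply/eqP; apply: contraT => qn0.
    have := H (- (p + 1) / (2 * q)); rewrite divfK ?mulf_neq0 ?pnatr_eq0//.
    suff : (- (p + 1) / (2 * q)) ^+ 2 * r <= 0 by lra.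
    by rewrite mulr_ge0_le0// sqr_ge0.
  rewrite q0 expr0n /=.
  have [->|pn0] := eqVneq p 0; first by rewrite mul0r.
  have pp : 0 < p by rewrite lt_def pn0.
  have := H 1; rewrite q0 !mulr0 addr0 expr1n mul1r => h1.
  have := H (2 * (p + 1)); rewrite q0 !mulr0 addr0 => h.
  rewrite mulr_ge0// leNgt; apply/negP => rn.
  have := H (Num.sqrt ((p + 1) / - r)).
  rewrite q0 !mulr0 addr0 sqr_sqrtr; last by rewrite divr_ge0 ?oppr_ge0 ?addr_ge0 ?ltW.
  by rewrite invrN mulrN mulNr divfK ?lt_eqF//; lra.
have := H (- q / r).
have -> : p + - q / r * (2 * q) + (- q / r) ^+ 2 * r = p - q ^+ 2 / r.
  by field; rewrite gt_eqF.
by rewrite subr_ge0 ler_pdivrMr.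
Qed.

Lemma l2dot_le f g : l2 m f -> l2 m g ->
  `|l2dot m f g| <= l2norm f * l2norm g.
Proof.
move=> lf lg; rewrite -(@ler_pXn2r _ 2)// ?nnegrE ?mulr_ge0 ?l2norm_ge0//.
rewrite real_normK ?num_real// exprMn; apply: discriminant_le => t.
have := sqr_ge0 (l2norm (fun x => f x + t * g x)).
have ltg := l2Z t lg; have lft := l2D lf ltg.
rewrite !l2norm_sqr_dot l2dotDl// l2dotZl// [l2dot m f (fun x => _)]l2dotC.
rewrite [l2dot m g (fun x => _)]l2dotC !l2dotDl// !l2dotZl// (l2dotC g f).
by move=> h; apply: le_trans h _; rewrite le_eqVlt; apply/orP; left; apply/eqP; ring.
Qed.

Lemma l2normD f g : l2 m f -> l2 m g ->
  l2norm (fun x => f x + g x) <= l2norm f + l2norm g.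
Proof.
move=> lf lg; rewrite -(@ler_pXn2r _ 2)// ?nnegrE ?addr_ge0 ?l2norm_ge0//.
have lfg := l2D lf lg.
rewrite l2norm_sqr_dot l2dotDl// [l2dot m f (fun x => _)]l2dotC.
rewrite [l2dot m g (fun x => _)]l2dotC !l2dotDl// (l2dotC g f) -!l2norm_sqr_dot.
have := l2dot_le lf lg; have := ler_norm (l2dot m f g).
by rewrite sqrrD; lra.
Qed.

Lemma l2normZ f a : l2 m f -> l2norm (fun x => a * f x) = `|a| * l2norm f.
Proof.
move=> /l2P lf; rewrite /l2norm (eq_rsum (g := fun x => a ^+ 2 * (m x * f x ^+ 2))).
  by rewrite rsumZ// sqrtrM ?sqr_ge0// sqrtr_sqr.
by move=> x; ring.
Qed.

Lemma l2normBC f g : l2norm (fun x => f x - g x) = l2norm (fun x => g x - f x).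
Proof. by rewrite /l2norm; congr Num.sqrt; apply: eq_rsum => x; ring. Qed.

Lemma l2normB f g : l2 m f -> l2 m g ->
  l2norm (fun x => f x - g x) <= l2norm f + l2norm g.
Proof.
move=> lf lg; have := l2normD lf (l2Z (-1) lg).
rewrite l2normZ// normrN1 mul1r; apply: le_trans; rewrite le_eqVlt; apply/orP; left.
by apply/eqP; congr l2norm; apply/funext => x; rewrite mulN1r.
Qed.

Lemma l2norm_dist f g u : l2 m f -> l2 m g -> l2 m u ->
  l2norm (fun x => f x - u x) <=
  l2norm (fun x => f x - g x) + l2norm (fun x => g x - u x).
Proof.
move=> lf lg lu; have := l2normD (l2B lf lg) (l2B lg lu).
by congr (_ <= _); congr l2norm; apply/funext => x; ring.
Qed.

Lemma l2norm_pt f x : l2 m f -> `|f x| <= (Num.sqrt (m x))^-1 * l2norm f.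
Proof.
move=> /l2P lf; rewrite mulrC ler_pdivlMr ?sqrtr_gt0//.
rewrite -sqrtr_sqr -sqrtrM ?sqr_ge0// ler_wsqrtr// mulrC.
exact: (@term_le_rsum _ _ (fun x => m x * f x ^+ 2)).
Qed.

Lemma l2_ub f C : 0 <= C ->
  (forall s, uniq s -> \sum_(x <- s) m x * f x ^+ 2 <= C ^+ 2) ->
  l2 m f /\ l2norm f <= C.
Proof.
move=> C0 H; have [sf lef] := rsummable_ub (l2_summand_ge0 f) H.
split; first exact/l2P.
by rewrite -(@ler_pXn2r _ 2)// ?nnegrE ?l2norm_ge0// l2norm_sqr.
Qed.

Lemma sum_le_l2norm f s : uniq s -> l2 m f ->
  \sum_(x <- s) m x * f x ^+ 2 <= l2norm f ^+ 2.
Proof. by move=> us /l2P lf; rewrite l2norm_sqr sum_le_rsum. Qed.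

(** Finite partial sums of squares pass to the limit, and the squared norm is their supremum. *)
Lemma l2norm_fatou (F : (X -> R) ^nat) f C : 0 <= C ->
  (forall x, F n x @[n --> \oo] --> f x) ->
  (\forall n \near \oo, l2 m (F n) /\ l2norm (F n) <= C) ->
  l2 m f /\ l2norm f <= C.
Proof.
move=> C0 Ff FC; apply: l2_ub => // s us.
have cs : \sum_(x <- s) m x * F n x ^+ 2 @[n --> \oo] --> \sum_(x <- s) m x * f x ^+ 2.
  apply: cvg_sumr => x; apply: cvgM; first exact: cvg_cst.
  by rewrite expr2; under eq_fun do rewrite expr2; apply: cvgM; exact: Ff.
apply: (cvgr_to_le cs); apply: filterS FC => n [lF nF].
by apply: le_trans (sum_le_l2norm us lF) _; rewrite lerXn2r ?nnegrE ?l2norm_ge0.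
Qed.

Lemma l2sq_cvg0 U (F : set_system U) {FF : ProperFilter F} (h : U -> X -> R) :
  (\forall t \near F, l2 m (h t)) ->
  (l2sq m (h t) @[t --> F] --> 0%E) <-> (l2norm (h t) @[t --> F] --> 0).
Proof.
move=> lh; split=> H.
  have c2 : l2norm (h t) ^+ 2 @[t --> F] --> 0.
    have cE : (l2norm (h t) ^+ 2)%:E @[t --> F] --> 0%:E.
      apply: cvg_trans H; apply: near_eq_cvg.
      by apply: filterS lh => t lt; rewrite l2sqE.
    exact: (fine_cvg cE).
  have -> : (fun t => l2norm (h t)) = (fun t => Num.sqrt (l2norm (h t) ^+ 2)).
    by apply/funext => t /=; rewrite sqrtr_sqr ger0_norm ?l2norm_ge0.
  rewrite -[X in _ --> X]sqrtr0.
  exact: (@cvg_comp _ _ _ (fun t => l2norm (h t) ^+ 2) Num.sqrt _ _ _ c2 (@sqrt_continuous R 0)).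
apply: (@cvg_trans _ ((l2norm (h t) ^+ 2)%:E @[t --> F])).
  by apply: near_eq_cvg; apply: filterS lh => t lt; rewrite l2sqE.
apply: cvg_EFin; first exact: nearW.
rewrite /= -[X in _ --> X](mulr0 0); under eq_fun do rewrite expr2.
by apply: cvgM.
Qed.

Lemma l2norm_pt_cvg U (F : set_system U) {FF : ProperFilter F} (h : U -> X -> R) f x :
  (\forall t \near F, l2 m (h t)) -> l2 m f ->
  l2norm (fun x => h t x - f x) @[t --> F] --> 0 -> h t x @[t --> F] --> f x.
Proof.
move=> lh lf H; apply/cvgrPdist_le => e e0.
have m0 : 0 < Num.sqrt (m x) by rewrite sqrtr_gt0.
have e'0 : 0 < Num.sqrt (m x) * e by rewrite mulr_gt0.
have H2 := @cvgr0_norm_le _ _ _ F _ _ H _ e'0.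
apply: filterS2 lh (H2 _) => t lt; rewrite ger0_norm ?l2norm_ge0// => le.
rewrite distrC; apply: le_trans (l2norm_pt _ (l2B lt lf)) _.
by rewrite mulrC ler_pdivrMr// mulrC.
Qed.

(* Dominated convergence, for which the squares [u ^ 2 - h ^ 2 >= (u - h) ^ 2]
   reduce to monotone convergence. *)
Lemma l2norm_dominated U (F : set_system U) {FF : ProperFilter F} (h : U -> X -> R) u :
  l2 m u -> (\forall t \near F, forall x, 0 <= h t x <= u x) ->
  (forall x, h t x @[t --> F] --> u x) ->
  l2norm (fun x => h t x - u x) @[t --> F] --> 0.
Proof.
move=> lu hu hc.
have lh : \forall t \near F, l2 m (h t).
  apply: filterS hu => t ht; apply: l2_le lu => x; have /andP[a a'] := ht x.
  by rewrite !ger0_norm//; exact: le_trans a'.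
have c2 : l2norm (h t) ^+ 2 @[t --> F] --> l2norm u ^+ 2.
  under eq_fun do rewrite l2norm_sqr; rewrite l2norm_sqr.
  apply: rsum_cvg.
  - apply: filterS hu => t ht x; have /andP[a a'] := ht x.
    rewrite l2_summand_ge0/= ler_wpM2l ?(ltW (hm x))// lerXn2r ?nnegrE//.
    exact: le_trans a'.
  - exact: (l2P u).1 lu.
  - move=> x; apply: cvgM; first exact: cvg_cst.
    by rewrite expr2; under eq_fun do rewrite expr2; apply: cvgM; exact: hc.
have cd : Num.sqrt (l2norm u ^+ 2 - l2norm (h t) ^+ 2) @[t --> F] --> 0.
  rewrite -[X in _ --> X]sqrtr0 -(subrr (l2norm u ^+ 2)).
  apply: (@cvg_comp _ _ _ (fun t => l2norm u ^+ 2 - l2norm (h t) ^+ 2) Num.sqrt).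
    by apply: cvgB c2; exact: cvg_cst.
  exact: sqrt_continuous.
apply: (squeeze_cvgr _ (cvg_cst 0) cd).
apply: filterS2 hu lh => t ht lt; rewrite l2norm_ge0/=.
rewrite /l2norm ler_wsqrtr// !sqr_sqrtr; try exact: rsum_ge0.
have su := (l2P u).1 lu; have st := (l2P (h t)).1 lt.
rewrite -rsumB//; apply: ler_rsum; [exact: (l2P _).1 (l2B lt lu)|exact: rsummableB|].
move=> x; have /andP[a a'] := ht x.
by rewrite -mulrBr ler_wpM2l ?(ltW (hm x))//; nra.
Qed.

End L2Space.

(** * The closed form and the resolvent *)

Section ClosedForm.
Variables (R : realType) (X : countType) (b : X -> X -> R) (m c : X -> R).
Variable v : X -> R.
Hypothesis hm : forall x, 0 < m x.
Hypothesis hb : weighted_graph b.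
Hypothesis hsub : subcritical b c.
Hypothesis hv0 : forall x, 0 < v x.
Hypothesis hv : superharmonic_fun b m c v.
Implicit Types (f g u w phi psi : X -> R) (x y z : X) (s : seq X).

Lemma fin_suppD f g : fin_supp f -> fin_supp g -> fin_supp (fun x => f x + g x).
Proof.
move=> /fin_suppP[s _ fs] /fin_suppP[t _ gt]; apply: (@fin_supp_seq _ _ _ (s ++ t)).
by move=> x; rewrite mem_cat negb_or => /andP[/fs -> /gt ->]; rewrite addr0.
Qed.

Lemma fin_suppZ f (a : R) : fin_supp f -> fin_supp (fun x => a * f x).
Proof.
move=> /fin_suppP[s _ fs]; apply: (@fin_supp_seq _ _ _ s).
by move=> x /fs ->; rewrite mulr0.
Qed.

Lemma fin_suppB f g : fin_supp f -> fin_supp g -> fin_supp (fun x => f x - g x).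
Proof.
move=> ff fg; have := fin_suppD ff (fin_suppZ (-1) fg).
by under eq_fun do rewrite mulN1r.
Qed.

Lemma fin_supp_dom f : fin_supp f -> formal_dom b f.
Proof. by move=> /fin_suppP[s _]; exact: formal_dom_fin. Qed.

Lemma fin_supp_l2 f : fin_supp f -> l2 m f.
Proof. by move=> /fin_suppP[s _]; exact: l2_fin. Qed.

Lemma sform_ge0 phi : fin_supp phi -> 0 <= sform b c phi phi.
Proof.
move=> fphi; case: hsub => [w [w0 _ hw]]; apply: le_trans (hw _ fphi).
by apply: rsum_ge0 => x; rewrite mulr_ge0// sqr_ge0.
Qed.

Lemma sformDr phi psi psi' : fin_supp phi -> fin_supp psi -> fin_supp psi' ->
  sform b c phi (fun x => psi x + psi' x) = sform b c phi psi + sform b c phi psi'.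
Proof.
move=> /fin_suppP[s us phis] /fin_supp_dom d /fin_supp_dom d'.
rewrite !(sformE hb _ us phis)//; last exact: formal_domD.
by rewrite -big_split; apply: eq_bigr => x _; rewrite lapD// mulrDr.
Qed.

Lemma sformZr phi psi (a : R) : fin_supp phi -> fin_supp psi ->
  sform b c phi (fun x => a * psi x) = a * sform b c phi psi.
Proof.
move=> /fin_suppP[s us phis] /fin_supp_dom d.
rewrite !(sformE hb _ us phis)//; last exact: formal_domZ.
by rewrite mulr_sumr; apply: eq_bigr => x _; rewrite lapZ// mulrCA.
Qed.

Lemma sformBr phi psi psi' : fin_supp phi -> fin_supp psi -> fin_supp psi' ->
  sform b c phi (fun x => psi x - psi' x) = sform b c phi psi - sform b c phi psi'.
Proof.
move=> fphi fpsi fpsi'; rewrite -mulN1r -sformZr// -sformDr//; last exact: fin_suppZ.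
by congr sform; apply/funext => x; rewrite mulN1r.
Qed.

Lemma sformBl phi psi psi' : fin_supp phi -> fin_supp psi -> fin_supp psi' ->
  sform b c (fun x => psi x - psi' x) phi = sform b c psi phi - sform b c psi' phi.
Proof. by move=> *; rewrite sformC sformBr// !(sformC b c phi). Qed.

Lemma sform_sqrD phi psi (t : R) : fin_supp phi -> fin_supp psi ->
  let f x := phi x + t * psi x in
  sform b c f f = sform b c phi phi + t * (2 * sform b c phi psi)
                  + t ^+ 2 * sform b c psi psi.
Proof.
move=> fphi fpsi f; have ft := fin_suppZ t fpsi.
have ff := fin_suppD fphi ft.
rewrite sformDr// sformZr// (sformC _ _ f phi) (sformC _ _ f psi).
by rewrite !sformDr// !sformZr// (sformC _ _ psi phi); ring.
Qed.

Lemma sform_sqrB phi psi : fin_supp phi -> fin_supp psi ->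
  sform b c (fun x => phi x - psi x) (fun x => phi x - psi x) =
  sform b c phi phi - 2 * sform b c phi psi + sform b c psi psi.
Proof.
move=> fphi fpsi; have := sform_sqrD (-1) fphi fpsi.
under eq_fun do rewrite mulN1r.
by move=> /= ->; ring.
Qed.

Lemma sform_CS phi psi : fin_supp phi -> fin_supp psi ->
  sform b c phi psi ^+ 2 <= sform b c phi phi * sform b c psi psi.
Proof.
move=> fphi fpsi; apply: discriminant_le => t.
by rewrite -sform_sqrD//; apply/sform_ge0/fin_suppD => //; exact: fin_suppZ.
Qed.

Lemma sform_parallelogram phi psi : fin_supp phi -> fin_supp psi ->
  sform b c (fun x => phi x - psi x) (fun x => phi x - psi x) <=
  2 * sform b c phi phi + 2 * sform b c psi psi.
Proof.
move=> fphi fpsi; have := sform_ge0 (fin_suppD fphi (fin_suppZ 1 fpsi)).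
by rewrite sform_sqrD// sform_sqrB//; lra.
Qed.

(* The ground state transform: it turns the form, whose potential [c] may be
   negative, into a sum of nonnegative terms. *)
Lemma ground_state phi : fin_supp phi ->
  let q p := b p.1 p.2 * v p.1 * v p.2 * (phi p.1 / v p.1 - phi p.2 / v p.2) ^+ 2 in
  let r x := lap b c v x / v x * phi x ^+ 2 in
  [/\ rsummable q, rsummable r & sform b c phi phi = 2^-1 * rsum q + rsum r].
Proof.
move=> fphi q r; have [s us phis] := fin_suppP fphi.
have dphi := fin_supp_dom fphi.
have dv : formal_dom b v by case: hv.
have vn x : v x != 0 by rewrite gt_eqF.
pose F x y := phi x ^+ 2 / v x * (b x y * v y).
pose G x y := phi x * (b x y * phi y).
have Fs x y : x \notin s -> F x y = 0.
  by move=> /phis h; rewrite /F h expr0n !mul0r.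
have Gs x y : x \notin s -> G x y = 0 by move=> /phis h; rewrite /G h !mul0r.
have sF x : rsummable (F x) by apply: rsummableZ; exact: dv.
have sG x : rsummable (G x) by apply: rsummableZ; exact: dphi.
have sF2 := rsummable_rows us Fs sF; have sG2 := rsummable_rows us Gs sG.
have sF3 := rsummable_swap sF2; have sG3 := rsummable_swap sG2.
have rs x : x \notin s -> r x = 0 by move=> /phis h; rewrite /r h expr0n mulr0.
have qE : q = fun p => (F p.1 p.2 - G p.1 p.2) + (F p.2 p.1 - G p.2 p.1).
  apply/funext => -[x y]; rewrite /q /F /G (weight_sym hb y x)/=.
  by field; rewrite !vn.
split.
- by rewrite qE; apply: rsummableD; exact: rsummableB.
- exact: rsummable_fin rs.
rewrite qE rsumD; try exact: rsummableB.
rewrite !rsumB// !(rsum_swap (F := F))// !(rsum_swap (F := G))//.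
rewrite (rsum_rows us Fs sF) (rsum_rows us Gs sG) (rsum_fin us rs).
have half (z : R) : 2^-1 * (z + z) = z by field.
rewrite half -sumrB -big_split/= (sformE hb _ us phis)//.
apply: eq_bigr => x _; rewrite /F /G !rsumZ; [|exact: dphi|exact: dv].
rewrite -/(nbr_sum b v x) -/(nbr_sum b phi x) /r /lap.
by field; rewrite vn.
Qed.

(** Fatou's lemma for the ground state representation. In the original form a negative [c] would
    spoil the passage to the limit; here every finite part of the two sums is bounded by the whole
    form. *)
Lemma sform_lsc (F : (X -> R) ^nat) phi C : (forall n, fin_supp (F n)) ->
  fin_supp phi -> (forall x, F n x @[n --> \oo] --> phi x) ->
  (\forall n \near \oo, sform b c (F n) (F n) <= C) -> sform b c phi phi <= C.
Proof.
move=> fF fphi Fphi FC.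
pose q (f : X -> R) (p : X * X) :=
  b p.1 p.2 * v p.1 * v p.2 * (f p.1 / v p.1 - f p.2 / v p.2) ^+ 2.
pose r (f : X -> R) x := lap b c v x / v x * f x ^+ 2.
have q0 f p : 0 <= q f p.
  by rewrite mulr_ge0 ?sqr_ge0// !mulr_ge0 ?(weight_ge0 hb)// ltW.
have r0 f x : 0 <= r f x.
  by rewrite mulr_ge0 ?sqr_ge0// divr_ge0 ?(lap_sup_ge0 hm hb hv)// ltW.
(* A finite set of pairs and a finite set of points are fixed together; the two suprema are taken
   one after the other below. *)
have key (t : seq (X * X)) (s : seq X) : uniq t -> uniq s ->
    2^-1 * (\sum_(p <- t) q phi p) + \sum_(x <- s) r phi x <= C.
  move=> ut us.
  have cs : 2^-1 * (\sum_(p <- t) q (F n) p) + \sum_(x <- s) r (F n) x @[n --> \oo]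
      --> 2^-1 * (\sum_(p <- t) q phi p) + \sum_(x <- s) r phi x.
    apply: cvgD.
      apply: cvgM; [exact: cvg_cst|apply: cvg_sumr => p].
      apply: cvgM; [exact: cvg_cst|].
      rewrite expr2; under eq_fun do rewrite expr2.
      by apply: cvgM; (apply: cvgB; (apply: cvgM; [exact: Fphi|exact: cvg_cst])).
    apply: cvg_sumr => x; apply: cvgM; [exact: cvg_cst|].
    by rewrite expr2; under eq_fun do rewrite expr2; apply: cvgM; exact: Fphi.
  apply: (cvgr_to_le cs); apply: filterS FC => n; apply: le_trans.
  have [sq sr ->] := ground_state (fF n).
  apply: lerD; last exact: (sum_le_rsum us (r0 (F n)) sr).
  by rewrite ler_wpM2l ?invr_ge0//; exact: (sum_le_rsum ut (q0 (F n)) sq).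
have [sq sr ->] : [/\ rsummable (q phi), rsummable (r phi) &
    sform b c phi phi = 2^-1 * rsum (q phi) + rsum (r phi)] := ground_state fphi.
have key2 (t : seq (X * X)) : uniq t -> 2^-1 * (\sum_(p <- t) q phi p) <= C - rsum (r phi).
  move=> ut; rewrite lerBrDr addrC -lerBrDr.
  by apply: (rsummable_ub (r0 phi) _).2 => s us; rewrite lerBrDr addrC key.
suff : rsum (q phi) <= 2 * (C - rsum (r phi)) by lra.
by apply: (rsummable_ub (q0 phi) _).2 => t /key2; lra.
Qed.

Lemma form_approx_cvg (fn : (X -> R) ^nat) f : l2 m f -> form_approx b m c fn f ->
  l2norm m (fun x => fn n x - f x) @[n --> \oo] --> 0.
Proof.
move=> lf [ffn c0 _]; apply/(@l2sq_cvg0 R X m hm nat \oo _ (fun n x => fn n x - f x)) => //.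
by apply: nearW => n; apply: l2B => //; exact: fin_supp_l2.
Qed.

(** The difference [phi] of the two sequences tends to 0 pointwise, so by semicontinuity [h(phi n)]
    is at most any bound on [h(phi n - phi k)] valid for large [k], and the Cauchy property makes
    that small. The parallelogram inequality turns two bounds [e / 4] into [e]. *)
Lemma closable (fn gn : (X -> R) ^nat) f : l2 m f ->
  form_approx b m c fn f -> form_approx b m c gn f ->
  sform b c (fun x => fn n x - gn n x) (fun x => fn n x - gn n x) @[n --> \oo] --> 0.
Proof.
move=> lf af ag; have cf := form_approx_cvg lf af; have cg := form_approx_cvg lf ag.
move: (af) (ag) => [ff _ hf] [fg _ hg].
pose phi n x := fn n x - gn n x.
have fphi n : fin_supp (phi n) by exact: fin_suppB.
have phi0 x : phi n x @[n --> \oo] --> 0.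
  rewrite -(subrr (f x)); apply: cvgB.
    apply: (l2norm_pt_cvg hm _ lf cf); apply: nearW => n; exact: fin_supp_l2.
  apply: (l2norm_pt_cvg hm _ lf cg); apply: nearW => n; exact: fin_supp_l2.
apply/cvgrPdist_le => e e0.
have e4 : 0 < e / 4 by rewrite divr_gt0.
have [N1 h1] := hf _ e4; have [N2 h2] := hg _ e4.
exists (maxn N1 N2) => // n /=; rewrite geq_max => /andP[n1 n2].
rewrite sub0r normrN ger0_norm; last exact/sform_ge0/fphi.
apply: (@sform_lsc (fun k x => phi n x - phi k x)).
- by move=> k; exact: fin_suppB.
- exact: fphi.
- move=> x; rewrite -[X in _ --> X]subr0; apply: cvgB; [exact: cvg_cst|exact: phi0].
- exists (maxn N1 N2) => // k /=; rewrite geq_max => /andP[k1 k2].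
  have -> : (fun x => phi n x - phi k x) =
      (fun x => (fn n x - fn k x) - (gn n x - gn k x)).
    by apply/funext => x; rewrite /phi; ring.
  apply: le_trans (sform_parallelogram _ _) _; try exact: fin_suppB.
  by have := h1 _ _ n1 k1; have := h2 _ _ n2 k2; rewrite /GRing.sub_fun/=; lra.
Qed.

(** [closed_form u u r] may use two different sequences for the same [u]. Polarisation gives
    [h(fn, gn) >= - h(fn - gn) / 4], and closability sends the right side to 0. *)
Lemma assoc_op_ge0 u g : assoc_op b m c u g -> 0 <= l2dot m g u.
Proof.
move=> [du lg H]; have [fn [gn [af ag cfg]]] := H _ du.
have [lu _] := du; have c0 := closable lu af ag.
have c1 : - (4^-1 * sform b c (fun x => fn n x - gn n x) (fun x => fn n x - gn n x))
    @[n --> \oo] --> 0.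
  by rewrite -oppr0 -(mulr0 4^-1); apply: cvgN; apply: cvgM => //; exact: cvg_cst.
move: (af) (ag) => [ff _ _] [fg _ _].
apply: (ler_cvg_to c1 cfg); apply: nearW => n.
have := sform_ge0 (fin_suppD (ff n) (fin_suppZ 1 (fg n))).
by rewrite sform_sqrD// sform_sqrB//; lra.
Qed.

(** Pairing [g + a u] with [u] and dropping the nonnegative term [(g, u)] leaves Cauchy-Schwarz.
    This yields uniqueness of resolvents and the contraction property of the Euler step. *)
Lemma assoc_op_contract u g (a : R) : 0 < a -> assoc_op b m c u g ->
  a * l2norm m u <= l2norm m (fun x => g x + a * u x).
Proof.
move=> a0 ug; have := assoc_op_ge0 ug; case: ug => [[lu _] lg _] h.
have lau := l2Z hm a lu; have lga := l2D hm lg lau.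
have [u0|un] := eqVneq (l2norm m u) 0.
  by rewrite u0 mulr0 l2norm_ge0.
have up : 0 < l2norm m u by rewrite lt_def un l2norm_ge0.
rewrite -(ler_pM2r up) -mulrA -expr2 (l2norm_sqr_dot hm).
have := l2dot_le hm lga lu; apply: le_trans; apply: le_trans (ler_norm _).
by rewrite l2dotDl// l2dotZl//; lra.
Qed.

End ClosedForm.

(** * The resolvent as a monotone limit of finite Dirichlet problems *)

Section Resolvent.
Variables (R : realType) (X : countType) (b : X -> X -> R) (m c : X -> R).
Variables (v : X -> R) (K : nat -> set X).
Hypothesis hm : forall x, 0 < m x.
Hypothesis hb : weighted_graph b.
Hypothesis hsub : subcritical b c.
Hypothesis hv0 : forall x, 0 < v x.
Hypothesis hv : superharmonic_fun b m c v.
Hypothesis hK : exhaustion K.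
Implicit Types (f g u w phi psi : X -> R) (x y z : X) (s : seq X).

Local Notation shift a := (fun x => c x + a * m x).

(** Together with [subcritical_shift] this makes all results on Dirichlet problems available for
    [H + a], an operator of the same kind with potential [c + a m]. *)
Lemma superharmonic_shift (a : R) : 0 <= a -> superharmonic_fun b m (shift a) v.
Proof.
move=> a0; case: hv => dv Hv; split=> // x.
rewrite (formal_opE m hb)// lap_shift mulrDr -(formal_opE m hb)// addr_ge0//.
by rewrite mulr_ge0 ?invr_ge0 ?mulr_ge0 ?(ltW (hm x)) ?(ltW (hv0 x)).
Qed.

Lemma subcritical_shift (a : R) : 0 <= a -> subcritical b (shift a).
Proof.
move=> a0; case: hsub => [w [w0 wn hw]]; exists w; split=> // phi fphi.
apply: le_trans (hw _ fphi) _.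
have dphi := fin_supp_dom b fphi; have [s us phis] := fin_suppP fphi.
rewrite !(sformE hb _ us phis)//; apply: ler_sum => x _.
rewrite lap_shift [leRHS]mulrDr lerDl mulrCA; apply: mulr_ge0.
  by rewrite mulr_ge0// ltW.
by rewrite -expr2 sqr_ge0.
Qed.

Let finK n : finite_set (K n). Proof. by case: hK. Qed.
Let monK n k : (n <= k)%N -> K n `<=` K k. Proof. by case: hK => _ h _; exact: h. Qed.

Section Approximation.
Variables (a : R) (f : X -> R).
Hypothesis a0 : 0 < a.
Hypothesis lf : l2 m f.

Let hva := superharmonic_shift (ltW a0).
Let hsa := subcritical_shift (ltW a0).

Local Notation un n := (dirichlet_inv b m (shift a) (K n) f).

Lemma fin_supp_off (A : set X) (g : X -> R) : finite_set A ->
  (forall x, ~ A x -> g x = 0) -> fin_supp g.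
Proof.
move=> finA gA; apply: (@fin_supp_seq _ _ _ (fset_set A)) => x.
by rewrite in_fset_set// notin_setE => /gA.
Qed.

Let un_off n x : ~ K n x -> un n x = 0.
Proof. exact: (dir_off hm hb hsa hv0 hva). Qed.

Let un_fin n : fin_supp (un n).
Proof. by apply: fin_supp_off (finK n) _ => x; exact: un_off. Qed.

Let lun n : l2 m (un n). Proof. exact: fin_supp_l2. Qed.

(** The weak form of the Dirichlet problem. Test functions must vanish off [K n], a constraint that
    has to be worked around when passing to the closure. *)
Lemma sform_resolvent n phi : (forall x, ~ K n x -> phi x = 0) ->
  sform b c phi (un n) = l2dot m (fun x => f x - a * un n x) phi.
Proof.
move=> phiK.
have phis x : x \notin (fset_set (K n) : seq X) -> phi x = 0.
  by rewrite in_fset_set// notin_setE => /phiK.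
rewrite (sformE hb c (fset_uniq _) phis); last exact: fin_supp_dom.
rewrite /l2dot (@rsum_fin _ _ _ (fset_set (K n))) ?fset_uniq//; last first.
  by move=> x /phis ->; rewrite !mulr0.
apply: eq_big_seq => x; rewrite in_fset_set// inE => Kx.
have -> : lap b c (un n) x = m x * f x - a * m x * un n x.
  rewrite -(lap_dir hm hb hsa hv0 hva f (finK n) Kx) (lap_shift b m c).
  by rewrite addrK.
ring.
Qed.

Lemma resolvent_norm n : a * l2norm m (un n) <= l2norm m f.
Proof.
have [u0|un0] := eqVneq (l2norm m (un n)) 0; first by rewrite u0 mulr0 l2norm_ge0.
have up : 0 < l2norm m (un n) by rewrite lt_def un0 l2norm_ge0.
rewrite -(ler_pM2r up) -mulrA -expr2 (l2norm_sqr_dot hm).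
have := l2dot_le hm lf (lun n); apply: le_trans; apply: le_trans (ler_norm _).
have := sform_ge0 hsub (un_fin n); rewrite sform_resolvent; last exact: un_off.
by rewrite l2dotBl// ?l2dotZl// ?subr_ge0//; exact: l2Z.
Qed.

(** Since [un n] is an admissible test function for [un k], the weak form yields the identity [h(un
    k - un n) + a |un k - un n|^2 = (f, un k - un n)]; the square is dropped and Cauchy-Schwarz
    applied. *)
Lemma resolvent_Cauchy n k : (n <= k)%N ->
  sform b c (fun x => un k x - un n x) (fun x => un k x - un n x) <=
  l2norm m f * l2norm m (fun x => un k x - un n x).
Proof.
move=> nk; have lB := l2B hm (lun k) (lun n).
apply: le_trans (le_trans (ler_norm _) (l2dot_le hm lf lB)).
rewrite sform_sqrB// (sformC b c (un k) (un n)) !sform_resolvent; first last.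
- by move=> x; exact: un_off.
- by move=> x nKx; apply: un_off => Knx; apply: nKx; exact: monK Knx.
- by move=> x; exact: un_off.
have lz k' : l2 m (fun x => a * un k' x) by exact: l2Z.
have := sqr_ge0 (l2norm m (fun x => un k x - un n x)).
rewrite (l2norm_sqr_dot hm) !l2dotBl// ![l2dot m _ (fun x => un k x - un n x)]l2dotC.
rewrite !l2dotBl// !l2dotZl// !(l2dotC _ f) (l2dotC _ (un n) (un k)) => h.
have h2 := mulr_ge0 (ltW a0) h.
rewrite -subr_ge0; apply: le_trans h2 _; rewrite le_eqVlt; apply/orP; left.
by apply/eqP; ring.
Qed.

Hypothesis f0 : forall x, 0 <= f x.

Let u x := lim (un n x @[n --> \oo]).

Let un_ge0 n x : 0 <= un n x.
Proof. by apply: (dirichlet_ge0 hm hb hsa hv0 hva). Qed.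

Let un_mono x n k : (n <= k)%N -> un n x <= un k x.
Proof.
by move=> nk; apply: (dirichlet_mono hm hb hsa hv0 hva) => //; exact: monK.
Qed.

Let un_cvg x : un n x @[n --> \oo] --> u x.
Proof.
apply: nondecreasing_is_cvgn; first by move=> n k; exact: un_mono.
exists ((Num.sqrt (m x))^-1 * (l2norm m f / a)) => _ [n _ <-].
apply: le_trans (ler_norm _) _; apply: le_trans (l2norm_pt hm x (lun n)) _.
by rewrite ler_wpM2l ?invr_ge0 ?sqrtr_ge0// ler_pdivlMr// mulrC resolvent_norm.
Qed.

Let un_le n x : un n x <= u x.
Proof.
apply: nondecreasing_cvgn_le; first by move=> i k; exact: un_mono.
exact: un_cvg.
Qed.

Let lu : l2 m u.
Proof.
apply: (l2norm_fatou hm (C := l2norm m f / a) _ un_cvg _).1.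
  by rewrite divr_ge0 ?l2norm_ge0// ltW.
by apply: nearW => n; split=> //; rewrite ler_pdivlMr// mulrC resolvent_norm.
Qed.

Let un_l2cvg : l2norm m (fun x => un n x - u x) @[n --> \oo] --> 0.
Proof.
apply: (l2norm_dominated hm lu) => //.
by apply: nearW => n x; rewrite un_ge0 un_le.
Qed.

Let un_Cauchy (e : R) : 0 < e -> exists N : nat, forall n k : nat,
  (N <= n)%N -> (N <= k)%N ->
  sform b c (fun x => un n x - un k x) (fun x => un n x - un k x) < e.
Proof.
(* The triangle inequality through [u] bounds the distance by [2 d], and [2 d |f| < e]; the [+ 1]
   keeps the denominator positive. *)
move=> e0; set d := e / (2 * (l2norm m f + 1)).
have f1 : 0 < l2norm m f + 1 by rewrite ltr_wpDl ?l2norm_ge0.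
have d0 : 0 < d by rewrite divr_gt0// mulr_gt0.
have [N hN] := cvg0_nat un_l2cvg d0.
have key n k : (N <= n)%N -> (n <= k)%N ->
    sform b c (fun x => un k x - un n x) (fun x => un k x - un n x) < e.
  move=> Nn nk; apply: le_lt_trans (resolvent_Cauchy nk) _.
  have := hN _ Nn; have := hN _ (leq_trans Nn nk).
  rewrite !ger0_norm ?l2norm_ge0// => h1 h2.
  have := l2norm_dist hm (lun k) lu (lun n); rewrite (l2normBC _ u) => h3.
  have h4 : l2norm m (fun x => un k x - un n x) <= 2 * d by lra.
  apply: (@le_lt_trans _ _ (l2norm m f * (2 * d))); first by rewrite ler_wpM2l ?l2norm_ge0.
  rewrite /d -[ltRHS](@divfK _ (l2norm m f + 1)) ?gt_eqF//.
  rewrite (_ : 2 * (e / (2 * _)) = e / (l2norm m f + 1)); last by field; rewrite gt_eqF.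
  by rewrite mulrC ltr_pM2l ?ltrDl// divr_gt0.
exists N => n k Nn Nk; have [nk|/ltnW kn] := leqP n k; last exact: key.
have -> : (fun x => un n x - un k x) = (fun x => -1 * (un k x - un n x)).
  by apply/funext => x; ring.
have fB : fin_supp (fun x => un k x - un n x) by exact: fin_suppB.
rewrite sformZr//; last by apply: fin_suppZ.
rewrite sformC sformZr// mulrA mulN1r opprK mul1r; exact: key.
Qed.

Let un_approx : form_approx b m c (fun n => un n) u.
Proof.
split=> //; apply/(@l2sq_cvg0 R X m hm nat \oo _ (fun n x => un n x - u x)) => //.
by apply: nearW => n; exact: l2B.
Qed.

(** The limit must satisfy the form identity against every [psi] in the closure, but the
    approximants [gn n] of [psi] need not be supported in [K n]. So [un n] is replaced by [un k]
    with [K k] containing the support of [gn n], at a cost controlled by the Cauchy property of [un]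
    and a bound on [h(gn n)]. *)
Lemma resolvent_exists_ge0 : exists u', [/\ forall x, 0 <= u' x,
  forall x, un n x @[n --> \oo] --> u' x,
  forall n x, un n x <= u' x,
  l2norm m (fun x => un n x - u' x) @[n --> \oo] --> 0 &
  assoc_op b m c u' (fun x => f x - a * u' x)].
Proof.
exists u; split=> //; first by move=> x; exact: le_trans (un_ge0 0 x) (un_le 0 x).
have lg : l2 m (fun x => f x - a * u x) by apply: l2B => //; exact: l2Z.
split=> //; first by split=> //; exists (fun n => un n).
move=> psi [lpsi [gn agn]]; exists (fun n => un n), gn; split=> //.
have cg := form_approx_cvg hm lpsi agn; move: agn => [fg _ gC].
have [N1 hN1] := gC _ ltr01.
(* From [gn n = (gn n - gn N1) + gn N1] the parallelogram inequality gives at most [2 + 2 h(gn N1)];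
   the last [+ 1] is slack. *)
pose M := 2 + 2 * sform b c (gn N1) (gn N1) + 1.
have M1 : 0 < M by have := sform_ge0 hsub (fg N1); rewrite /M; lra.
have gM n : (N1 <= n)%N -> sform b c (gn n) (gn n) <= M.
  move=> Nn; have := hN1 _ _ Nn (leqnn N1); rewrite /GRing.sub_fun/= => h.
  have fd : fin_supp (fun x => gn n x - gn N1 x) by exact: fin_suppB.
  have fg' := fg N1.
  have := sform_parallelogram hb hsub fd (fin_suppZ (-1) fg').
  have -> : (fun x => gn n x - gn N1 x - -1 * gn N1 x) = gn n.
    by apply/funext => x; ring.
  rewrite sformZr//; last exact: fin_suppZ.
  rewrite (sformC b c (fun x => -1 * gn N1 x)) sformZr//.
  by rewrite /M; lra.
have cd : l2dot m (fun x => f x - a * u x) (gn n) @[n --> \oo] -->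
    l2dot m (fun x => f x - a * u x) psi.
  apply/cvgrPdist_le => e e0.
  set G := l2norm m (fun x => f x - a * u x).
  have G1 : 0 < G + 1 by rewrite ltr_wpDl ?l2norm_ge0.
  have [N hN] := cvg0_nat cg (divr_gt0 e0 G1).
  exists N => //= n /hN; rewrite ger0_norm ?l2norm_ge0// => /ltW h.
  have lgn : l2 m (gn n) by exact: fin_supp_l2.
  rewrite -normrN opprB ![l2dot m (fun x => f x - a * u x) _]l2dotC -l2dotBl//.
  apply: le_trans (l2dot_le hm (l2B hm lgn lpsi) lg) _.
  apply: (@le_trans _ _ (e / (G + 1) * G)); first by rewrite ler_wpM2r ?l2norm_ge0.
  by rewrite -mulrA ler_piMr ?(ltW e0)// ler_pdivrMl// mulr1 lerDl.
suff key : sform b c (un n) (gn n) - l2dot m (fun x => f x - a * u x) (gn n) @[n --> \oo] --> 0.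
  rewrite -[X in _ --> X]add0r.
  rewrite (_ : (fun n => sform b c (un n) (gn n)) = (fun n =>
    sform b c (un n) (gn n) - l2dot m (fun x => f x - a * u x) (gn n) +
    l2dot m (fun x => f x - a * u x) (gn n))); first exact: cvgD.
  by apply/funext => n; rewrite subrK.
apply/cvgrPdist_le => e e0.
(* Chosen so that Cauchy-Schwarz for the form gives a square of at most [e ^ 2 / M * M = e ^ 2]. *)
have e2M : 0 < e ^+ 2 / M by rewrite divr_gt0// exprn_gt0.
have [N2 hN2] := un_Cauchy e2M.
exists (maxn N1 N2) => // n /=; rewrite geq_max => /andP[n1 n2].
rewrite sub0r normrN.
have lgn : l2 m (gn n) by exact: fin_supp_l2.
(* The index [k] of the resolvent is decoupled from [n]: the bound is shown for fixed [n] and all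
   large [k], then passes to the limit in [k]. *)
have ck : `|sform b c (un n) (gn n) - l2dot m (fun x => f x - a * un k x) (gn n)|
    @[k --> \oo] --> `|sform b c (un n) (gn n) - l2dot m (fun x => f x - a * u x) (gn n)|.
  apply: cvg_norm; apply: cvgB; first exact: cvg_cst.
  have E w : l2 m w -> l2dot m (fun x => f x - a * w x) (gn n) =
      l2dot m f (gn n) - a * l2dot m w (gn n).
    by move=> lw; rewrite l2dotBl ?l2dotZl//; exact: l2Z.
  rewrite E//; under eq_fun do rewrite E//.
  apply: cvgB; first exact: cvg_cst.
  apply: cvgM; first exact: cvg_cst.
  apply/cvgrPdist_le => e' e'0.
  have g1 : 0 < l2norm m (gn n) + 1 by rewrite ltr_wpDl ?l2norm_ge0.
  have [N hN] := cvg0_nat un_l2cvg (divr_gt0 e'0 g1).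
  exists N => //= k /hN; rewrite ger0_norm ?l2norm_ge0// => /ltW h.
  rewrite -normrN opprB -l2dotBl//.
  apply: le_trans (l2dot_le hm (l2B hm (lun k) lu) lgn) _.
  apply: (@le_trans _ _ (e' / (l2norm m (gn n) + 1) * l2norm m (gn n))).
    by rewrite ler_wpM2r ?l2norm_ge0.
  by rewrite -mulrA ler_piMr ?(ltW e'0)// ler_pdivrMl// mulr1 lerDl.
apply: (cvgr_to_le ck).
have [s us gs] := fin_suppP (fg n).
have [N3 hN3] : exists N3, forall x, x \in s -> forall k, (N3 <= k)%N -> K k x.
  elim: (s) => [|x t [N hN]]; first by exists 0%N.
  have [N' hN'] := exhaustion_near hK x; exists (maxn N N') => z.
  rewrite inE => /orP[/eqP ->|zt] k; rewrite geq_max => /andP[k1 k2]; first exact: hN'.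
  exact: hN zt _ k1.
exists (maxn N2 N3) => // k /=; rewrite geq_max => /andP[k2 k3].
rewrite -(@sform_resolvent k (gn n)); last first.
  move=> x nKx; apply: gs; apply/negP => xs; apply: nKx; exact: hN3 xs _ k3.
rewrite (sformC b c (gn n)) -sformBl//.
rewrite -(@ler_pXn2r _ 2)// ?nnegrE ?(ltW e0)// real_normK ?num_real//.
have fB : fin_supp (fun x => un n x - un k x) by exact: fin_suppB.
apply: le_trans (sform_CS hb hsub fB (fg n)) _.
apply: (@le_trans _ _ (e ^+ 2 / M * M)); last by rewrite divfK ?gt_eqF.
apply: ler_pM; [exact: sform_ge0|exact: sform_ge0| |exact: gM].
by apply/ltW; exact: hN2.
Qed.

End Approximation.

(** With [d = 1_y - a un], the weak form tested with [d] gives [h(d, a un) = a |d|^2]; expanding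
    [h(d + a un)] and dropping [h(d)] and [h(a un)] leaves the claim. Such a rate asks of [1_y] only
    that it lie in the form domain. *)
Lemma resolvent_strong (a : R) y : 0 < a ->
  \forall n \near \oo,
  let un := dirichlet_inv b m (shift a) (K n) (one_at R y) in
  2 * a * l2norm m (fun x => a * un x - one_at R y x) ^+ 2 <=
    sform b c (one_at R y) (one_at R y).
Proof.
move=> a0; have [N hN] := exhaustion_near hK y.
exists N => // n /= /hN Ky; set u := dirichlet_inv _ _ _ _ _.
have lo := l2_one hm y.
have fo := fin_supp_one R y.
have u_off x : ~ K n x -> u x = 0.
  exact: (dir_off hm hb (subcritical_shift (ltW a0)) hv0 (superharmonic_shift (ltW a0))).
have fu : fin_supp u := fin_supp_off (finK n) u_off.
have lu : l2 m u := fin_supp_l2 hm fu.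
have fau := fin_suppZ a fu.
pose d x := one_at R y x - a * u x.
have fd : fin_supp d by exact: fin_suppB.
have ld := fin_supp_l2 hm fd.
have d_off x : ~ K n x -> d x = 0.
  move=> nK; rewrite /d u_off// mulr0 subr0 /one_at; case: eqP => // E.
  by case: nK; rewrite E.
have key : sform b c d (fun x => a * u x) = a * l2norm m d ^+ 2.
  by rewrite sformZr// (sform_resolvent _ a0 d_off) (l2norm_sqr_dot hm).
rewrite l2normBC (_ : l2norm m _ = l2norm m d)//.
have oE : one_at R y = (fun x => d x + 1 * (a * u x)).
  by apply/funext => x; rewrite /d; ring.
rewrite [X in sform b c X]oE [X in sform b c _ X]oE sform_sqrD// key.
by have := sform_ge0 hsub fd; have := sform_ge0 hsub fau; lra.
Qed.

End Resolvent.

(** * The semigroup and its local boundedness *)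

Section UniformBoundedness.
Variables (R : realType) (X : countType) (m : X -> R).
Hypothesis hm : forall x, 0 < m x.
Implicit Types (f g : X -> R) (x y z : X).
Local Notation N := (l2norm m).

Definition l2_operator (A : (X -> R) -> X -> R) : Prop :=
  [/\ forall f, l2 m f -> l2 m (A f),
      forall (a : R) f g, l2 m f -> l2 m g ->
        A (fun x => a * f x + g x) = (fun x => a * A f x + A g x) &
      exists C, forall f, l2 m f -> N (A f) <= C * N f].

Lemma l2_0 : l2 m (fun=> 0). Proof. exact: (@l2_fin _ _ _ hm _ [::]). Qed.

Lemma l2norm0 : N (fun=> 0) = 0.
Proof.
by rewrite /l2norm (eq_rsum (g := fun=> 0)) ?rsum0 ?sqrtr0// => x; rewrite expr0n mulr0.
Qed.

Lemma l2norm_eq0 f : l2 m f -> N f = 0 -> f = fun=> 0.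
Proof.
move=> lf N0; apply/funext => x; apply/eqP; rewrite -normr_le0.
by apply: le_trans (l2norm_pt hm x lf) _; rewrite N0 mulr0.
Qed.

Section Operator.
Variable A : (X -> R) -> X -> R.
Hypothesis hA : l2_operator A.

Lemma l2_op f : l2 m f -> l2 m (A f).
Proof. by case: hA => lA _ _; exact: lA. Qed.

Lemma l2_op0 : A (fun=> 0) = fun=> 0.
Proof.
case: hA => _ lA _; have := lA (-1) _ _ l2_0 l2_0.
under eq_fun do rewrite mulr0 addr0.
by move=> ->; apply/funext => x; rewrite mulN1r addNr.
Qed.

Lemma l2_opZ (a : R) f : l2 m f -> A (fun x => a * f x) = fun x => a * A f x.
Proof.
move=> lf; case: hA => _ lA _; have := lA a _ _ lf l2_0.
under eq_fun do rewrite addr0.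
by move=> ->; apply/funext => x; rewrite l2_op0 addr0.
Qed.

Lemma l2_opD f g : l2 m f -> l2 m g -> A (fun x => f x + g x) = fun x => A f x + A g x.
Proof.
move=> lf lg; case: hA => _ lA _; have := lA 1 _ _ lf lg.
by under eq_fun do rewrite mul1r; move=> ->; apply/funext => x; rewrite mul1r.
Qed.

Lemma l2_opB f g : l2 m f -> l2 m g -> A (fun x => f x - g x) = fun x => A f x - A g x.
Proof.
move=> lf lg; have := l2_opD lf (l2Z hm (-1) lg); rewrite l2_opZ//.
under eq_fun do rewrite mulN1r.
by move=> ->; apply/funext => x; rewrite mulN1r.
Qed.

(** The operator norm as a supremum over the unit ball. The [3 / 4] leaves a margin over the tail
    [1 / 2] in the gliding hump below. *)
Lemma l2_op_norm : exists a, [/\ 0 <= a, forall f, l2 m f -> N (A f) <= a * N f &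
  0 < a -> exists g, [/\ l2 m g, N g <= 1 & 3 / 4 * a <= N (A g)]].
Proof.
case: (hA) => lA _ [C hC].
pose S := [set r | exists g, [/\ l2 m g, N g <= 1 & r = N (A g)]].
have S0 : S 0 by exists (fun=> 0); rewrite l2_op0 l2norm0; split=> //; exact: l2_0.
have hS : has_sup S.
  split; first by exists 0.
  exists `|C| => _ [g [lg g1 ->]]; apply: le_trans (hC _ lg) _.
  apply: le_trans (ler_norm _) _; rewrite normrM ler_piMr//.
  by rewrite ger0_norm ?l2norm_ge0.
have a0 : 0 <= sup S by apply: ub_le_sup => //; case: hS.
exists (sup S); split=> // [f lf|apos].
  have [f0|fn] := eqVneq (N f) 0.
    by rewrite f0 mulr0; have := hC _ lf; rewrite f0 mulr0.
  have fp : 0 < N f by rewrite lt_def fn l2norm_ge0.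
  rewrite -ler_pdivrMr//; apply: ub_le_sup; first by case: hS.
  exists (fun x => (N f)^-1 * f x); split; first exact: l2Z.
    by rewrite l2normZ// ger0_norm ?invr_ge0 ?l2norm_ge0// mulVf.
  by rewrite l2_opZ// l2normZ ?ger0_norm ?invr_ge0 ?l2norm_ge0 1?mulrC//; exact: lA.
have e0 : 0 < 4^-1 * sup S by rewrite mulr_gt0.
have [_ [g [lg g1 ->]] le] := sup_adherent e0 hS.
by exists g; split=> //; lra.
Qed.

End Operator.

(** Completeness of l^2 for sequences with geometric steps; [3 / 2 * 3^-1 ^ n] is the tail of the
    geometric series. *)
Lemma geometric_l2_cvg (xs : (X -> R) ^nat) : (forall n, l2 m (xs n)) ->
  (forall n, N (fun x => xs n.+1 x - xs n x) <= 3^-1 ^+ n) ->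
  exists f, l2 m f /\ forall n, N (fun x => f x - xs n x) <= 3 / 2 * 3^-1 ^+ n.
Proof.
move=> lxs hxs.
have tail n k : (n <= k)%N ->
    N (fun x => xs k x - xs n x) <= 3 / 2 * (3^-1 ^+ n - 3^-1 ^+ k).
  elim: k => [|k IH]; first by rewrite leqn0 => /eqP ->;
    rewrite subrr mulr0 (_ : (fun x => _) = fun=> 0) ?l2norm0//;
    apply/funext => x; rewrite subrr.
  rewrite leq_eqVlt => /orP[/eqP ->|].
    rewrite subrr mulr0 (_ : (fun x => _) = fun=> 0) ?l2norm0//.
    by apply/funext => x; rewrite subrr.
  rewrite ltnS => /IH h; have := l2norm_dist hm (lxs k.+1) (lxs k) (lxs n).
  have := hxs k; rewrite exprS; move: (3^-1 ^+ k) (3^-1 ^+ n) h => p q; lra.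
have g0 : (3^-1 : R) ^+ n @[n --> \oo] --> 0.
  by apply: cvg_expr; rewrite ger0_norm ?invr_ge0// invf_lt1// ltr1n.
have cx x : cvgn (fun n => xs n x).
  pose C := (Num.sqrt (m x))^-1.
  have C0 : 0 <= C by rewrite invr_ge0 sqrtr_ge0.
  have step n k : (n <= k)%N -> `|xs k x - xs n x| <= C * (3 / 2 * (3^-1 ^+ n - 3^-1 ^+ k)).
    move=> nk; apply: le_trans (l2norm_pt hm x (l2B hm (lxs k) (lxs n))) _.
    by rewrite ler_wpM2l// tail.
  (* Adding the accumulated step bounds makes the sequence nondecreasing, so that convergence
     follows from boundedness. *)
  pose y n := xs n x + C * (3 / 2 * (1 - 3^-1 ^+ n)).
  have cy : cvgn y.
    apply: nondecreasing_is_cvgn.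
      move=> n k nk; rewrite /y -subr_ge0.
      have := step _ _ nk; rewrite ler_norml => /andP[+ _].
      by rewrite -subr_ge0 => h; apply: le_trans h _; rewrite le_eqVlt;
        apply/orP; left; apply/eqP; field.
    exists (xs 0%N x + C * (3 / 2) + C * (3 / 2)) => _ [n _ <-]; rewrite /y.
    have := step _ _ (leq0n n); rewrite expr0 ler_norml => /andP[_].
    have p0 : 0 <= (3^-1 : R) ^+ n by rewrite exprn_ge0// invr_ge0.
    have := mulr_ge0 C0 p0; rewrite !mulrBr !mulr1 mulrA.
    by move: (3^-1 ^+ n) => p; rewrite -!mulrA; nra.
  have cz : C * (3 / 2 * (1 - 3^-1 ^+ n)) @[n --> \oo] --> C * (3 / 2 * (1 - 0)).
    apply: cvgM; [exact: cvg_cst|apply: cvgM; [exact: cvg_cst|]].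
    by apply: cvgB => //; exact: cvg_cst.
  apply/cvg_ex; exists (lim (y n @[n --> \oo]) - C * (3 / 2 * (1 - 0))).
  rewrite (_ : (fun n => xs n x) = fun n => y n - C * (3 / 2 * (1 - 3^-1 ^+ n))).
    by apply: cvgB.
  by apply/funext => n; rewrite /y addrK.
pose f x := lim (xs n x @[n --> \oo]).
have key n : l2 m (fun x => f x - xs n x) /\
    N (fun x => f x - xs n x) <= 3 / 2 * 3^-1 ^+ n.
  have p0 k : 0 <= (3^-1 : R) ^+ k by rewrite exprn_ge0// invr_ge0.
  apply: (l2norm_fatou hm (F := fun k x => xs k x - xs n x)).
  - by rewrite mulr_ge0.
  - by move=> x; apply: cvgB; [exact: cx|exact: cvg_cst].
  - exists n => // k /= nk; split; first exact: l2B.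
    by apply: le_trans (tail _ _ nk) _; rewrite ler_wpM2l// lerBlDr lerDl.
exists f; split; last by move=> n; exact: (key n).2.
have := l2D hm (key 0%N).1 (lxs 0%N).
by under eq_fun do rewrite subrK.
Qed.

(* The gliding hump: the sign of the n-th term of [sum_n +- 3^-n g_n] is chosen
   so that [A n] does not shrink the contribution of [g_n], which is almost
   optimal for the operator norm of [A n]; the tail is too small to cancel it. *)
Lemma uniform_boundedness (A : nat -> (X -> R) -> X -> R) :
  (forall n, l2_operator (A n)) ->
  (forall f, l2 m f -> exists C, forall n, N (A n f) <= C) ->
  exists n, forall f, l2 m f -> N (A n f) <= 4 * 3 ^+ n * n%:R * N f.
Proof.
move=> hA hpt; apply: contrapT => H.
have /choice[a ha] := fun n => l2_op_norm (hA n).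
have abig n : 4 * 3 ^+ n * n%:R < a n.
  rewrite ltNge; apply/negP => le; apply: H; exists n => f lf.
  have [_ h _] := ha n; apply: le_trans (h f lf) _.
  by rewrite ler_wpM2r ?l2norm_ge0.
have M0 n : 0 <= 4 * 3 ^+ n * n%:R :> R by rewrite mulr_ge0// mulr_ge0// exprn_ge0.
have apos n : 0 < a n by exact: le_lt_trans (abig n).
have /choice[g hg] : forall n, exists g, [/\ l2 m g, N g <= 1 & 3 / 4 * a n <= N (A n g)].
  by move=> n; have [_ _] := ha n; exact.
pose e n : R := 3^-1 ^+ n.
have e0 n : 0 < e n by rewrite exprn_gt0// invr_gt0.
pose xs := fix F n := if n is k.+1 then
    let p := fun x => F k x + e k * g k x in
    if e k * N (A k (g k)) <= N (A k p) then p else fun x => F k x + - e k * g k x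
  else (fun=> 0 : R).
have lxs n : l2 m (xs n).
  elim: n => [|n IH]; first exact: l2_0.
  by have [lg _ _] := hg n; rewrite /=; case: ifP => _; apply: l2D => //; exact: l2Z.
have stepx n : N (fun x => xs n.+1 x - xs n x) <= e n.
  have [lg g1 _] := hg n.
  have E : N (fun x => xs n.+1 x - xs n x) = e n * N (g n).
    rewrite /=; case: ifP => _.
      rewrite (_ : (fun x => _) = fun x => e n * g n x).
        by rewrite l2normZ// ger0_norm// ltW.
      by apply/funext => x; rewrite addrAC subrr add0r.
    rewrite (_ : (fun x => _) = fun x => - e n * g n x).
      by rewrite l2normZ// normrN ger0_norm// ltW.
    by apply/funext => x; rewrite addrAC subrr add0r.
  by rewrite E ler_piMr// ltW.
have grow n : e n * N (A n (g n)) <= N (A n (xs n.+1)).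
  have [lg _ _] := hg n; rewrite /=; case: ifPn => //; rewrite -ltNge => lt.
  have lp := l2D hm (lxs n) (l2Z hm (e n) lg).
  have lq := l2D hm (lxs n) (l2Z hm (- e n) lg).
  have := l2normB hm (l2_op (hA n) lp) (l2_op (hA n) lq).
  rewrite -(l2_opB (hA n))//.
  rewrite (_ : (fun x => _ - _) = fun x => 2 * e n * g n x); last first.
    by apply/funext => x; ring.
  rewrite (l2_opZ (hA n))// (l2normZ hm); last exact: l2_op.
  rewrite ger0_norm ?mulr_ge0 ?(ltW (e0 n))//.
  by move: lt; rewrite -mulrA; lra.
have [f [lf hf]] := geometric_l2_cvg lxs stepx.
have [C hC] := hpt f lf.
(* The nearly optimal [g n] contributes at least [3/4 * a n * e n], the tail costs at most
   [1/2 * a n * e n], and [4 * 3 ^ n * n < a n] makes the remaining quarter at least [n]. *)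
have low n : n%:R <= N (A n f).
  have [lg _ h1] := hg n.
  have h2 := grow n; have h3 := hf n.+1; have [_ h4 _] := ha n.
  have lB := l2B hm lf (lxs n.+1).
  have {}h4 := h4 _ lB.
  have := l2norm_dist hm (l2_op (hA n) (lxs n.+1)) (l2_op (hA n) lf) l2_0.
  rewrite (_ : (fun x => A n (xs n.+1) x - 0) = A n (xs n.+1)); last first.
    by apply/funext => x; rewrite subr0.
  rewrite (_ : (fun x => A n f x - 0) = A n f); last by apply/funext => x; rewrite subr0.
  rewrite l2normBC -(l2_opB (hA n))// => h5.
  have h6 : a n * N (fun x => f x - xs n.+1 x) <= a n * (1 / 2 * e n).
    rewrite ler_wpM2l ?(ltW (apos n))//; apply: le_trans h3 _.
    by rewrite exprS /e le_eqVlt; apply/orP; left; apply/eqP; field.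
  have h7 : 3 / 4 * (a n * e n) <= e n * N (A n (g n)).
    by rewrite mulrA [leLHS]mulrC ler_wpM2l// ltW.
  have h8 : n%:R <= 4^-1 * (a n * e n).
    have := ltW (abig n); rewrite -(ler_pM2r (e0 n)) => h.
    suff : 4 * 3 ^+ n * n%:R * e n = 4 * n%:R :> R by lra.
    rewrite /e exprVn; field; exact: expf_neq0.
  by lra.
have [k hk] : exists k : nat, C < k%:R.
  exists (Num.bound `|C|); apply: le_lt_trans (ler_norm _) _.
  exact: archi_boundP.
by have := le_trans (low k) (hC k); rewrite leNgt hk.
Qed.

End UniformBoundedness.

(** * Bounds and continuity of the semigroup in time *)

Section Semigroup.
Variables (R : realType) (X : countType) (b : X -> X -> R) (m c : X -> R).
Variable T : R -> (X -> R) -> X -> R.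
Hypothesis hm : forall x, 0 < m x.
Hypothesis hT : semigroup_of b m c T.
Implicit Types (f g : X -> R) (x y z : X) (s t : R).
Local Notation N := (l2norm m).

Lemma semigroup_operator t : 0 <= t -> l2_operator m (T t).
Proof.
move=> t0; split.
- by move=> f; exact: (semigroup_l2 hT).
- by move=> a f g; exact: (semigroup_linear hT).
- have [C hC] := semigroup_bounded hT t0.
  exists (Num.sqrt `|C|) => f lf; have := hC _ lf.
  rewrite !l2sqE//; last exact: (semigroup_l2 hT).
  rewrite -EFinM lee_fin => h.
  rewrite -(@ler_pXn2r _ 2)// ?nnegrE ?mulr_ge0 ?sqrtr_ge0 ?l2norm_ge0//.
  rewrite exprMn (sqr_sqrtr (normr_ge0 C)); apply: le_trans h _.
  by rewrite ler_wpM2r ?sqr_ge0// ler_norm.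
Qed.

Let lT t f : 0 <= t -> l2 m f -> l2 m (T t f).
Proof. exact: (semigroup_l2 hT). Qed.

Lemma at_right0P (F : R -> R) :
  F t @[t --> 0^'+] --> 0 <->
  forall e, 0 < e -> exists2 d, 0 < d & forall t, 0 < t -> t < d -> `|F t| < e.
Proof.
split=> [F0 e e0|H].
  have /cvgrPdist_lt/(_ e e0) := F0.
  move=> [d /= d0 hd]; exists d => // t t0 td.
  have := hd t; rewrite /ball/= sub0r normrN ger0_norm ?ltW// => /(_ td t0).
  by rewrite sub0r normrN.
apply/cvgrPdist_lt => e /H[d d0 hd]; exists d => //= t.
rewrite /ball/= sub0r normrN => td t0; rewrite sub0r normrN; apply: hd => //.
by rewrite gtr0_norm in td.
Qed.

Lemma semigroup_cvg0 f e : l2 m f -> 0 < e ->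
  exists2 d, 0 < d & forall t, 0 <= t -> t < d -> N (fun x => T t f x - f x) < e.
Proof.
move=> lf e0; have := semigroup_continuous hT lf.
have near0 : \forall t \near (0:R)^'+, l2 m (fun x => T t f x - f x).
  by apply: filterS (nbhs_right_ge (0:R)) => t t0; apply: l2B => //; exact: lT.
move=> /(@l2sq_cvg0 R X m hm _ _ _ (fun t x => T t f x - f x) near0)/at_right0P/(_ e e0).
move=> [d d0 hd]; exists d => // t; rewrite le_eqVlt => /orP[/eqP <- _|t0 td].
  rewrite (semigroup0 hT)// (_ : (fun x => _) = fun=> 0) ?(l2norm0 m)//.
  by apply/funext => x; rewrite subrr.
by have := hd _ t0 td; rewrite ger0_norm ?l2norm_ge0.
Qed.

Lemma semigroup_generatorP f g : l2 m f -> l2 m g ->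
  assoc_op b m c f g <-> forall e, 0 < e -> exists2 d, 0 < d &
    forall t, 0 < t -> t < d -> N (fun x => t^-1 * (f x - T t f x) - g x) < e.
Proof.
move=> lf lg; rewrite -(semigroup_generator hT lf lg).
have near0 : \forall t \near (0:R)^'+, l2 m (fun x => t^-1 * (f x - T t f x) - g x).
  apply: filterS (nbhs_right_ge (0:R)) => t t0; apply: l2B => //; apply: l2Z => //.
  by apply: l2B => //; exact: lT.
rewrite (l2sq_cvg0 hm near0) at_right0P; split=> H e /H[d d0 hd]; exists d => // t t0 td.
  by have := hd _ t0 td; rewrite ger0_norm ?l2norm_ge0.
by rewrite ger0_norm ?l2norm_ge0// hd.
Qed.

Lemma assoc_op_l2 f g : assoc_op b m c f g -> l2 m f /\ l2 m g.
Proof. by case=> -[]. Qed.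

(** In [assoc_op] the approximating sequences may depend on the test function; linearity is read off
    instead from the difference quotients of the semigroup. *)
Lemma assoc_op_linear (a : R) f g f' g' : assoc_op b m c f g -> assoc_op b m c f' g' ->
  assoc_op b m c (fun x => a * f x + f' x) (fun x => a * g x + g' x).
Proof.
move=> fg fg'; have [lf lg] := assoc_op_l2 fg; have [lf' lg'] := assoc_op_l2 fg'.
apply/semigroup_generatorP; [by apply: l2D => //; exact: l2Z|by apply: l2D => //; exact: l2Z|].
move=> e e0.
have a1 : 0 < `|a| + 1 by rewrite ltr_wpDl.
have e1 : 0 < e / 2 / (`|a| + 1) by rewrite !divr_gt0.
have e2 : 0 < e / 2 by rewrite divr_gt0.
have [d1 d10 h1] := (semigroup_generatorP lf lg).1 fg _ e1.
have [d2 d20 h2] := (semigroup_generatorP lf' lg').1 fg' _ e2.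
exists (Num.min d1 d2); first by rewrite lt_min d10.
move=> t t0; rewrite lt_min => /andP[/(h1 _ t0) k1 /(h2 _ t0) k2].
have t0' := ltW t0.
rewrite (semigroup_linear hT)//.
pose u x := t^-1 * (f x - T t f x) - g x.
pose w x := t^-1 * (f' x - T t f' x) - g' x.
have lu : l2 m u by apply: l2B => //; apply: l2Z => //; apply: l2B => //; exact: lT.
have lw : l2 m w by apply: l2B => //; apply: l2Z => //; apply: l2B => //; exact: lT.
rewrite (_ : (fun x => _) = fun x => a * u x + w x); last first.
  by apply/funext => x; rewrite /u /w; ring.
apply: le_lt_trans (l2normD hm (l2Z hm a lu) lw) _; rewrite (l2normZ hm)//.
have k1' : `|a| * N u <= e / 2.
  apply: (@le_trans _ _ (`|a| * (e / 2 / (`|a| + 1)))); first by rewrite ler_wpM2l// ltW.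
  by rewrite mulrCA ler_piMr ?(ltW e2)// ler_pdivrMr// mul1r lerDl.
rewrite -/w in k2; lra.
Qed.

(** [T t] is bounded and commutes with the difference quotients at 0. *)
Lemma assoc_op_semigroup t f g : 0 <= t -> assoc_op b m c f g ->
  assoc_op b m c (T t f) (T t g).
Proof.
move=> t0 fg; have [lf lg] := assoc_op_l2 fg.
apply/semigroup_generatorP; [exact: lT|exact: lT|].
have hA := semigroup_operator t0.
have [a [a0 ha _]] := l2_op_norm hm hA.
move=> e e0; have a1 : 0 < a + 1 by rewrite ltr_wpDl.
have [d d0 h] := (semigroup_generatorP lf lg).1 fg _ (divr_gt0 e0 a1).
exists d => // s s0 sd; have s0' := ltW s0.
pose u x := s^-1 * (f x - T s f x) - g x.
have lB : l2 m (fun x => f x - T s f x) by apply: l2B => //; exact: lT.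
have lu : l2 m u by apply: l2B => //; exact: l2Z.
rewrite (_ : (fun x => _) = T t u); last first.
  rewrite /u (l2_opB hm hA)//; last exact: l2Z.
  rewrite (l2_opZ hm hA)// (l2_opB hm hA)//; last exact: lT.
  by rewrite -!(semigroupD hT)// addrC.
apply: le_lt_trans (ha _ lu) _.
apply: (@le_lt_trans _ _ (a * (e / (a + 1)))).
  by rewrite ler_wpM2l// ltW// h.
rewrite mulrCA -[ltRHS]mulr1 ltr_pM2l// ltr_pdivrMr// mul1r.
by rewrite ltrDl.
Qed.

(** Were it false, there would be times [ts n] in [[0, 1 / (n + 1)]] at which [T] violates the bound
    [4 * 3 ^ n * n]. Strong continuity at 0 bounds each orbit along [ts], so the uniform boundedness
    principle is contradicted. *)
Lemma semigroup_locally_bounded :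
  exists d M, [/\ 0 < d, 1 <= M & forall t f, 0 <= t -> t <= d -> l2 m f ->
    N (T t f) <= M * N f].
Proof.
apply: contrapT => H.
have bad n : exists t, [/\ 0 <= t, t <= n.+1%:R^-1 &
    exists f, l2 m f /\ 4 * 3 ^+ n * n%:R * N f < N (T t f)].
  apply: contrapT => Hn; apply: H; exists n.+1%:R^-1, (1 + 4 * 3 ^+ n * n%:R).
  split; rewrite ?invr_gt0 ?ltr0n ?lerDl ?mulr_ge0 ?exprn_ge0//.
  move=> t f t0 td lf; rewrite leNgt; apply/negP => lt.
  apply: Hn; exists t; split=> //; exists f; split=> //.
  apply: le_lt_trans lt; rewrite ler_wpM2r ?l2norm_ge0//.
  by rewrite lerDr.
have /choice[ts hts] := bad.
have ts0 n : 0 <= ts n by have [] := hts n.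
have := @uniform_boundedness R X m hm (fun n => T (ts n)) (fun n => semigroup_operator (ts0 n)).
case=> [f lf|n hn]; last first.
  by have [_ _ [f [lf]]] := hts n; rewrite ltNge hn.
have [d d0 hd] := semigroup_cvg0 lf ltr01.
have [n0 hn0] : exists n0 : nat, forall n, (n0 <= n)%N -> ts n < d.
  have [n0 h0] : exists n0 : nat, d^-1 < n0%:R.
    by exists (Num.bound d^-1); apply: archi_boundP; rewrite invr_ge0 ltW.
  exists n0 => n n0n; have [_ le _] := hts n; apply: le_lt_trans le _.
  rewrite invf_plt ?posrE ?ltr0n//; apply: lt_le_trans h0 _.
  by rewrite ler_nat; exact: leqW.
(* The finitely many times before [n0] are absorbed by the sum of their norms. *)
exists (\sum_(i < n0) N (T (ts i) f) + (N f + 1)) => n.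
have [n0n|nn0] := leqP n0 n.
  apply: ler_wpDl; first by apply: sumr_ge0 => i _; exact: l2norm_ge0.
  have := l2normD hm (l2B hm (lT (ts0 n) lf) lf) lf.
  rewrite (_ : (fun x => _ - _ + _) = T (ts n) f); last first.
    by apply/funext => x; rewrite subrK.
  by have := hd _ (ts0 n) (hn0 _ n0n); lra.
rewrite (bigD1 (Ordinal nn0))//= -addrA lerDl addr_ge0 ?addr_ge0 ?l2norm_ge0//.
by apply: sumr_ge0 => i _; exact: l2norm_ge0.
Qed.

(** Up to time [t] there are [n] steps of length at most [d], each costing a factor [M]. *)
Lemma semigroup_bounded_on t : exists M, 1 <= M /\
  forall s f, 0 <= s -> s <= t -> l2 m f -> N (T s f) <= M * N f.
Proof.
have [d [M [d0 M1 hM]]] := semigroup_locally_bounded.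
have M0 : 0 <= M by exact: le_trans M1.
have H n : forall s f, 0 <= s -> s <= n%:R * d -> l2 m f -> N (T s f) <= M ^+ n * N f.
  elim: n => [|n IH] s f s0 sn lf.
    have -> : s = 0 by apply/eqP; rewrite eq_le s0 andbT -[leRHS](mul0r d).
    by rewrite (semigroup0 hT)// mul1r.
  have [sd|/ltW ds] := leP s d.
    apply: le_trans (hM _ _ s0 sd lf) _; rewrite ler_wpM2r ?l2norm_ge0//.
    by rewrite exprS ler_peMr// exprn_ege1.
  have sd0 : 0 <= s - d by rewrite subr_ge0.
  rewrite -(subrK d s) addrC (semigroupD hT)//; last exact: ltW.
  apply: le_trans (hM _ _ (ltW d0) (lexx _) (lT sd0 lf)) _.
  rewrite exprS -mulrA ler_wpM2l// IH// lerBlDr.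
  by rewrite -natr1 mulrDl mul1r in sn.
have [n hn] : exists n : nat, `|t| / d < n%:R.
  by exists (Num.bound (`|t| / d)); apply: archi_boundP; rewrite divr_ge0// ltW.
exists (M ^+ n); split; first exact: exprn_ege1.
move=> s f s0 st lf; apply: H => //; apply: le_trans st _; apply: le_trans (ler_norm _) _.
by rewrite -ler_pdivrMr// ltW.
Qed.

Lemma semigroup_unif_continuous t f e : l2 m f -> 0 < e ->
  exists2 d, 0 < d & forall r s, 0 <= r -> r <= t -> 0 <= s -> s <= t ->
    `|r - s| < d -> N (fun x => T r f x - T s f x) < e.
Proof.
move=> lf e0; have [M [M1 hM]] := semigroup_bounded_on t.
have M0 : 0 < M by exact: lt_le_trans M1.
have [d d0 hd] := semigroup_cvg0 lf (divr_gt0 e0 M0).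
exists d => // r s r0 rt s0 st.
wlog rs : r s r0 rt s0 st / s <= r => [hw|].
  have [|/ltW] := leP s r; first exact: hw.
  by move=> sr; rewrite distrC (l2normBC m); exact: hw.
have rs0 : 0 <= r - s by rewrite subr_ge0.
rewrite ger0_norm// => rsd.
have lB : l2 m (fun x => T (r - s) f x - f x) by apply: l2B => //; exact: lT.
rewrite (_ : (fun x => _) = T s (fun x => T (r - s) f x - f x)); last first.
  rewrite (l2_opB hm (semigroup_operator s0))//; last exact: lT.
  by rewrite -(semigroupD hT)// addrC subrK.
apply: le_lt_trans (hM _ _ s0 st lB) _.
by rewrite mulrC -ltr_pdivlMr// hd.
Qed.

End Semigroup.

(** * Positivity of the semigroup *)

Section Positivity.
Variables (R : realType) (X : countType) (b : X -> X -> R) (m c : X -> R).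
Variables (v : X -> R) (K : nat -> set X) (T : R -> (X -> R) -> X -> R).
Hypothesis hm : forall x, 0 < m x.
Hypothesis hb : weighted_graph b.
Hypothesis hsub : subcritical b c.
Hypothesis hv0 : forall x, 0 < v x.
Hypothesis hv : superharmonic_fun b m c v.
Hypothesis hK : exhaustion K.
Hypothesis hT : semigroup_of b m c T.
Implicit Types (f g u : X -> R) (x y z : X) (s t e : R).
Local Notation N := (l2norm m).
Local Notation assoc := (assoc_op b m c).

Lemma assoc_op_eq f f' g g' : assoc f g -> f =1 f' -> g =1 g' -> assoc f' g'.
Proof. by move=> + /funext <- /funext <-. Qed.

Lemma assoc_op0 f g : assoc f g -> assoc (fun=> 0) (fun=> 0).
Proof.
move=> fg; have := assoc_op_linear hm hT (-1) fg fg.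
by move/assoc_op_eq; apply => x; ring.
Qed.

(* One step of the implicit Euler scheme: [euler e f = (1 + e H)^-1 f]. *)
Definition euler e f : X -> R :=
  xget (fun=> 0) [set u | assoc u (fun x => e^-1 * (f x - u x))].

Lemma euler_uniq e f u u' : 0 < e ->
  assoc u (fun x => e^-1 * (f x - u x)) -> assoc u' (fun x => e^-1 * (f x - u' x)) ->
  u = u'.
Proof.
move=> e0 hu hu'; have [lu _] := assoc_op_l2 hu; have [lu' _] := assoc_op_l2 hu'.
have hd := assoc_op_linear hm hT (-1) hu' hu.
have ld : l2 m (fun x => -1 * u' x + u x) by have [] := assoc_op_l2 hd.
have e1 : 0 < e^-1 by rewrite invr_gt0.
have := assoc_op_contract hm hb hsub hv0 hv e1 hd.
rewrite [X in _ <= l2norm m X](_ : _ = fun=> 0); last by apply/funext => x; ring.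
rewrite (l2norm0 m) pmulr_rle0// => le0.
have N0 : N (fun x => -1 * u' x + u x) = 0 by apply/eqP; rewrite eq_le le0 l2norm_ge0.
apply/funext => x; have := congr1 (@^~ x) (l2norm_eq0 hm ld N0) => /=.
by move/eqP; rewrite mulN1r addrC subr_eq0 => /eqP.
Qed.

Lemma euler_exists e f : 0 < e -> l2 m f ->
  exists u, assoc u (fun x => e^-1 * (f x - u x)).
Proof.
move=> e0 lf; have e1 : 0 < e^-1 by rewrite invr_gt0.
have pos g : l2 m g -> (forall x, 0 <= g x) ->
    exists u, assoc u (fun x => e^-1 * (g x - u x)).
  move=> lg g0; have lg' := l2Z hm e^-1 lg.
  have g0' x : 0 <= e^-1 * g x by rewrite mulr_ge0// ltW.
  have [u [_ _ _ _ hu]] := resolvent_exists_ge0 hm hb hsub hv0 hv hK e1 lg' g0'.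
  by exists u; apply: (assoc_op_eq hu) => // x; rewrite mulrBr.
have lfp : l2 m (fun x => Num.max (f x) 0).
  apply: (l2_le hm) lf => x; rewrite [leLHS]ger0_norm ?le_max ?lexx ?orbT//.
  by rewrite ge_max ler_norm normr_ge0.
have lfn : l2 m (fun x => Num.max (f x) 0 - f x) by exact: l2B.
have [u1 h1] := pos _ lfp (fun x => ltac:(by rewrite le_max lexx orbT)).
have [u2 h2] := pos _ lfn (fun x => ltac:(by rewrite subr_ge0 le_max lexx)).
exists (fun x => -1 * u2 x + u1 x).
apply: (assoc_op_eq (assoc_op_linear hm hT (-1) h2 h1)) => // x; ring.
Qed.

Lemma eulerP e f : 0 < e -> l2 m f ->
  assoc (euler e f) (fun x => e^-1 * (f x - euler e f x)).
Proof.
move=> e0 lf; rewrite /euler.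
exact: (@xgetPex _ (fun=> 0) _ (euler_exists e0 lf)).
Qed.

Lemma l2_euler e f : 0 < e -> l2 m f -> l2 m (euler e f).
Proof. by move=> e0 lf; have [] := assoc_op_l2 (eulerP e0 lf). Qed.

Lemma euler_contract e f : 0 < e -> l2 m f -> N (euler e f) <= N f.
Proof.
move=> e0 lf; have hP := eulerP e0 lf; have e1 : 0 < e^-1 by rewrite invr_gt0.
have := assoc_op_contract hm hb hsub hv0 hv e1 hP.
rewrite [X in _ <= l2norm m X](_ : _ = fun x => e^-1 * f x); last first.
  by apply/funext => x; ring.
by rewrite (l2normZ hm)// ger0_norm ?(ltW e1)// ler_pM2l.
Qed.

Lemma euler_linear e (a : R) f g : 0 < e -> l2 m f -> l2 m g ->
  euler e (fun x => a * f x + g x) = fun x => a * euler e f x + euler e g x.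
Proof.
move=> e0 lf lg; have lfg : l2 m (fun x => a * f x + g x) by apply: l2D => //; exact: l2Z.
apply: (euler_uniq e0 (eulerP e0 lfg)).
apply: (assoc_op_eq (assoc_op_linear hm hT a (eulerP e0 lf) (eulerP e0 lg))) => // x.
ring.
Qed.

Lemma euler_operator e : 0 < e -> l2_operator m (euler e).
Proof.
move=> e0; split; [by move=> f; exact: l2_euler|by move=> a f g; exact: euler_linear|].
by exists 1 => f lf; rewrite mul1r euler_contract.
Qed.

Lemma euler_ge0 e f : 0 < e -> l2 m f -> (forall x, 0 <= f x) ->
  forall x, 0 <= euler e f x.
Proof.
move=> e0 lf f0; have e1 : 0 < e^-1 by rewrite invr_gt0.
have lf' := l2Z hm e^-1 lf.
have f0' x : 0 <= e^-1 * f x by rewrite mulr_ge0// ltW.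
have [u [u0 _ _ _ hu]] := resolvent_exists_ge0 hm hb hsub hv0 hv hK e1 lf' f0'.
suff -> : euler e f = u by [].
apply: (euler_uniq e0 (eulerP e0 lf)).
by apply: (assoc_op_eq hu) => // x; rewrite mulrBr.
Qed.

(** A resolvent identity: [f] solves the Euler equation with datum [f + e g]. *)
Lemma euler_generator e f g : 0 < e -> assoc f g ->
  forall x, f x - euler e f x = e * euler e g x.
Proof.
move=> e0 fg x; have [lf lg] := assoc_op_l2 fg.
have lfg : l2 m (fun x => e * g x + f x) by apply: l2D => //; exact: l2Z.
have E : euler e (fun x => e * g x + f x) = f.
  apply: (euler_uniq e0 (eulerP e0 lfg)); apply: (assoc_op_eq fg) => // z.
  by rewrite addrK mulKf// gt_eqF.
by rewrite -{1}E euler_linear// addrK.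
Qed.

Lemma euler_semigroup e t f : 0 < e -> 0 <= t -> l2 m f ->
  T t (euler e f) = euler e (T t f).
Proof.
move=> e0 t0 lf; have lTf : l2 m (T t f) by exact: (semigroup_l2 hT).
have hA := semigroup_operator hm hT t0.
have lP := l2_euler e0 lf.
apply: (euler_uniq e0 _ (eulerP e0 lTf)).
apply: (assoc_op_eq (assoc_op_semigroup hm hT t0 (eulerP e0 lf))) => // x.
by rewrite (l2_opZ hm hA) ?(l2_opB hm hA)//; exact: l2B.
Qed.

Lemma euler_cvg_generator e f g : 0 < e -> assoc f g ->
  N (fun x => euler e f x - f x) <= e * N g.
Proof.
move=> e0 fg; have [lf lg] := assoc_op_l2 fg; have lP := l2_euler e0 lg.
rewrite l2normBC (_ : (fun x => _) = fun x => e * euler e g x).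
  by rewrite (l2normZ hm)// ger0_norm ?(ltW e0)// ler_pM2l// euler_contract.
by apply/funext => x; exact: euler_generator.
Qed.

(* Chernoff's estimate: telescoping [T_(k e) - P^k], each step costs
   [(T_e - P) f = o(e)]. *)
Lemma semigroup_euler_dist e t M f (r : R) k : 0 < e -> 0 <= M -> l2 m f ->
  (forall s f, 0 <= s -> s <= t -> l2 m f -> N (T s f) <= M * N f) ->
  N (fun x => T e f x - euler e f x) <= r -> k%:R * e <= t ->
  N (fun x => T (k%:R * e) f x - iter k (euler e) f x) <= k%:R * (M * r).
Proof.
move=> e0 M0 lf hM hr; have e0' := ltW e0.
have hP := euler_operator e0.
have lit j : l2 m (iter j (euler e) f).
  by elim: j => //= j IH; exact: l2_euler.
have lTe : l2 m (T e f) by exact: (semigroup_l2 hT).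
have lPf := l2_euler e0 lf.
elim: k => [|k IH] kt.
  rewrite !mul0r (semigroup0 hT)//= (_ : (fun x => _) = fun=> 0) ?(l2norm0 m)//.
  by apply/funext => x; rewrite subrr.
have ke0 : 0 <= k%:R * e by rewrite mulr_ge0.
have kt' : k%:R * e <= t by apply: le_trans kt; rewrite ler_wpM2r// ler_nat.
have hA := semigroup_operator hm hT ke0.
have lTk : l2 m (T (k%:R * e) f) by exact: (semigroup_l2 hT).
have E1 : T (k.+1%:R * e) f = T (k%:R * e) (T e f).
  by rewrite -(semigroupD hT)// -natr1 mulrDl mul1r.
have lTT : l2 m (T (k%:R * e) (T e f)) by exact: (semigroup_l2 hT).
have lPT := l2_euler e0 lTk.
have := l2norm_dist hm lTT lPT (l2_euler e0 (lit k)).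
rewrite /= -E1 => h; apply: le_trans h _.
rewrite [leRHS](_ : _ = M * r + k%:R * (M * r)); last by rewrite -natr1; ring.
apply: lerD; last first.
  rewrite -(l2_opB hm hP)//; apply: le_trans (IH kt').
  by apply: euler_contract => //; exact: l2B.
rewrite E1 -euler_semigroup// -(l2_opB hm hA)//.
apply: le_trans (hM _ _ ke0 kt' (l2B hm lTe lPf)) _.
by rewrite ler_wpM2l.
Qed.

(** The Euler scheme is shown to converge for [f] in the domain of [H^2], where one step errs by at
    most [2 e q]: one [q] comes from the difference quotient of [T], one from [euler e g - g], which
    is [O(e)] as [g] is in the domain. Nonnegative approximants then exclude a negative value. *)
Lemma semigroup_ge0_smooth t f g g2 : 0 <= t -> assoc f g -> assoc g g2 ->
  (forall x, 0 <= f x) -> forall x, 0 <= T t f x.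
Proof.
rewrite le_eqVlt => /orP[/eqP <-|t0] fg gg2 f0 x.
  by rewrite (semigroup0 hT)//; have [] := assoc_op_l2 fg.
have [lf lg] := assoc_op_l2 fg; have [_ lg2] := assoc_op_l2 gg2.
have t0' := ltW t0; have [M [M1 hM]] := semigroup_bounded_on hm hT t.
have M0 : 0 < M by exact: lt_le_trans M1.
have lT s h : 0 <= s -> l2 m h -> l2 m (T s h) by move=> s0; exact: (semigroup_l2 hT).
have key r : 0 < r -> exists h, [/\ l2 m h, forall x, 0 <= h x &
    N (fun x => T t f x - h x) <= r].
  (* After [n] steps of size [e = t / n] the total error is [n * e * M * 2 q = r]. *)
  move=> r0; pose q := r / (t * M * 2).
  have q0 : 0 < q by rewrite divr_gt0// !mulr_gt0.
  have [d d0 hd] := (semigroup_generatorP hm hT lf lg).1 fg _ q0.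
  pose d' := Num.min d (q / (N g2 + 1)).
  have g21 : 0 < N g2 + 1 by rewrite ltr_wpDl ?l2norm_ge0.
  have d'0 : 0 < d' by rewrite lt_min d0 divr_gt0.
  have [n hn] : exists n : nat, t / d' < n%:R.
    by exists (Num.bound (t / d')); apply: archi_boundP; rewrite divr_ge0// ltW.
  have n0 : 0 < n%:R :> R by apply: le_lt_trans hn; rewrite divr_ge0// ltW.
  pose e := t / n%:R; have e0 : 0 < e by rewrite divr_gt0.
  have ed' : e < d' by rewrite /e ltr_pdivrMr// mulrC -ltr_pdivrMr.
  have [ed eg] : e < d /\ e < q / (N g2 + 1) by apply/andP; rewrite -lt_min.
  exists (iter n (euler e) f); split.
  - by elim: (n) => //= j IH; exact: l2_euler.
  - elim: (n) => //= j IH; apply: euler_ge0 => //.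
    by elim: (j) => //= i IHi; exact: l2_euler.
  have tE : n%:R * e = t by rewrite /e mulrC divfK// gt_eqF.
  rewrite -{1}tE.
  have lPg := l2_euler e0 lg.
  have hr : N (fun x => T e f x - euler e f x) <= e * (q + q).
    pose w x := e^-1 * (f x - T e f x) - g x.
    have lw : l2 m w by apply: l2B => //; apply: l2Z => //; apply: l2B => //; exact/lT/lf/ltW.
    rewrite (_ : (fun x => _) = fun x => e * ((euler e g x - g x) - w x)); last first.
      apply/funext => z; rewrite !mulrBr -(euler_generator e0 fg) !mulrA mulfV ?gt_eqF//.
      ring.
    have lB : l2 m (fun x => euler e g x - g x) by exact: l2B.
    rewrite (l2normZ hm); last exact: l2B.
    rewrite ger0_norm ?(ltW e0)// ler_pM2l//.
    apply: le_trans (l2normB hm lB lw) _; apply: lerD; last exact/ltW/hd.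
    apply: le_trans (euler_cvg_generator e0 gg2) _.
    apply: (@le_trans _ _ (q / (N g2 + 1) * N g2)).
      by rewrite ler_wpM2r ?l2norm_ge0// ltW.
    by rewrite -mulrA ler_piMr ?(ltW q0)// ler_pdivrMl// mulr1 lerDl.
  have nt : n%:R * e <= t by rewrite tE.
  apply: le_trans (semigroup_euler_dist e0 (ltW M0) lf hM hr nt) _.
  rewrite le_eqVlt; apply/orP; left; apply/eqP.
  rewrite -[n%:R * _](_ : n%:R * e * (M * (q + q)) = _); last ring.
  rewrite tE /q; field; by rewrite !gt_eqF.
rewrite leNgt; apply/negP => lt0.
have sm : 0 < Num.sqrt (m x) by rewrite sqrtr_gt0.
(* With this radius the error at [x] is at most half of [- T t f x], whereas a nonnegative [h x] is
   at least the whole of it away from [T t f x]. *)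
have r0 : 0 < Num.sqrt (m x) * (- T t f x) / 2.
  by rewrite divr_gt0// mulr_gt0// oppr_gt0.
have [h [lh h0 hle]] := key _ r0.
have := l2norm_pt hm x (l2B hm (lT _ _ t0' lf) lh).
have : (Num.sqrt (m x))^-1 * N (fun x => T t f x - h x) <= - T t f x / 2.
  by rewrite ler_pdivrMl// mulrA.
rewrite ltr0_norm; last by rewrite subr_lt0; exact: lt_le_trans (h0 x).
by have := h0 x; lra.
Qed.

(** The rate of [resolvent_strong] at [a = 1 / e], carried to the limit over the exhaustion by
    Fatou. *)
Lemma l2norm_euler_one e y : 0 < e ->
  N (fun x => euler e (one_at R y) x - one_at R y x) <=
  Num.sqrt (e * sform b c (one_at R y) (one_at R y)).
Proof.
move=> e0; have e1 : 0 < e^-1 by rewrite invr_gt0.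
have lo := l2_one hm y.
have fo := fin_supp_one R y.
have o0 x : 0 <= one_at R y x by rewrite /one_at ler0n.
have [u [_ cu _ _ hu]] := resolvent_exists_ge0 hm hb hsub hv0 hv hK e1 lo o0.
have -> : euler e (one_at R y) = fun x => e^-1 * u x.
  apply: (euler_uniq e0 (eulerP e0 lo)).
  apply: (assoc_op_eq (assoc_op_linear hm hT e^-1 hu (assoc_op0 hu))) => x; ring.
have s0 := sform_ge0 hsub fo.
have := resolvent_strong hm hb hsub hv0 hv hK y e1 => hn.
have [finK _ _] := hK.
apply: (l2norm_fatou hm (F := fun n x => e^-1 * dirichlet_inv b m (fun x => c x + e^-1 * m x) (K n)
  (one_at R y) x - one_at R y x) _ _ _).2.
- exact: sqrtr_ge0.
- by move=> x; apply: cvgB; [apply: cvgM; [exact: cvg_cst|exact: cu]|exact: cvg_cst].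
- apply: filterS hn => n /= hle; split.
    apply: l2B => //; apply: l2Z => //.
    apply: (fin_supp_l2 hm); apply: (fin_supp_off (finK n)) => z nK.
    apply: (dir_off hm hb (subcritical_shift _ hb hsub (ltW e1)) hv0
      (superharmonic_shift hm hb hv0 hv (ltW e1))) => //.
  rewrite -(@ler_pXn2r _ 2)// ?nnegrE ?sqrtr_ge0 ?l2norm_ge0//.
  rewrite (sqr_sqrtr (mulr_ge0 (ltW e0) s0)) -ler_pdivrMl//.
  have := sqr_ge0 (N (fun x => e^-1 * dirichlet_inv b m (fun x => c x + e^-1 * m x) (K n)
    (one_at R y) x - one_at R y x)).
  move: hle; set p := N _ ^+ 2; rewrite -mulrA => hle p0.
  by have := mulr_ge0 (ltW e1) p0; lra.
Qed.

(** [1_y] is replaced by the result of two Euler steps, which is nonnegative and in the domain of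
    [H^2]; the rate of smoothing and the bound on [T t] control the difference. *)
Lemma semigroup_one_ge0 t y x : 0 <= t -> 0 <= T t (one_at R y) x.
Proof.
move=> t0; have lo := l2_one hm y.
have o0 z : 0 <= one_at R y z by rewrite /one_at ler0n.
have [M [M1 hM]] := semigroup_bounded_on hm hT t.
have M0 : 0 < M by exact: lt_le_trans M1.
have hA := semigroup_operator hm hT t0.
set S := sform b c (one_at R y) (one_at R y).
have S1 : 0 <= S by exact: (sform_ge0 hsub (fin_supp_one R y)).
have sm : 0 < Num.sqrt (m x) by rewrite sqrtr_gt0.
rewrite leNgt; apply/negP => lt0.
(* Each smoothing costs [r] and [T t] a factor [M], so the error at [x] is at most
   [2 M r / sqrt(m x)], half the size of the supposed negative value. *)
pose r := Num.sqrt (m x) * (- T t (one_at R y) x) / (4 * M).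
have r0 : 0 < r by rewrite divr_gt0 ?mulr_gt0// oppr_gt0.
pose e := r ^+ 2 / (S + 1).
have S2 : 0 < S + 1 by rewrite ltr_wpDl.
have e0 : 0 < e by rewrite divr_gt0// exprn_gt0.
have h1 : N (fun x => euler e (one_at R y) x - one_at R y x) <= r.
  apply: le_trans (l2norm_euler_one y e0) _.
  rewrite -(@ler_pXn2r _ 2)// ?nnegrE ?sqrtr_ge0 ?(ltW r0)//.
  rewrite (sqr_sqrtr (mulr_ge0 (ltW e0) S1)) /e -mulrA.
  by rewrite ler_piMr ?exprn_ge0 ?(ltW r0)// ler_pdivrMl// mulr1 lerDl.
pose f1 := euler e (one_at R y); pose f := euler e f1.
have l1 : l2 m f1 := l2_euler e0 lo; have lf : l2 m f := l2_euler e0 l1.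
have h2 : N (fun x => f x - one_at R y x) <= r + r.
  apply: le_trans (l2norm_dist hm lf l1 lo) _; apply: lerD => //.
  rewrite /f {2}/f1 -(l2_opB hm (euler_operator e0))//.
  by apply: le_trans (euler_contract e0 (l2B hm l1 lo)) _.
have f0 : forall z, 0 <= T t f z.
  have hf := eulerP e0 l1; have hf1 := eulerP e0 lo; rewrite -/f1 in hf1.
  have hd := assoc_op_linear hm hT e^-1 (assoc_op_linear hm hT (-1) hf hf1)
    (assoc_op0 hf).
  apply: (semigroup_ge0_smooth t0 hf) => //.
    by apply: (assoc_op_eq hd) => // z; rewrite /f; ring.
  by apply: euler_ge0 => //; exact: euler_ge0.
have lTf : l2 m (T t f) by exact: (semigroup_l2 hT).
have lTo : l2 m (T t (one_at R y)) by exact: (semigroup_l2 hT).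
have h3 : N (fun x => T t f x - T t (one_at R y) x) <= M * (r + r).
  rewrite -(l2_opB hm hA)//; apply: le_trans (hM _ _ t0 (lexx _) (l2B hm lf lo)) _.
  by rewrite ler_wpM2l// ltW.
have := l2norm_pt hm x (l2B hm lTf lTo).
have : (Num.sqrt (m x))^-1 * N (fun x => T t f x - T t (one_at R y) x) <=
    - T t (one_at R y) x / 2.
  rewrite ler_pdivrMl//; apply: le_trans h3 _; rewrite /r le_eqVlt; apply/orP; left.
  by apply/eqP; field; rewrite gt_eqF.
rewrite gtr0_norm; last by rewrite subr_gt0; exact: lt_le_trans (f0 x).
move: lt0 (f0 x); clear; move: (T t f x) (T t _ x) (_ * N _) => p q w q0 p0 h3 h4.
lra.
Qed.

End Positivity.

(** * The heat kernel and the Green function *)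

Section HeatKernel.
Variables (R : realType) (X : countType) (b : X -> X -> R) (m c : X -> R).
Variables (T : R -> (X -> R) -> X -> R).
Hypothesis hm : forall x, 0 < m x.
Hypothesis hT : semigroup_of b m c T.
Implicit Types (f g u : X -> R) (x y z : X) (s t e : R).
Local Notation N := (l2norm m).
Local Notation assoc := (assoc_op b m c).

Let lT t f : 0 <= t -> l2 m f -> l2 m (T t f).
Proof. exact: (semigroup_l2 hT). Qed.

Lemma semigroup_sum t (k : X -> R) (r : seq X) : 0 <= t ->
  l2 m (fun z => \sum_(y <- r) k y * one_at R y z) /\
  T t (fun z => \sum_(y <- r) k y * one_at R y z) =
    fun x => \sum_(y <- r) k y * T t (one_at R y) x.
Proof.
move=> t0; have hA := semigroup_operator hm hT t0.
elim: r => [|y r [IH1 IH2]].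
  under eq_fun do rewrite big_nil; split; first exact: l2_0.
  by rewrite (l2_op0 hm hA); apply/funext => x; rewrite big_nil.
have lo := l2_one hm y; have lko := l2Z hm (k y) lo.
under eq_fun do rewrite big_cons; split; first exact: l2D.
rewrite (l2_opD hA)// (l2_opZ hm hA)// IH2.
by apply/funext => x; rewrite big_cons.
Qed.

(* [t |-> T_t f x], extended to a function that is continuous on the line *)
Definition orbit_at f x : R -> R := fun s => T (Num.max s 0) f x.

Lemma orbit_at_ge0 f x s : 0 <= s -> orbit_at f x s = T s f x.
Proof. by move=> s0; rewrite /orbit_at max_l. Qed.

Lemma max0_dist (r s : R) : `|Num.max r 0 - Num.max s 0| <= `|r - s|.
Proof.
have [r0|r0] := leP r 0; have [s0|s0] := leP s 0.
- by rewrite subrr normr0.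
- by rewrite sub0r normrN gtr0_norm// distrC; apply: le_trans (ler_norm _); lra.
- by rewrite subr0 gtr0_norm//; apply: le_trans (ler_norm _); lra.
- by [].
Qed.

Lemma l2norm_pt_le f x e : l2 m f -> N f <= Num.sqrt (m x) * e -> `|f x| <= e.
Proof.
move=> lf h; apply: le_trans (l2norm_pt hm x lf) _.
by rewrite ler_pdivrMl// sqrtr_gt0.
Qed.

Lemma continuous_orbit_at f x : l2 m f -> continuous (orbit_at f x).
Proof.
move=> lf s0; apply/cvgrPdist_le => e e0.
have sm : 0 < Num.sqrt (m x) by rewrite sqrtr_gt0.
have [d d0 hd] := semigroup_unif_continuous hm hT (`|s0| + 1) lf (mulr_gt0 sm e0).
exists (Num.min d 1) => /=; first by rewrite lt_min d0 ltr01.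
move=> s /=; rewrite lt_min => /andP[sd s1].
have r0 (r : R) : 0 <= Num.max r 0 by rewrite le_max lexx orbT.
rewrite -[_ - _]/((fun z => T (Num.max s0 0) f z - T (Num.max s 0) f z) x).
apply: l2norm_pt_le; first by apply: l2B => //; exact: lT.
apply/ltW/hd => //.
- rewrite ge_max addr_ge0// andbT; have := ler_norm s0; lra.
- rewrite ge_max addr_ge0// andbT; have := ler_norm s0.
  by have := ler_norm (s - s0); rewrite distrC; lra.
- exact: le_lt_trans (max0_dist _ _) sd.
Qed.

(** The generator only gives a right derivative at 0. For [h > 0] the quotient at [s] is [T s]
    applied to one at 0; for [h < 0] one writes [T s = T (s + h) T (- h)] and needs the bound on
    [[0, s]] and the continuity of the orbit of [g]. *)
Lemma semigroup_quotient f g s e : assoc f g -> 0 < s -> 0 < e ->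
  exists2 d, 0 < d & forall h, h != 0 -> `|h| < d -> 0 <= s + h /\
    N (fun x => h^-1 * (T (s + h) f x - T s f x) + T s g x) <= e.
Proof.
move=> fg s0 e0; have [lf lg] := assoc_op_l2 fg; have s0' := ltW s0.
have [M [M1 hM]] := semigroup_bounded_on hm hT s.
have M0 : 0 < M by exact: lt_le_trans M1.
have e1 : 0 < e / 2 / M by rewrite !divr_gt0.
have e2 : 0 < e / 2 by rewrite divr_gt0.
have [d1 d10 h1] := (semigroup_generatorP hm hT lf lg).1 fg _ e1.
have [d2 d20 h2] := semigroup_unif_continuous hm hT s lg e2.
pose w k x := k^-1 * (f x - T k f x) - g x.
have lw k : 0 <= k -> l2 m (w k).
  by move=> k0; apply: l2B => //; apply: l2Z => //; apply: l2B => //; exact: lT.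
have hw k r : 0 < k -> k < d1 -> 0 <= r -> r <= s -> N (T r (w k)) <= e / 2.
  move=> k0 kd r0 rs; apply: le_trans (hM _ _ r0 rs (lw _ (ltW k0))) _.
  by rewrite mulrC -ler_pdivlMr// ltW// h1.
have wE k r : 0 < k -> 0 <= r -> T r (w k) =
    fun x => k^-1 * (T r f x - T (r + k) f x) - T r g x.
  move=> k0 r0; have hA := semigroup_operator hm hT r0.
  have lk := lT (ltW k0) lf; have lB := l2B hm lf lk.
  rewrite /w (l2_opB hm hA)//; last exact: l2Z.
  by rewrite (l2_opZ hm hA)// (l2_opB hm hA)// (semigroupD hT)// ltW.
exists (Num.min s (Num.min d1 d2)); first by rewrite !lt_min s0 d10.
move=> h hn; rewrite !lt_min => /and3P[hs hd1 hd2].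
have [h0|h0] := ltP 0 h.
  rewrite gtr0_norm// in hs hd1 hd2.
  split; first by rewrite addr_ge0// ltW.
  have := hw _ _ h0 hd1 s0' (lexx _); rewrite wE// l2normBC => le.
  rewrite (_ : (fun x => _) = fun x => T s g x - h^-1 * (T s f x - T (s + h) f x)).
    by apply: le_trans le _; lra.
  by apply/funext => x; ring.
have {}h0 : h < 0 by rewrite lt_neqAle hn.
rewrite ltr0_norm// in hs hd1 hd2.
have k0 : 0 < - h by rewrite oppr_gt0.
have sh0 : 0 <= s + h by lra.
have shs : s + h <= s by lra.
split=> //.
rewrite (_ : (fun x => _) = fun x => (T s g x - T (s + h) g x) - T (s + h) (w (- h)) x).
  have lB : l2 m (fun x => T s g x - T (s + h) g x) by apply: l2B => //; exact: lT.
  apply: le_trans (l2normB hm lB (lT sh0 (lw _ (ltW k0)))) _.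
  rewrite (splitr e); apply: lerD; last exact: hw.
  apply/ltW/h2 => //; rewrite opprD addrA subrr sub0r ger0_norm ?(ltW k0)//.
apply/funext => x; rewrite wE// addrK; field; exact: hn.
Qed.

Lemma is_derive_orbit_at f g x s : assoc f g -> 0 < s ->
  is_derive s (1:R) (orbit_at f x) (- orbit_at g x s).
Proof.
move=> fg s0; have [lf lg] := assoc_op_l2 fg.
have C : h^-1 *: ((orbit_at f x \o shift s) (h *: (1:R)) - orbit_at f x s) @[h --> 0^'] -->
    - orbit_at g x s.
  apply/cvgrPdist_le => e e0.
  have sm : 0 < Num.sqrt (m x) by rewrite sqrtr_gt0.
  have [d d0 hd] := semigroup_quotient fg s0 (mulr_gt0 sm e0).
  exists d => //= h; rewrite /ball/= sub0r normrN => hh hn.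
  have [sh0 le] := hd _ hn hh.
  rewrite -normrN opprB opprK /GRing.scale/= mulr1 addrC.
  rewrite (addrC h) !orbit_at_ge0 ?(ltW s0)// addrC.
  rewrite -[_ + _]/((fun x => h^-1 * (T (s + h) f x - T s f x) + T s g x) x).
  apply: l2norm_pt_le => //; apply: l2D => //; last by apply: lT => //; exact: ltW.
  by apply: l2Z => //; apply: l2B => //; apply: lT => //; exact: ltW.
by apply: DeriveDef; [exact: cvgP C|exact: cvg_lim C].
Qed.

Lemma integral_resolvent a y u t x : 0 < t ->
  assoc u (fun z => one_at R y z - a * u z) ->
  (\int[lebesgue_measure]_(s in `[0%R, t]) (expR (- (a * s)) * T s (one_at R y) x)%:E =
   (u x - expR (- (a * t)) * T t u x)%:E)%E.
Proof.
move=> t0 hu; have [lu lg] := assoc_op_l2 hu; have lo := l2_one hm y.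
pose E (s : R) := expR (- (a * s)).
(* An antiderivative of the integrand: the derivative of the exponential cancels the term [- a u] of
   [H u = 1_y - a u]. *)
pose F (s : R) := - (E s * orbit_at u x s).
have dE (s : R) : is_derive s (1:R) E (- a * E s).
  rewrite /E; have h : is_derive s (1:R) (fun s : R => - (a * s)) (- a).
    rewrite (_ : (fun s => - (a * s)) = (fun s : R => (- a) *: s)); last first.
      by apply/funext => r; rewrite /GRing.scale/= mulNr.
    by apply: is_derive_eq; rewrite /GRing.scale/= mulr1.
  by apply: is_derive_eq; rewrite /GRing.scale/= mulrC.
have cE : continuous E.
  by move=> s; apply/differentiable_continuous/derivable1_diffP; case: (dE s).
have cF : continuous F.
  move=> s; apply: cvgN; apply: cvgM; [exact: cE|exact: continuous_orbit_at].
have co : continuous (orbit_at (one_at R y) x) by exact: continuous_orbit_at.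
have dF s : 0 < s -> is_derive s (1:R) F (E s * orbit_at (one_at R y) x s).
  move=> s0; have h1 := is_derive_orbit_at x hu s0.
  rewrite /F; apply: is_derive_eq; rewrite /GRing.scale/=.
  rewrite !orbit_at_ge0 ?(ltW s0)//.
  have hA := semigroup_operator hm hT (ltW s0).
  rewrite (l2_opB hm hA)//; last exact: l2Z.
  by rewrite (l2_opZ hm hA)//; ring.
have -> : (\int[lebesgue_measure]_(s in `[0%R, t]) (expR (- (a * s)) * T s (one_at R y) x)%:E =
   \int[lebesgue_measure]_(s in `[0%R, t]) (E s * orbit_at (one_at R y) x s)%:E)%E.
  apply: eq_integral => s; rewrite inE/= in_itv/= => /andP[s0 _].
  by rewrite orbit_at_ge0.
rewrite (@continuous_FTC2 _ _ F)//.
- rewrite -EFinB /F /E mulr0 oppr0 expR0 mul1r !orbit_at_ge0 ?(ltW t0)//.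
  by rewrite (semigroup0 hT)//; congr EFin; ring.
- apply: continuous_subspaceT => s; apply: cvgM; [exact: cE|exact: co].
- split.
  + by move=> s; rewrite in_itv/= => /andP[s0 _]; case: (dF _ s0).
  + by apply: cvg_at_right_filter; exact: cF.
  + by apply: cvg_at_left_filter; exact: cF.
- move=> s; rewrite in_itv/= => /andP[s0 _].
  by rewrite derive1E; case: (dF _ s0).
Qed.

Lemma measurable_orbit_at f x (D : set R) : measurable D -> l2 m f ->
  measurable_fun D (orbit_at f x).
Proof.
move=> mD lf; apply: (measurable_funS measurableT) => //.
by apply: measurable_realfun.continuous_measurable_fun; exact: continuous_orbit_at.
Qed.

End HeatKernel.

(** Sums over [X] become series over codes, a number that codes no point contributing 0; this gives
    access to termwise integration. *)
Lemma esum_nneseries (R : realType) (X : countType) (f : X -> \bar R) :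
  (forall x, 0 <= f x)%E ->
  \esum_(x in setT) f x = (\sum_(0 <= n <oo) oapp f 0 (@pickle_inv X n))%E.
Proof.
move=> f0; rewrite nneseries_esumT; last by move=> n; case: (@pickle_inv X n).
rewrite (esum_mkcond setT).
rewrite [RHS](esumID (@choice.pickle X @` [set: X])); last by move=> n _; case: (@pickle_inv X n).
rewrite [X in (_ + X)%E]esum1 ?adde0; last first.
  move=> n /= [_ hn]; case E : (@pickle_inv X n) => [x|]//=.
  by case: hn; exists x => //; have := @pickle_invK X n; rewrite E.
rewrite setTI (reindex_esum setT (@choice.pickle X @` [set: X]) (@choice.pickle X)).
  by apply: eq_esum => x _; rewrite in_setT pickleK_inv.
split; [by move=> x _; exists x| |by []].
by move=> x y _ _; exact: (pcan_inj (@choice.pickleK X)).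
Qed.

(** * Time integrals of the heat kernel *)

Section HeatGreen.
Variables (R : realType) (X : countType) (b : X -> X -> R) (m c : X -> R).
Variables (v : X -> R) (K : nat -> set X) (T : R -> (X -> R) -> X -> R).
Hypothesis hm : forall x, 0 < m x.
Hypothesis hb : weighted_graph b.
Hypothesis hsub : subcritical b c.
Hypothesis hv0 : forall x, 0 < v x.
Hypothesis hv : superharmonic_fun b m c v.
Hypothesis hK : exhaustion K.
Hypothesis hT : semigroup_of b m c T.
Implicit Types (f g u : X -> R) (x y z : X) (s t e : R).
Local Notation N := (l2norm m).
Local Notation G := (green b m c K).
Local Notation H := (formal_op b m c).
Local Notation p t x y := (T t (one_at R y) x).
Local Notation mu := (@lebesgue_measure R).

Let finK n : finite_set (K n). Proof. by case: hK. Qed.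
Let p0 t x y : 0 <= t -> 0 <= p t x y.
Proof. exact: (semigroup_one_ge0 hm hb hsub hv0 hv hK hT). Qed.
Let G0 x y : 0 <= G x y. Proof. exact: (green_ge0 hm hb hsub hv0 hv hK). Qed.

(** Links the kernel extension of the semigroup with the operator on l^2: truncations of [g] to
    [K n] converge to [g] in norm, and their kernel sums converge by domination. *)
Lemma semigroup_kernel t g x : 0 <= t -> l2 m g -> (forall z, 0 <= g z) ->
  \esum_(z in setT) (p t x z * g z)%:E = (T t g x)%:E.
Proof.
move=> t0 lg g0; have hA := semigroup_operator hm hT t0.
pose gn n z : R := \sum_(y <- fset_set (K n)) g y * one_at R y z.
have gnE n z : gn n z = if z \in fset_set (K n) then g z else 0.
  rewrite /gn; case: ifPn => zK.
    rewrite (bigD1_seq z)/=; [|exact: zK|exact: fset_uniq].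
    rewrite /one_at eqxx mulr1 big1 ?addr0// => y yz.
    by rewrite eq_sym (negPf yz) mulr0.
  rewrite big1_seq// => y /= yK; rewrite /one_at; case: eqP => [E|_]; last by rewrite mulr0.
  by rewrite E yK in zK.
have gn_le n z : 0 <= gn n z <= g z by rewrite gnE; case: ifP; rewrite ?lexx g0.
have gn_cvg z : gn n z @[n --> \oo] --> g z.
  have [n0 hn0] := exhaustion_near hK z.
  apply: cvg_near_cst; exists n0 => // n /= /hn0 Kz.
  by rewrite gnE in_fset_set// mem_set.
have lgn n : l2 m (gn n).
  by have [] := semigroup_sum hm hT g (fset_set (K n)) t0.
have cN : N (fun z => gn n z - g z) @[n --> \oo] --> 0.
  by apply: (l2norm_dominated hm lg) => //; exact: nearW.
have cT : T t (gn n) x @[n --> \oo] --> T t g x.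
  have lTg : l2 m (T t g) by exact: (semigroup_l2 hT).
  have lTn : \forall n \near \oo, l2 m (T t (gn n)).
    by apply: nearW => n; exact: (semigroup_l2 hT).
  apply: (l2norm_pt_cvg hm lTn lTg).
  have [a [a0 ha _]] := l2_op_norm hm hA.
  have ca : a * N (fun z => gn n z - g z) @[n --> \oo] --> 0.
    by rewrite -(mulr0 a); apply: cvgM => //; exact: cvg_cst.
  apply: (squeeze_cvgr _ (cvg_cst 0) ca); apply: nearW => n.
  by rewrite l2norm_ge0 -(l2_opB hm hA)// ha//; exact: l2B.
have cTE : (T t (gn n) x)%:E @[n --> \oo] --> (T t g x)%:E.
  by apply: cvg_EFin; [exact: nearW|exact: cT].
apply: (cvg_unique (@ereal_hausdorff R) _ cTE).
have -> : (fun n => (T t (gn n) x)%:E) = fun n => \esum_(z in setT) (p t x z * gn n z)%:E.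
  apply/funext => n; rewrite rsumE; first last.
  - apply: (@rsummable_fin _ _ _ (fset_set (K n))) => z /negPf zK.
    by rewrite gnE zK mulr0.
  - by move=> z; rewrite mulr_ge0 ?p0//; have /andP[] := gn_le n z.
  have [_ ->] := semigroup_sum hm hT g (fset_set (K n)) t0; congr EFin.
  rewrite (@rsum_fin _ _ _ (fset_set (K n))) ?fset_uniq//; last first.
    by move=> z /negPf zK; rewrite gnE zK mulr0.
  by apply: eq_big_seq => z zK; rewrite gnE zK mulrC.
apply: esum_cvg.
  apply: nearW => n z; have /andP[h1 h2] := gn_le n z.
  by rewrite !lee_fin mulr_ge0 ?p0//= ler_wpM2l// p0.
move=> z; apply: cvg_EFin; first exact: nearW.
by apply: cvgM; [exact: cvg_cst|exact: gn_cvg].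
Qed.

(* [u k] is the resolvent [(H + a k)^-1 1_y]. *)
Lemma resolvent_approx y : exists (a : nat -> R) (u : nat -> X -> R), [/\
  forall k, 0 < a k <= 1, a k @[k --> \oo] --> 0,
  forall k x, 0 <= u k x <= G x y,
  forall x, u k x @[k --> \oo] --> G x y &
  forall k, assoc_op b m c (u k) (fun x => one_at R y x - a k * u k x)].
Proof.
pose a k : R := k.+1%:R^-1.
have a0 k : 0 < a k by rewrite invr_gt0 ltr0n.
have ca : a k @[k --> \oo] --> 0 by exact: cvg_harmonic.
have lo := l2_one hm y.
have o0 x : 0 <= one_at R y x by rewrite /one_at ler0n.
have /choice[u hu] := fun k => resolvent_exists_ge0 hm hb hsub hv0 hv hK (a0 k) lo o0.
pose gn n x := dirichlet_inv b m c (K n) (one_at R y) x.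
pose un k n x := dirichlet_inv b m (fun x => c x + a k * m x) (K n) (one_at R y) x.
have hs k := subcritical_shift hm hb hsub (ltW (a0 k)).
have hvs k := superharmonic_shift hm hb hv0 hv (ltW (a0 k)).
have un0 k n x : 0 <= un k n x by exact: (dirichlet_ge0 hm hb (hs k) hv0 (hvs k)).
have gn0 n x : 0 <= gn n x by exact: (dirichlet_ge0 hm hb hsub hv0 hv).
have dun k n : formal_dom b (un k n) by exact: (formal_dom_dir hm hb (hs k) hv0 (hvs k)).
have dgn n : formal_dom b (gn n) by exact: (formal_dom_dir hm hb hsub hv0 hv).
have Lun k n x : K n x -> lap b c (un k n) x = m x * one_at R y x - a k * m x * un k n x.
  move=> Kx; rewrite -(lap_dir hm hb (hs k) hv0 (hvs k) (one_at R y) (finK n) Kx).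
  by rewrite (lap_shift b m c) addrK.
have ungn k n x : un k n x <= gn n x.
  rewrite -subr_ge0.
  apply: (min_principle hm hb hsub hv0 hv (finK n) (f := fun x => gn n x - un k n x)).
  - exact: formal_domB.
  - move=> z nK; rewrite /gn /un (dir_off hm hb hsub hv0 hv)//.
    by rewrite (dir_off hm hb (hs k) hv0 (hvs k))// subr0.
  - move=> z Kz; rewrite lapB// Lun// (lap_dir hm hb hsub hv0 hv)//.
    by rewrite subKr !mulr_ge0// ltW.
(* The resolvent identity on [K n], with [un] on its right side enlarged to [gn]: for fixed [n] the
   gap is at most a multiple of [a k]. *)
have gnun k n x : gn n x - un k n x <= a k * dirichlet_inv b m c (K n) (gn n) x.
  rewrite -subr_ge0.
  have dd : formal_dom b (dirichlet_inv b m c (K n) (gn n)).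
    exact: (formal_dom_dir hm hb hsub hv0 hv).
  apply: (min_principle hm hb hsub hv0 hv (finK n)
    (f := fun x => a k * dirichlet_inv b m c (K n) (gn n) x - (gn n x - un k n x))).
  - by apply: formal_domB; [exact: formal_domZ|exact: formal_domB].
  - move=> z nK; rewrite /gn /un !(dir_off hm hb hsub hv0 hv)//.
    by rewrite (dir_off hm hb (hs k) hv0 (hvs k))// mulr0 !subr0.
  - move=> z Kz; rewrite !lapB//; [|exact: formal_domZ|exact: formal_domB].
    rewrite lapZ// Lun// !(lap_dir hm hb hsub hv0 hv)//.
    rewrite subKr -!mulrA -mulrBr -mulrBr.
    by rewrite !mulr_ge0 ?subr_ge0// ltW.
have ule k x : 0 <= u k x <= G x y.
  have [h1 h2 _ _ _] := hu k; rewrite h1/=.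
  apply: (cvgr_to_le (h2 x)); apply: nearW => n; apply: le_trans (ungn k n x) _.
  exact: (dirichlet_green_le hm hb hsub hv0 hv hK).
exists a, u; split=> //.
- by move=> k; rewrite a0/= invf_le1 ?ltr0n// ler1n.
(* First [n0] brings [gn] close to [G]; then, for this fixed [n0], a large [k] makes [a k * D]
   small, and [un k n0 <= u k <= G] does the rest. *)
- move=> x; apply/cvgrPdist_le => e e0.
  have e2 : 0 < e / 2 by rewrite divr_gt0.
  have gc : dirichlet_inv b m c (K n) (one_at R y) x @[n --> \oo] --> G x y.
    exact: (green_cvg hm hb hsub hv0 hv hK).
  have /cvgrPdist_lt/(_ _ e2) := gc.
  move=> [n0 _ /(_ n0 (leqnn _))] hn0.
  set D := dirichlet_inv b m c (K n0) (gn n0) x.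
  have cD : a k * D @[k --> \oo] --> 0.
    by rewrite -(mul0r D); apply: cvgM => //; exact: cvg_cst.
  have [k0 hk0] := cvg0_nat cD e2.
  exists k0 => // k /= /hk0 hk.
  have /andP[u1 u2] := ule k x.
  rewrite ger0_norm ?subr_ge0//.
  have [_ _ h3 _ _] := hu k.
  have := h3 n0 x; have := gnun k n0 x; rewrite -/D /un => k1 k2.
  have := ler_norm (a k * D); have := ler_norm (G x y - gn n0 x).
  move: hk hn0 k1 k2; rewrite /gn; set A := dirichlet_inv _ _ _ _ _ _.
  set B := dirichlet_inv _ _ _ _ _ _; clear; lra.
- by move=> k; have [] := hu k.
Qed.

Let I t x y := (\int[mu]_(s in `[0%R, t]) (p s x y)%:E)%E.

Let measurable_p t x y : measurable_fun (`[0, t] : set R) (fun s : R => p s x y).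
Proof.
apply: (eq_measurable_fun (orbit_at T (one_at R y) x)).
  by move=> s; rewrite inE/= in_itv/= => /andP[s0 _]; rewrite orbit_at_ge0.
by apply: (measurable_orbit_at hm hT) => //; exact: l2_one.
Qed.

Lemma heat_integral_ge0 t x y : (0 <= I t x y)%E.
Proof.
by apply: integral_ge0 => s; rewrite /= in_itv/= => /andP[s0 _]; rewrite lee_fin p0.
Qed.

(** On [[0, t]] the weight [exp(- a s)] lies between [exp(- a t)] and 1; this sandwiches the
    integral of the kernel between values of the resolvent, and no limit is taken under the
    integral. *)
Lemma resolvent_integral_bounds a u t x y : 0 < a -> 0 < t ->
  assoc_op b m c u (fun z => one_at R y z - a * u z) ->
  ((expR (- (a * t)))%:E * I t x y <= (u x - expR (- (a * t)) * T t u x)%:E)%E /\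
  ((u x - expR (- (a * t)) * T t u x)%:E <= I t x y)%E.
Proof.
move=> a0 t0 hu; rewrite -(integral_resolvent hm hT x t0 hu).
have mp : measurable_fun (`[0, t] : set R) (EFin \o (fun s => p s x y)).
  by apply/measurable_EFinP; exact: measurable_p.
have mE : measurable_fun (`[0, t] : set R) (EFin \o (fun s => expR (- (a * s)) * p s x y)).
  apply/measurable_EFinP; apply: measurable_funM; last exact: measurable_p.
  apply: (measurable_funS measurableT) => //.
  apply: measurable_realfun.continuous_measurable_fun => s.
  apply: continuous_comp; last exact: continuous_expR.
  by apply: cvgN; apply: cvgM; [exact: cvg_cst|exact: cvg_id].
split.
- rewrite -ge0_integralZl//; last first.
  + by move=> s; rewrite /= in_itv/= => /andP[s0 _]; rewrite lee_fin p0.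
  apply: ge0_le_integral => //.
  + move=> s; rewrite /= in_itv/= => /andP[s0 _].
    by rewrite mule_ge0// lee_fin ?expR_ge0 ?p0.
  + exact: measurable_funeM.
  + move=> s; rewrite /= in_itv/= => /andP[s0 st].
    rewrite -EFinM lee_fin ler_wpM2r ?p0// ler_expR lerN2.
    by rewrite ler_wpM2l// ltW.
- apply: ge0_le_integral => //.
  + move=> s; rewrite /= in_itv/= => /andP[s0 _].
    by rewrite lee_fin mulr_ge0 ?expR_ge0 ?p0.
  + move=> s; rewrite /= in_itv/= => /andP[s0 st].
    rewrite lee_fin ler_piMl ?p0// -expR0 ler_expR oppr_le0.
    by rewrite mulr_ge0// ltW.
Qed.

Lemma heat_integral_fin t x y : 0 < t -> I t x y \is a fin_num.
Proof.
move=> t0; have [a [u [ha _ _ _ hu]]] := resolvent_approx y.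
have /andP[a0 _] := ha 0%N.
have [h _] := resolvent_integral_bounds x a0 t0 (hu 0%N).
rewrite ge0_fin_numE ?heat_integral_ge0//.
move: h; case: (I t x y) => [r _| |]//; first by rewrite ltry.
by rewrite gt0_muley ?lte_fin ?expR_gt0.
Qed.

(** The limit of [T t (u k) x] is computed twice: it is [G x y - I t x y] by the sandwich, and the
    kernel sum against [G] by domination, since [u k <= G(., y)]. *)
Lemma heat_green t x y : 0 < t ->
  (\esum_(z in setT) (p t x z * G z y)%:E + I t x y = (G x y)%:E)%E.
Proof.
move=> t0; have t0' := ltW t0.
have [a [u [ha ca hug cu hu]]] := resolvent_approx y.
have /fineK := heat_integral_fin x y t0; set J := fine _ => JE.
pose E k := expR (- (a k * t)).
have cE : E k @[k --> \oo] --> (1:R).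
  rewrite -expR0; apply: (@cvg_comp _ _ _ (fun k => - (a k * t)) expR _ (nbhs (0:R))).
    by rewrite -oppr0 -(mul0r t); apply: cvgN; apply: cvgM => //; exact: cvg_cst.
  exact: continuous_expR.
have a0 k : 0 < a k by have /andP[] := ha k.
pose S k := u k x - E k * T t (u k) x.
have cS : S k @[k --> \oo] --> J.
  have cJ : E k * J @[k --> \oo] --> J.
    by rewrite -[X in _ --> X]mul1r; apply: cvgM => //; exact: cvg_cst.
  apply: (squeeze_cvgr _ cJ (cvg_cst J)); apply: nearW => k.
  have [] := resolvent_integral_bounds x (a0 k) t0 (hu k).
  by rewrite -JE -EFinM !lee_fin => -> ->.
have cT : T t (u k) x @[k --> \oo] --> G x y - J.
  have -> : (fun k => T t (u k) x) = (fun k => (u k x - S k) / E k).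
    apply/funext => k; rewrite /S opprB addrC subrK mulrC mulKf//.
    by rewrite gt_eqF// expR_gt0.
  rewrite -[X in _ --> X]divr1; apply: cvgM; first exact: cvgB.
  by apply: cvgV => //; exact: oner_neq0.
have cTE : (T t (u k) x)%:E @[k --> \oo] --> (G x y - J)%:E.
  by apply: cvg_EFin; [exact: nearW|exact: cT].
have cs : (T t (u k) x)%:E @[k --> \oo] --> \esum_(z in setT) (p t x z * G z y)%:E.
  have -> : (fun k => (T t (u k) x)%:E) = fun k => \esum_(z in setT) (p t x z * u k z)%:E.
    apply/funext => k; rewrite semigroup_kernel//.
      by have [] := assoc_op_l2 (hu k).
    by move=> z; have /andP[] := hug k z.
  apply: esum_cvg.
    apply: nearW => k z; have /andP[h1 h2] := hug k z.
    by rewrite !lee_fin mulr_ge0 ?p0//= ler_wpM2l// p0.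
  move=> z; apply: cvg_EFin; first exact: nearW.
  by apply: cvgM; [exact: cvg_cst|exact: cu].
rewrite -(cvg_unique (@ereal_hausdorff R) cTE cs) -JE -EFinD; congr EFin.
by rewrite subrK.
Qed.

Lemma heat_integral_le t x y : 0 < t -> (I t x y <= (G x y)%:E)%E.
Proof.
move=> t0; rewrite -(heat_green x y t0) leeDr// esum_ge0// => z _.
by rewrite lee_fin mulr_ge0// p0// ltW.
Qed.

(** The upper bound comes from [heat_green]. For the lower one, [T t (u k) x] is at most [G x y] for
    all [t > 0], so the factor [exp(- a t)] removes it as [t] grows and leaves [u k x], which is
    close to [G x y]. *)
Lemma heat_integral_cvg x y : I t x y @[t --> +oo] --> (G x y)%:E.
Proof.
have [a [u [ha ca hug cu hu]]] := resolvent_approx y.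
apply/fine_cvgP; split.
  by near=> t; apply: heat_integral_fin; near: t; exact: nbhs_pinfty_gt.
apply/cvgrPdist_le => e e0.
have e2 : 0 < e / 2 by rewrite divr_gt0.
have /cvgrPdist_lt/(_ _ e2)[k _ /(_ k (leqnn _)) hk] := cu x.
have /andP[a0 _] := ha k.
have G1 : 0 < G x y + 1 by rewrite ltr_wpDl.
have /cvgrPdist_lt/(_ _ (divr_gt0 e2 G1)) : expR (- (a k * t)) @[t --> +oo] --> (0:R).
  under eq_fun do rewrite mulrC.
  have cA : t * a k @[t --> +oo] --> +oo by exact: (gt0_cvgMly a0 (@cvg_id _ _)).
  exact: (cvg_comp _ _ cA (@cvgr_expR R)).
move=> [t1 [_ ht1]].
near=> t; have t0 : 0 < t by near: t; exact: nbhs_pinfty_gt.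
have tt1 : t1 < t by near: t; apply: nbhs_pinfty_gt; exact: num_real.
have /fineK := heat_integral_fin x y t0; set J := fine _ => JE /=.
have [_] := resolvent_integral_bounds x a0 t0 (hu k).
have := heat_integral_le x y t0.
rewrite -JE !lee_fin -/J => J1 J2.
have TG : T t (u k) x <= G x y.
  have [luk _] := assoc_op_l2 (hu k).
  rewrite -lee_fin -semigroup_kernel ?(ltW t0)//; last by move=> z; have /andP[] := hug k z.
  rewrite -(heat_green x y t0); apply: le_trans (leeDl _ (heat_integral_ge0 t x y)).
  apply: le_esum => z _; have /andP[h1 h2] := hug k z.
  by rewrite lee_fin ler_wpM2l// p0// ltW.
rewrite JE -/J ger0_norm ?subr_ge0//.
have := ht1 _ tt1; rewrite sub0r normrN ger0_norm ?expR_ge0// => hE.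
have h2 : expR (- (a k * t)) * T t (u k) x <= e / 2.
  apply: (@le_trans _ _ (expR (- (a k * t)) * G x y)).
    by rewrite ler_wpM2l ?expR_ge0.
  apply: (@le_trans _ _ (e / 2 / (G x y + 1) * G x y)).
    by rewrite ler_wpM2r// ltW.
  by rewrite -mulrA ler_piMr ?(ltW e2)// ler_pdivrMl// mulr1 lerDl.
have := ler_norm (G x y - u k x) => /=.
lra.
Unshelve. all: by end_near. Qed.

Lemma heat_integral_sum t x (k : X -> R) : (forall y, 0 <= k y) ->
  (\int[mu]_(s in `[0%R, t]) heat T s k x =
   \esum_(y in setT) (I t x y * (k y)%:E))%E.
Proof.
move=> k0.
(* The maximum with 0 changes nothing for [s >= 0] and makes every term nonnegative without a
   condition on [s]. *)
transitivity (\int[mu]_(s in `[0%R, t]) (\sum_(0 <= n <oo)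
    oapp (fun y => (Num.max (p s x y * k y) 0)%:E) 0 (@pickle_inv X n)))%E.
  apply: eq_integral => s; rewrite inE/= in_itv/= => /andP[s0 _].
  rewrite /heat xsum_ge0; last by move=> y; rewrite mulr_ge0 ?p0.
  rewrite -esum_nneseries; last by move=> y; rewrite lee_fin le_max lexx orbT.
  by apply: eq_esum => y _; rewrite max_l// mulr_ge0 ?p0.
have mpk y : measurable_fun (`[0, t] : set R) (EFin \o (fun s => Num.max (p s x y * k y) 0)).
  apply/measurable_EFinP; apply: measurable_maxr => //.
  by apply: measurable_funM => //; exact: measurable_p.
rewrite integral_nneseries//; first last.
- by move=> n s _; case: (@pickle_inv X n) => //= y; rewrite lee_fin le_max lexx orbT.
- by move=> n; case: (@pickle_inv X n) => [y|]; [exact: mpk|exact: measurable_cst].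
rewrite esum_nneseries; last by move=> y; rewrite mule_ge0 ?heat_integral_ge0 ?lee_fin.
apply: eq_eseriesr => n _; case: (@pickle_inv X n) => [y|]/=; last exact: integral0.
rewrite /I -ge0_integralZr//; first last.
- by rewrite lee_fin.
- by move=> s; rewrite /= in_itv/= => /andP[s0 _]; rewrite lee_fin p0.
- by apply/measurable_EFinP; exact: measurable_p.
apply: eq_integral => s; rewrite inE/= in_itv/= => /andP[s0 _].
by rewrite -EFinM max_l// mulr_ge0 ?p0.
Qed.

Lemma heat_integral_sum_cvg x (k : X -> R) : (forall y, 0 <= k y) ->
  (\int[mu]_(s in `[0%R, t]) heat T s k x)%E @[t --> +oo] -->
  (\esum_(y in setT) (G x y * k y)%:E)%E.
Proof.
move=> k0; under eq_fun do rewrite heat_integral_sum//.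
apply: esum_cvg.
  near=> t; have t0 : 0 < t by near: t; exact: nbhs_pinfty_gt.
  move=> y; rewrite mule_ge0 ?heat_integral_ge0 ?lee_fin//= EFinM.
  by apply: lee_wpmul2r; [rewrite lee_fin|exact: heat_integral_le].
by move=> y; rewrite EFinM; apply: cvgeZr => //; exact: heat_integral_cvg.
Unshelve. all: by end_near. Qed.

Let dv : formal_dom b v. Proof. by case: hv. Qed.
Let Hv0 x : 0 <= H v x. Proof. by case: hv. Qed.

Let green_opE x : green_op G (H v) x = \esum_(y in setT) (G x y * H v y)%:E.
Proof. by rewrite /green_op xsum_ge0// => y; rewrite mulr_ge0. Qed.

Lemma green_heat : (forall x, green_op G (H v) x = (v x)%:E) ->
  (forall t x, 0 < t ->
     (heat T t v x + \int[mu]_(s in `[0%R, t]) heat T s (H v) x = (v x)%:E)%E) /\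
  (forall x, heat T t v x @[t --> +oo] --> 0%E).
Proof.
move=> hii.
have part1 t x : 0 < t ->
    (heat T t v x + \int[mu]_(s in `[0%R, t]) heat T s (H v) x = (v x)%:E)%E.
  move=> t0; have t0' := ltW t0; rewrite heat_integral_sum// -hii green_opE.
  rewrite /heat xsum_ge0; last by move=> y; rewrite mulr_ge0 ?p0// ltW.
  (* [v] is expanded as [G (H v)] inside the heat sum; after the exchange of sums [heat_green]
     applies to each pole [y] separately. *)
  rewrite (eq_esum (b := fun z => \esum_(y in setT) (p t x z * (G z y * H v y))%:E)); last first.
    move=> z _; rewrite EFinM -hii green_opE -esumZl ?p0//.
    by move=> y; rewrite lee_fin mulr_ge0.
  rewrite (esum_swap (a := fun z y => (p t x z * (G z y * H v y))%:E)); last first.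
    by move=> z y; rewrite lee_fin !mulr_ge0// p0.
  rewrite -esumD; first last.
  - by move=> y _; rewrite mule_ge0 ?heat_integral_ge0 ?lee_fin.
  - by move=> y _; apply: esum_ge0 => z _; rewrite lee_fin !mulr_ge0// p0.
  apply: eq_esum => y _; rewrite EFinM -(heat_green x y t0).
  have S0 : (0 <= \esum_(z in setT) (p t x z * G z y)%:E)%E.
    by apply: esum_ge0 => z _; rewrite lee_fin mulr_ge0// p0.
  rewrite (ge0_muleDl _ S0 (heat_integral_ge0 t x y)).
  congr (_ + _)%E; rewrite muleC -esumZl//; last first.
    by move=> z; rewrite lee_fin mulr_ge0// p0.
  by apply: eq_esum => z _; rewrite -EFinM; congr EFin; ring.
split=> // x.
have cI := @heat_integral_sum_cvg x _ Hv0; rewrite -green_opE hii in cI.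
have : ((v x)%:E - \int[mu]_(s in `[0%R, t]) heat T s (H v) x)%E @[t --> +oo] -->
    ((v x)%:E - (v x)%:E)%E.
  by apply: cvgeB => //; exact: cvg_cst.
rewrite subee//; apply: cvg_trans; apply: near_eq_cvg; near=> t.
have t0 : 0 < t by near: t; exact: nbhs_pinfty_gt.
have h1 := part1 t x t0.
(* Finiteness allows the integral to be subtracted from both sides of the first identity. *)
have fi : (\int[mu]_(s in `[0%R, t]) heat T s (H v) x)%E \is a fin_num.
  rewrite ge0_fin_numE; last first.
    rewrite heat_integral_sum//; apply: esum_ge0 => y _.
    by rewrite mule_ge0 ?heat_integral_ge0 ?lee_fin.
  apply: (@le_lt_trans _ _ (v x)%:E); last by rewrite ltry.
  rewrite -h1 leeDr// /heat xsum_ge0; last by move=> y; rewrite mulr_ge0 ?p0// ltW.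
  by apply: esum_ge0 => y _; rewrite lee_fin mulr_ge0 ?p0// ltW.
by rewrite -h1 addeK.
Unshelve. all: by end_near. Qed.

Lemma heat_green_op :
  (forall t x, 0 < t ->
     (heat T t v x + \int[mu]_(s in `[0%R, t]) heat T s (H v) x = (v x)%:E)%E) ->
  (forall x, heat T t v x @[t --> +oo] --> 0%E) ->
  forall x, green_op G (H v) x = (v x)%:E.
Proof.
move=> h1 h2 x; rewrite green_opE.
have cI := @heat_integral_sum_cvg x _ Hv0.
have cs : (heat T t v x + \int[mu]_(s in `[0%R, t]) heat T s (H v) x)%E @[t --> +oo] -->
    (0 + \esum_(y in setT) (G x y * H v y)%:E)%E.
  by apply: cvgeD => //; exact: h2.
have cc : (heat T t v x + \int[mu]_(s in `[0%R, t]) heat T s (H v) x)%E @[t --> +oo] -->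
    (v x)%:E.
  apply: cvg_near_cst; near=> t; apply: h1; near: t; exact: nbhs_pinfty_gt.
by rewrite -(cvg_unique (@ereal_hausdorff R) cs cc) add0e.
Unshelve. all: by end_near. Qed.

End HeatGreen.

Theorem theorem26 (R : realType) (X : countType)
    (b : X -> X -> R) (m c : X -> R)
    (T : R -> (X -> R) -> X -> R) (K : nat -> set X) (v : X -> R)
    (hm : forall x, 0 < m x)
    (hb : weighted_graph b)
    (hpos : positive_op b m c)
    (hsub : subcritical b c)
    (hT : semigroup_of b m c T)
    (hK : exhaustion K)
    (hv0 : forall x, 0 < v x)
    (hv : superharmonic_fun b m c v) :
  let G := green b m c K in
  let H := formal_op b m c in
  [<-> (* (i) *)
       forall h : X -> R, harmonic_fun b m c h -> (forall x, `|h x| <= v x) ->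
         forall x, h x = 0;
       (* (ii) *)
       forall x, green_op G (H v) x = (v x)%:E;
       (* (ii), in the form v \in P *)
       potential b G v;
       (* (iii) *)
       (forall (t : R) (x : X), 0 < t ->
          (heat T t v x +
           \int[lebesgue_measure]_(s in `[0%R, t]) heat T s (H v) x)%E
          = (v x)%:E) /\
       (forall x, heat T t v x @[t --> +oo] --> 0%E);
       (* (iv) *)
       forall u : X -> R, superharmonic_fun b m c u -> potential b G u ->
         xsum (fun x => H u x * v x * m x) = xsum (fun x => u x * H v x * m x)].
Proof.
move=> G H; have gp := green_potential hm hb hsub hv0 hv hK.
tfae.
- exact: (no_harmonic_green hm hb hsub hv0 hv hK).
- exact: gp.1.
- by move=> /gp; exact: (green_heat hm hb hsub hv0 hv hK hT).
- move=> [h1 h2].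
  apply: (green_symmetric_pairing hm hb hsub hv0 hv hK).
  exact: (heat_green_op hm hb hsub hv0 hv hK hT).
- move=> /(symmetric_pairing_green hm hb hsub hv0 hv hK).
  exact: (green_no_harmonic hm hb hsub hv0 hv hK).
Qed.
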